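(* Let $f$ be a meromorphic function on a domain $\Omega\subseteq\mathbb{C}$ such that there exist a real number $M>0$, a domain $U\subseteq\Omega$ and an analytic function $F:U\to\mathbb{C}$ with the property that $f=e^F$ on $U$ and $F$ maps $U$ univalently onto the half-plane $H=\{w\in\mathbb{C}: \mathrm{Re}\, w>\log M\}$. Then the flow $\dot z = f(z)$ has infinitely many pairwise disjoint trajectories $z(t)$ on which $z(t)$ tends in finite increasing time from within $U$ to the extended boundary $\partial_\infty\Omega$ of $\Omega$.
   Context: A trajectory of $\dot z = \frac{dz}{dt} = f(z)$ ($t$ real) is a path $z(t)$ in $\Omega$ with $z'(t)=f(z(t))\in\mathbb{C}$ for $t$ in some maximal interval $(\alpha,\beta)\subseteq\mathbb{R}$. Trajectories are disjoint if the corresponding subsets of $\Omega$ are disjoint. The statement that a trajectory $z(t)$ tends in finite increasing time from within $U$ to the extended boundary $\partial_\infty\Omega$ of $\Omega$ means that there exists $T\in\mathbb{R}$ with the following property: to each compact set $K_0\subseteq\Omega$ corresponds $t_0\in(-\infty,T)$ with $z(t)\in U\setminus K_0$ for $t_0<t<T$. *)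

(* Defs.v *)
From Stdlib Require Import Reals List.
From Coquelicot Require Import Coquelicot.
Open Scope R_scope.

Definition connected_set {T : UniformSpace} (D : T -> Prop) : Prop :=
  forall A B : T -> Prop, open A -> open B ->
    (forall x, D x -> A x \/ B x) ->
    (exists x, D x /\ A x) -> (exists x, D x /\ B x) ->
    exists x, D x /\ A x /\ B x.

Definition compact_set {T : UniformSpace} (K : T -> Prop) : Prop :=
  forall (I : Type) (A : I -> T -> Prop),
    (forall i, open (A i)) ->
    (forall x, K x -> exists i, A i x) ->
    exists l : list I, forall x, K x -> exists i, In i l /\ A i x.

Definition is_domain (D : C -> Prop) : Prop :=
  (exists z, D z) /\
  open (T := C_UniformSpace) D /\ connected_set (T := C_UniformSpace) D.

Definition Cexp (z : C) : C :=
  (exp (Re z) * cos (Im z), exp (Re z) * sin (Im z)).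

Definition C_differentiable (g : C -> C) (z : C) : Prop :=
  @ex_derive C_AbsRing C_NormedModule g z.

(** For an open set [D] this depends only on the values of [g] on [D], so an
    analytic function on [D] is represented by any extension of it to [C]. *)
Definition analytic_on (D : C -> Prop) (g : C -> C) : Prop :=
  forall z, D z -> C_differentiable g z.

(** The extended plane: [Some w] is the finite point [w], [None] is infinity. *)
Definition Cbar : Type := option C.

Definition regular_at (f : C -> Cbar) (z0 : C) : Prop :=
  exists g : C -> C,
    locally (T := C_UniformSpace) z0
      (fun z => f z = Some (g z) /\ C_differentiable g z).

Definition pole_at (f : C -> Cbar) (z0 : C) : Prop :=
  f z0 = None /\
  exists g : C -> C,
    locally' (T := C_UniformSpace) z0
      (fun z => f z = Some (g z) /\ C_differentiable g z) /\
    filterlim (fun z => Cmod (g z)) (locally' (T := C_UniformSpace) z0)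
      (Rbar_locally p_infty).

Definition meromorphic_on (D : C -> Prop) (f : C -> Cbar) : Prop :=
  forall z0, D z0 -> regular_at f z0 \/ pole_at f z0.

Definition half_plane (c : R) (w : C) : Prop := c < Re w.

Definition maps_univalently_onto (F : C -> C) (U H : C -> Prop) : Prop :=
  analytic_on U F /\
  (forall z1 z2, U z1 -> U z2 -> F z1 = F z2 -> z1 = z2) /\
  (forall w, H w <-> exists z, U z /\ F z = w).

(** A path on the open interval [(lo, hi)]; values of [pt] elsewhere are
    irrelevant. *)
Record path : Type := Path { lo : Rbar; hi : Rbar; pt :> R -> C }.

Definition in_dom (z : path) (t : R) : Prop :=
  Rbar_lt (lo z) t /\ Rbar_lt t (hi z).

Definition image (z : path) (w : C) : Prop :=
  exists t, in_dom z t /\ z t = w.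

(** The requirement that [f (z t)] be finite keeps the path off the poles. *)
Definition solution (Omega : C -> Prop) (f : C -> Cbar) (z : path) : Prop :=
  Rbar_lt (lo z) (hi z) /\
  forall t, in_dom z t ->
    Omega (z t) /\
    exists v : C, f (z t) = Some v /\
      @is_derive R_AbsRing C_R_NormedModule z t v.

Definition extends (y z : path) : Prop :=
  Rbar_le (lo y) (lo z) /\ Rbar_le (hi z) (hi y) /\
  forall t, in_dom z t -> y t = z t.

Definition trajectory (Omega : C -> Prop) (f : C -> Cbar) (z : path) : Prop :=
  solution Omega f z /\
  forall y, solution Omega f y -> extends y z -> lo y = lo z /\ hi y = hi z.

Definition disjoint_paths (y z : path) : Prop :=
  forall w, ~ (image y w /\ image z w).

Definition tends_to_boundary_in_finite_time
    (Omega U : C -> Prop) (z : path) : Prop :=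
  exists T : R, forall K0 : C -> Prop,
    compact_set (T := C_UniformSpace) K0 -> (forall w, K0 w -> Omega w) ->
    exists t0 : R, t0 < T /\
      forall t, t0 < t < T -> in_dom z t /\ U (z t) /\ ~ K0 (z t).

(* Main.v *)
Require Import Defs.
From Stdlib Require Import Reals Lra Lia List ClassicalEpsilon.
From Coquelicot Require Import Coquelicot.
Open Scope R_scope.

(** In the coordinate [w = F z], with [G] the inverse of [F], the flow becomes
    [dw/dt = exp w / G' w], that is [dt = h w dw] with [h w = exp (- w) G' w].
    A weak form of Koebe's distortion theorem (obtained from Bloch's theorem
    applied to branches of [log (G - G w0)]) gives
    [G'' / G' = O (1 / (Re w - log M))], so [h] behaves like [exp (- w)] far to
    the right: [Phi w], the integral of [h] from [w] to infinity along a
    horizontal line, is close to [h w], and [psi = - log Phi] is a univalent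
    coordinate with [psi'] close to 1.  In it the trajectories with [Phi = - t]
    are the explicit horizontal lines [psi = - log (- t) + 2 pi i k], which reach
    [Re w = infinity] at time 0.

    They leave every compact subset of [Omega]: since [|f| = exp (Re w)] is
    unbounded, they could only accumulate at a pole; then [G] would map a far
    half-plane into a small disc around the pole, where [1 / f] would take the
    value [exp (- w)] at all the distinct points [G (w + 2 pi i k)], contrary to
    the identity theorem.  Uniqueness for the flow keeps the maximal extensions
    disjoint. *)

(** * Complex and path derivatives *)

(** No existence theorem for differential equations enters: the arcs are explicit in the coordinate
    [psi], maximal trajectories come from gluing extensions, and only uniqueness is proved for the
    flow. A crude distortion constant is enough because its size only decides how far to the right
    one must start. Beyond [c + 20 * distortion_const] one has [|h' + h| <= |h| / 20], and this
    number 20 produces all later constants: the decay rate 19/20, the error 1/19 for [Phi], the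
    error 1/18 for [psi']. In the coordinate [psi] the flow is [d psi/dt = exp psi], whose right
    side has period [2 pi i]. So one real solution gives a line at every height [2 pi k], and all of
    them end at the same time 0. This common time settles disjointness: the flow is autonomous, so
    trajectories that meet differ by a time shift; the shift must vanish, since each leaves compact
    sets exactly at time 0; then they agree up to time 0, where the imaginary part of [psi]
    separates them. Cauchy theory is needed only on segments and circles, by differentiating under
    the integral sign. *)

(* One notion of derivative for both [phi = id] (complex) and [phi = RtoC]
   (curves), so that the calculus rules are proved once. *)
Definition gder {T : Type} (phi f : T -> C) (x : T) (l : C) : Prop :=
  forall eps, 0 < eps -> exists delta, 0 < delta /\ forall y,
    Cmod (phi y - phi x) < delta ->
    Cmod (f y - f x - l * (phi y - phi x)) <= eps * Cmod (phi y - phi x).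

Definition gcont {T : Type} (phi f : T -> C) (x : T) : Prop :=
  forall eps, 0 < eps -> exists delta, 0 < delta /\ forall y,
    Cmod (phi y - phi x) < delta -> Cmod (f y - f x) < eps.

Notation cder := (gder (fun z : C => z)).
Notation ccont := (gcont (fun z : C => z)).
Notation pder := (gder RtoC).
Notation pcont := (gcont RtoC).

Lemma Cmod_sym (a b : C) : Cmod (a - b) = Cmod (b - a).
Proof. rewrite <- Cmod_opp. f_equal. ring. Qed.

Lemma Cmod_tri (a b c : C) : Cmod (a - c) <= Cmod (a - b) + Cmod (b - c).
Proof. replace (a - c)%C with ((a - b) + (b - c))%C by ring. apply Cmod_triangle. Qed.

Lemma Cmod_tri_inv (a b : C) : Cmod a - Cmod b <= Cmod (a - b).
Proof.
  generalize (Cmod_triangle (a - b) b).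
  replace (a - b + b)%C with a by ring. lra.
Qed.

Lemma Cmod_pos (z : C) : z <> 0 -> 0 < Cmod z.
Proof. apply Cmod_gt_0. Qed.

Lemma Cmod_zero (z : C) : Cmod z <= 0 -> z = 0.
Proof. intros H. apply Cmod_eq_0. generalize (Cmod_ge_0 z). lra. Qed.

Lemma Csub_neq (a b : C) : a <> b -> (a - b)%C <> 0.
Proof. intros H E. apply H. replace a with (a - b + b)%C by ring. rewrite E. ring. Qed.

Lemma Csub_eq (a b : C) : (a - b = 0)%C -> a = b.
Proof. intros E. replace a with (a - b + b)%C by ring. rewrite E. ring. Qed.

Lemma Cmod_RtoC_sub (x y : R) : Cmod (RtoC x - RtoC y) = Rabs (x - y).
Proof. rewrite <- RtoC_minus. apply Cmod_R. Qed.

Section Rules.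
Context {T : Type} (phi : T -> C).

Lemma gder_gcont (f : T -> C) (x : T) (l : C) : gder phi f x l -> gcont phi f x.
Proof.
  intros H eps He. destruct (H 1 ltac:(lra)) as [d [Hd H1]].
  assert (Hl : 0 <= Cmod l) by apply Cmod_ge_0.
  exists (Rmin d (eps / (Cmod l + 2))). split.
  - apply Rmin_pos; [lra|]. apply Rdiv_lt_0_compat; lra.
  - intros y Hy. specialize (H1 y).
    assert (Hy1 := Rlt_le_trans _ _ _ Hy (Rmin_l _ _)).
    assert (Hy2 := Rlt_le_trans _ _ _ Hy (Rmin_r _ _)).
    specialize (H1 Hy1). set (k := (phi y - phi x)%C) in *.
    replace (f y - f x)%C with ((f y - f x - l * k) + l * k)%C by ring.
    eapply Rle_lt_trans; [apply Cmod_triangle|]. rewrite Cmod_mult.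
    apply Rle_lt_trans with ((Cmod l + 1) * Cmod k); [lra|].
    apply (Rmult_lt_compat_r (Cmod l + 2)) in Hy2; [|lra].
    unfold Rdiv in Hy2. rewrite Rmult_assoc, Rinv_l, Rmult_1_r in Hy2 by lra.
    generalize (Cmod_ge_0 k). nra.
Qed.

Lemma gder_ext_loc (f g : T -> C) (x : T) (l : C) (d : R) : 0 < d ->
  (forall y, Cmod (phi y - phi x) < d -> f y = g y) ->
  gder phi f x l -> gder phi g x l.
Proof.
  intros Hd E H eps He. destruct (H eps He) as [d1 [Hd1 H1]].
  exists (Rmin d d1). split; [apply Rmin_pos; lra|]. intros y Hy.
  rewrite <- !E.
  - apply H1. eapply Rlt_le_trans; [apply Hy|apply Rmin_r].
  - replace (phi x - phi x)%C with (RtoC 0) by ring. rewrite Cmod_0. lra.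
  - eapply Rlt_le_trans; [apply Hy|apply Rmin_l].
Qed.

Lemma gder_ext (f g : T -> C) (x : T) (l : C) :
  (forall y, f y = g y) -> gder phi f x l -> gder phi g x l.
Proof. intros E. apply gder_ext_loc with 1; [lra|auto]. Qed.

Lemma gcont_ext_loc (f g : T -> C) (x : T) (d : R) : 0 < d ->
  (forall y, Cmod (phi y - phi x) < d -> f y = g y) ->
  gcont phi f x -> gcont phi g x.
Proof.
  intros Hd E H eps He. destruct (H eps He) as [d1 [Hd1 H1]].
  exists (Rmin d d1). split; [apply Rmin_pos; lra|]. intros y Hy.
  rewrite <- !E.
  - apply H1. eapply Rlt_le_trans; [apply Hy|apply Rmin_r].
  - replace (phi x - phi x)%C with (RtoC 0) by ring. rewrite Cmod_0. lra.
  - eapply Rlt_le_trans; [apply Hy|apply Rmin_l].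
Qed.

Lemma gcont_ext (f g : T -> C) (x : T) :
  (forall y, f y = g y) -> gcont phi f x -> gcont phi g x.
Proof. intros E. apply gcont_ext_loc with 1; [lra|auto]. Qed.

Lemma gder_const (c : C) (x : T) : gder phi (fun _ => c) x 0.
Proof.
  intros eps He. exists 1. split; [lra|]. intros y _.
  replace (c - c - 0 * (phi y - phi x))%C with (RtoC 0) by ring.
  rewrite Cmod_0. generalize (Cmod_ge_0 (phi y - phi x)). nra.
Qed.

Lemma gder_phi (x : T) : gder phi phi x 1.
Proof.
  intros eps He. exists 1. split; [lra|]. intros y _.
  replace (phi y - phi x - 1 * (phi y - phi x))%C with (RtoC 0) by ring.
  rewrite Cmod_0. generalize (Cmod_ge_0 (phi y - phi x)). nra.
Qed.

Lemma gder_plus (f g : T -> C) (x : T) (l m : C) :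
  gder phi f x l -> gder phi g x m -> gder phi (fun y => f y + g y)%C x (l + m)%C.
Proof.
  intros Hf Hg eps He.
  destruct (Hf (eps / 2) ltac:(lra)) as [d1 [Hd1 H1]].
  destruct (Hg (eps / 2) ltac:(lra)) as [d2 [Hd2 H2]].
  exists (Rmin d1 d2). split; [apply Rmin_pos; lra|]. intros y Hy.
  specialize (H1 y (Rlt_le_trans _ _ _ Hy (Rmin_l _ _))).
  specialize (H2 y (Rlt_le_trans _ _ _ Hy (Rmin_r _ _))).
  set (k := (phi y - phi x)%C) in *.
  replace (f y + g y - (f x + g x) - (l + m) * k)%C
    with ((f y - f x - l * k) + (g y - g x - m * k))%C by ring.
  eapply Rle_trans; [apply Cmod_triangle|]. lra.
Qed.

Lemma gcont_const (c : C) (x : T) : gcont phi (fun _ => c) x.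
Proof. eapply gder_gcont, gder_const. Qed.

Lemma gcont_phi (x : T) : gcont phi phi x.
Proof. eapply gder_gcont, gder_phi. Qed.

Lemma gcont_comp (f : C -> C) (g : T -> C) (x : T) :
  ccont f (g x) -> gcont phi g x -> gcont phi (fun y => f (g y)) x.
Proof.
  intros Hf Hg eps He. destruct (Hf eps He) as [d1 [Hd1 H1]].
  destruct (Hg d1 Hd1) as [d2 [Hd2 H2]]. exists d2. split; auto.
Qed.

(** The outer function is always complex and only the inner one depends on [phi], so one rule serves
    composition of holomorphic maps and maps applied to curves. *)
Lemma gder_comp (f : C -> C) (g : T -> C) (x : T) (l m : C) :
  cder f (g x) l -> gder phi g x m -> gder phi (fun y => f (g y)) x (l * m)%C.
Proof.
  intros Hf Hg eps He.
  assert (Hl : 0 <= Cmod l) by apply Cmod_ge_0.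
  assert (Hm : 0 <= Cmod m) by apply Cmod_ge_0.
  set (e1 := eps / (2 * (Cmod m + 1))). set (e2 := Rmin 1 (eps / (2 * (Cmod l + 1)))).
  assert (He1 : 0 < e1) by (apply Rdiv_lt_0_compat; lra).
  assert (He2 : 0 < e2) by (apply Rmin_pos; [lra|apply Rdiv_lt_0_compat; lra]).
  destruct (Hf e1 He1) as [d1 [Hd1 H1]].
  destruct (Hg e2 He2) as [d2 [Hd2 H2]].
  destruct (gder_gcont _ _ _ Hg d1 Hd1) as [d3 [Hd3 H3]].
  exists (Rmin d2 d3). split; [apply Rmin_pos; lra|]. intros y Hy.
  specialize (H2 y (Rlt_le_trans _ _ _ Hy (Rmin_l _ _))).
  specialize (H3 y (Rlt_le_trans _ _ _ Hy (Rmin_r _ _))).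
  specialize (H1 (g y) H3).
  set (k := (phi y - phi x)%C) in *.
  replace (f (g y) - f (g x) - l * m * k)%C
    with ((f (g y) - f (g x) - l * (g y - g x)) + l * (g y - g x - m * k))%C by ring.
  eapply Rle_trans; [apply Cmod_triangle|]. rewrite Cmod_mult.
  assert (Hk := Cmod_ge_0 k).
  assert (B : Cmod (g y - g x) <= (Cmod m + 1) * Cmod k).
  { replace (g y - g x)%C with ((g y - g x - m * k) + m * k)%C by ring.
    eapply Rle_trans; [apply Cmod_triangle|]. rewrite Cmod_mult.
    assert (e2 <= 1) by apply Rmin_l. nra. }
  assert (E1 : e1 * (Cmod m + 1) = eps / 2) by (unfold e1; field; lra).
  assert (E2 : e2 * (Cmod l + 1) <= eps / 2).
  { apply Rle_trans with (eps / (2 * (Cmod l + 1)) * (Cmod l + 1)).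
    - apply Rmult_le_compat_r; [lra|apply Rmin_r].
    - right. field. lra. }
  assert (Cmod l * Cmod (g y - g x - m * k) <= Cmod l * (e2 * Cmod k))
    by (apply Rmult_le_compat_l; lra).
  assert (e1 * Cmod (g y - g x) <= e1 * ((Cmod m + 1) * Cmod k))
    by (apply Rmult_le_compat_l; lra).
  assert (e1 * ((Cmod m + 1) * Cmod k) = eps / 2 * Cmod k) by (rewrite <- E1; ring).
  assert (Cmod l * e2 <= eps / 2) by nra.
  nra.
Qed.

End Rules.

Lemma cder_scal (c z : C) : cder (fun y => c * y)%C z c.
Proof.
  intros eps He. exists 1. split; [lra|]. intros y _.
  replace (c * y - c * z - c * (y - z))%C with (RtoC 0) by ring.
  rewrite Cmod_0. generalize (Cmod_ge_0 (y - z)). nra.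
Qed.

Lemma cder_sqr (z : C) : cder (fun y => y * y)%C z (2 * z)%C.
Proof.
  intros eps He. exists eps. split; [lra|]. intros y Hy.
  replace (y * y - z * z - 2 * z * (y - z))%C with ((y - z) * (y - z))%C by ring.
  rewrite Cmod_mult. apply Rmult_le_compat_r; [apply Cmod_ge_0|lra].
Qed.

Lemma cder_inv (z : C) : z <> 0 -> cder Cinv z (- (/ (z * z)))%C.
Proof.
  intros Hz eps He. assert (Hp := Cmod_pos z Hz). set (r := Cmod z) in *.
  exists (Rmin (r / 2) (eps * (r * r * r) / 2)).
  assert (Hr3 : 0 < r * r * r) by (repeat apply Rmult_lt_0_compat; lra).
  split. { apply Rmin_pos; [lra|]. apply Rdiv_lt_0_compat; [nra|lra]. }
  intros y Hy.
  assert (Hy1 := Rlt_le_trans _ _ _ Hy (Rmin_l _ _)).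
  assert (Hy2 := Rlt_le_trans _ _ _ Hy (Rmin_r _ _)).
  assert (Hy3 : r / 2 <= Cmod y).
  { generalize (Cmod_tri_inv z y). rewrite Cmod_sym. fold r. lra. }
  assert (Hy0 : y <> 0) by (intros ->; rewrite Cmod_0 in Hy3; lra).
  replace (/ y - / z - - / (z * z) * (y - z))%C
    with ((y - z) * (y - z) * / (z * z * y))%C by (field; auto).
  rewrite !Cmod_mult, Cmod_inv, !Cmod_mult by (repeat apply Cmult_neq_0; auto).
  fold r. set (k := Cmod (y - z)) in *.
  assert (0 <= k) by apply Cmod_ge_0.
  assert (Hd : 0 < r * r * Cmod y) by (repeat apply Rmult_lt_0_compat; lra).
  apply Rmult_le_reg_r with (r * r * Cmod y); [exact Hd|].
  rewrite Rmult_assoc, Rinv_l, Rmult_1_r by lra.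
  assert (r * r * (r / 2) <= r * r * Cmod y) by (apply Rmult_le_compat_l; nra).
  assert (k <= eps * (r * r * Cmod y)) by nra. nra.
Qed.

Lemma gder_scal {T : Type} (phi f : T -> C) (x : T) (l c : C) :
  gder phi f x l -> gder phi (fun y => c * f y)%C x (c * l)%C.
Proof. intros H. apply (gder_comp phi (fun y => c * y)%C f); [apply cder_scal|auto]. Qed.

Lemma gder_opp {T : Type} (phi f : T -> C) (x : T) (l : C) :
  gder phi f x l -> gder phi (fun y => - f y)%C x (- l)%C.
Proof.
  intros H. replace (- l)%C with (- (1) * l)%C by ring.
  apply gder_ext with (fun y => - (1) * f y)%C; [intros; ring|].
  apply gder_scal, H.
Qed.

Lemma gder_minus {T : Type} (phi f g : T -> C) (x : T) (l m : C) :
  gder phi f x l -> gder phi g x m -> gder phi (fun y => f y - g y)%C x (l - m)%C.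
Proof. intros Hf Hg. apply gder_plus; [auto|apply gder_opp; auto]. Qed.

(* Polarisation [4 f g = (f + g)^2 - (f - g)^2] reduces products to squares. *)
Lemma gder_mult {T : Type} (phi f g : T -> C) (x : T) (l m : C) :
  gder phi f x l -> gder phi g x m ->
  gder phi (fun y => f y * g y)%C x (l * g x + f x * m)%C.
Proof.
  intros Hf Hg.
  apply gder_ext with (fun y => / 4 * ((f y + g y) * (f y + g y)
     - (f y - g y) * (f y - g y)))%C; [intros; field|].
  replace (l * g x + f x * m)%C with
    (/ 4 * (2 * (f x + g x) * (l + m) - 2 * (f x - g x) * (l - m)))%C by field.
  apply gder_scal, gder_minus.
  - apply (gder_comp phi (fun y => y * y)%C (fun y => f y + g y)%C);
      [apply cder_sqr|apply gder_plus; auto].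
  - apply (gder_comp phi (fun y => y * y)%C (fun y => f y - g y)%C);
      [apply cder_sqr|apply gder_minus; auto].
Qed.

Lemma gder_inv {T : Type} (phi f : T -> C) (x : T) (l : C) : f x <> 0 ->
  gder phi f x l -> gder phi (fun y => / f y)%C x (- l / (f x * f x))%C.
Proof.
  intros H0 H. replace (- l / (f x * f x))%C with (- (/ (f x * f x)) * l)%C
    by (field; auto).
  apply (gder_comp phi Cinv f); [apply cder_inv|]; auto.
Qed.

Lemma gder_div {T : Type} (phi f g : T -> C) (x : T) (l m : C) : g x <> 0 ->
  gder phi f x l -> gder phi g x m ->
  gder phi (fun y => f y / g y)%C x ((l * g x - f x * m) / (g x * g x))%C.
Proof.
  intros H0 Hf Hg.
  replace ((l * g x - f x * m) / (g x * g x))%C with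
    (l * / g x + f x * (- m / (g x * g x)))%C by (field; auto).
  apply (gder_mult phi f (fun y => / g y)%C); [|apply gder_inv]; auto.
Qed.

Section ContRules.
Context {T : Type} (phi : T -> C).

Lemma gcont_plus (f g : T -> C) (x : T) :
  gcont phi f x -> gcont phi g x -> gcont phi (fun y => f y + g y)%C x.
Proof.
  intros Hf Hg eps He. destruct (Hf (eps / 2) ltac:(lra)) as [d1 [Hd1 H1]].
  destruct (Hg (eps / 2) ltac:(lra)) as [d2 [Hd2 H2]].
  exists (Rmin d1 d2). split; [apply Rmin_pos; lra|]. intros y Hy.
  specialize (H1 y (Rlt_le_trans _ _ _ Hy (Rmin_l _ _))).
  specialize (H2 y (Rlt_le_trans _ _ _ Hy (Rmin_r _ _))).
  replace (f y + g y - (f x + g x))%C with ((f y - f x) + (g y - g x))%C by ring.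
  eapply Rle_lt_trans; [apply Cmod_triangle|]. lra.
Qed.

Lemma gcont_scal (f : T -> C) (x : T) (c : C) :
  gcont phi f x -> gcont phi (fun y => c * f y)%C x.
Proof.
  intros H. apply (gcont_comp phi (fun y => c * y)%C f); auto.
  eapply gder_gcont, cder_scal.
Qed.

Lemma gcont_minus (f g : T -> C) (x : T) :
  gcont phi f x -> gcont phi g x -> gcont phi (fun y => f y - g y)%C x.
Proof.
  intros Hf Hg. apply gcont_ext with (fun y => f y + - (1) * g y)%C; [intros; ring|].
  apply gcont_plus; [|apply gcont_scal]; auto.
Qed.

Lemma gcont_mult (f g : T -> C) (x : T) :
  gcont phi f x -> gcont phi g x -> gcont phi (fun y => f y * g y)%C x.
Proof.
  intros Hf Hg.
  apply gcont_ext with (fun y => / 4 * ((f y + g y) * (f y + g y)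
     - (f y - g y) * (f y - g y)))%C; [intros; field|].
  apply gcont_scal, gcont_minus.
  - apply (gcont_comp phi (fun y => y * y)%C (fun y => f y + g y)%C);
      [eapply gder_gcont, cder_sqr|apply gcont_plus; auto].
  - apply (gcont_comp phi (fun y => y * y)%C (fun y => f y - g y)%C);
      [eapply gder_gcont, cder_sqr|apply gcont_minus; auto].
Qed.

End ContRules.

Lemma cder_unique (f : C -> C) (z l m : C) : cder f z l -> cder f z m -> l = m.
Proof.
  intros Hl Hm. apply NNPP; intros N. apply Csub_neq, Cmod_pos in N.
  set (e := Cmod (l - m) / 3).
  destruct (Hl e ltac:(unfold e; lra)) as [d1 [Hd1 H1]].
  destruct (Hm e ltac:(unfold e; lra)) as [d2 [Hd2 H2]].
  set (h := Rmin d1 d2 / 2).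
  assert (Hh : 0 < h) by (generalize (Rmin_pos _ _ Hd1 Hd2); unfold h; lra).
  assert (E : (z + h - z = h)%C) by ring.
  specialize (H1 (z + h)%C). specialize (H2 (z + h)%C). rewrite E in *.
  rewrite Cmod_R, Rabs_pos_eq in H1, H2 by lra.
  specialize (H1 ltac:(generalize (Rmin_l d1 d2); unfold h in *; lra)).
  specialize (H2 ltac:(generalize (Rmin_r d1 d2); unfold h in *; lra)).
  assert (Cmod ((l - m) * h) <= e * h + e * h).
  { replace ((l - m) * h)%C with
      ((f (z + h)%C - f z - m * h) - (f (z + h)%C - f z - l * h))%C by ring.
    unfold Cminus at 1. eapply Rle_trans; [apply Cmod_triangle|].
    rewrite Cmod_opp. lra. }
  rewrite Cmod_mult, Cmod_R, Rabs_pos_eq in H by lra.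
  unfold e in *. nra.
Qed.

(* Meaningful only where [f] is complex differentiable. *)
Definition cD (f : C -> C) (z : C) : C := epsilon (inhabits (RtoC 0)) (cder f z).

Lemma cD_correct (f : C -> C) (z : C) : (exists l, cder f z l) -> cder f z (cD f z).
Proof. intros H. unfold cD. apply epsilon_spec. exact H. Qed.

Lemma cD_unique (f : C -> C) (z l : C) : cder f z l -> cD f z = l.
Proof. intros H. apply cder_unique with f z; [apply cD_correct; eauto|auto]. Qed.

(** * Open sets and holomorphic functions *)

Definition cball (a : C) (r : R) (z : C) : Prop := Cmod (z - a) < r.

Definition copen (D : C -> Prop) : Prop :=
  forall z, D z -> exists r, 0 < r /\ forall y, cball z r y -> D y.

Definition hol (D : C -> Prop) (f : C -> C) : Prop := forall z, D z -> exists l, cder f z l.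

Lemma cball_open (a : C) (r : R) : copen (cball a r).
Proof.
  intros z Hz. exists (r - Cmod (z - a)). unfold cball in *. split; [lra|].
  intros y Hy. generalize (Cmod_tri y z a). lra.
Qed.

Lemma hol_ccont (D : C -> Prop) (f : C -> C) (z : C) : hol D f -> D z -> ccont f z.
Proof. intros H Hz. destruct (H z Hz) as [l Hl]. eapply gder_gcont, Hl. Qed.

Lemma hol_cD (D : C -> Prop) (f : C -> C) (z : C) : hol D f -> D z -> cder f z (cD f z).
Proof. intros H Hz. apply cD_correct, H, Hz. Qed.

Lemma hol_sub (D E : C -> Prop) (f : C -> C) : (forall z, E z -> D z) -> hol D f -> hol E f.
Proof. intros S H z Hz. apply H, S, Hz. Qed.

Lemma gder_eq {T : Type} (phi f : T -> C) (x : T) (l m : C) :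
  l = m -> gder phi f x l -> gder phi f x m.
Proof. intros ->; auto. Qed.

(** * Integrals along paths *)

Lemma norm_Cmod (z : C) : @norm R_AbsRing C_R_NormedModule z = Cmod z.
Proof. symmetry. apply Cmod_norm. Qed.

Lemma pder_is_derive (g : R -> C) (t : R) (l : C) :
  pder g t l <-> @is_derive R_AbsRing C_R_NormedModule g t l.
Proof.
  assert (E : forall y : R,
     @minus C_R_NormedModule (minus (g y) (g t)) (scal (minus y t) l)
       = (g y - g t - l * (RtoC y - RtoC t))%C).
  { intros y. unfold minus, plus, opp, scal; simpl. unfold prod_plus, prod_opp, prod_scal, plus, opp, scal; simpl.
    unfold mult; simpl. apply injective_projections; simpl; ring. }
  split; intros H.
  - split; [apply is_linear_scal_l|].
    intros x Hx. apply (is_filter_lim_locally_unique (K := R_AbsRing) (V := R_NormedModule)) in Hx.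
    subst x. intros eps. destruct (H eps (cond_pos eps)) as [d [Hd H1]].
    exists (mkposreal d Hd). intros y Hy.
    specialize (H1 y). rewrite Cmod_RtoC_sub in H1. specialize (H1 Hy).
    rewrite <- E, <- norm_Cmod in H1. exact H1.
  - intros eps He. destruct H as [_ H].
    destruct (H t (fun P HP => HP) (mkposreal eps He)) as [d H1].
    exists d. split; [apply cond_pos|]. intros y Hy.
    rewrite Cmod_RtoC_sub in Hy. specialize (H1 y Hy).
    rewrite <- E, <- norm_Cmod, Cmod_RtoC_sub. exact H1.
Qed.

Lemma cder_is_derive (f : C -> C) (z l : C) :
  cder f z l <-> @is_derive C_AbsRing C_NormedModule f z l.
Proof.
  assert (E : forall y : C,
     @minus C_NormedModule (minus (f y) (f z)) (scal (minus y z) l)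
       = (f y - f z - l * (y - z))%C).
  { intros y. unfold minus, plus, opp, scal; simpl. unfold mult; simpl. ring. }
  split; intros H.
  - split; [apply is_linear_scal_l|].
    intros x Hx. apply (is_filter_lim_locally_unique (K := C_AbsRing) (V := AbsRing_NormedModule C_AbsRing)) in Hx.
    subst x. intros eps. destruct (H eps (cond_pos eps)) as [d [Hd H1]].
    exists (mkposreal d Hd). intros y Hy. specialize (H1 y Hy).
    rewrite <- E in H1. exact H1.
  - intros eps He. destruct H as [_ H].
    destruct (H z (fun P HP => HP) (mkposreal eps He)) as [d H1].
    exists d. split; [apply cond_pos|]. intros y Hy.
    specialize (H1 y Hy). rewrite <- E. exact H1.
Qed.

Lemma pcont_continuous (g : R -> C) (t : R) :
  pcont g t <-> @continuous R_UniformSpace C_R_NormedModule g t.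
Proof.
  split; intros H.
  - intros P [eps HP]. destruct (H eps (cond_pos eps)) as [d [Hd H1]].
    exists (mkposreal d Hd). intros y Hy. apply HP.
    specialize (H1 y). rewrite Cmod_RtoC_sub in H1. specialize (H1 Hy).
    apply C_NormedModule_mixin_compat1. exact H1.
  - intros eps He.
    (* The balls of [C_UniformSpace] are squares; the square of half-side [r] lies in the disc of
       radius [sqrt 2 * r]. *)
    assert (Hs : 0 < sqrt 2) by (apply sqrt_lt_R0; lra).
    assert (He2 : 0 < eps / sqrt 2) by (apply Rdiv_lt_0_compat; lra).
    destruct (H (ball (M := C_UniformSpace) (g t) (mkposreal _ He2))) as [d H1].
    { exists (mkposreal _ He2). auto. }
    exists d. split; [apply cond_pos|]. intros y Hy. rewrite Cmod_RtoC_sub in Hy.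
    specialize (H1 y Hy). apply C_NormedModule_mixin_compat2 in H1.
    simpl in H1. replace (sqrt 2 * (eps / sqrt 2)) with eps in H1 by (field; lra).
    exact H1.
Qed.

Definition Cint (g : R -> C) (a b : R) : C := @RInt C_R_CompleteNormedModule g a b.

Definition pcont_on (g : R -> C) (a b : R) : Prop := forall t, a <= t <= b -> pcont g t.

Lemma Cint_correct (g : R -> C) (a b : R) : a <= b -> pcont_on g a b ->
  @is_RInt C_R_NormedModule g a b (Cint g a b).
Proof.
  intros Hab Hg. apply (RInt_correct (V := C_R_CompleteNormedModule)).
  apply (ex_RInt_continuous (V := C_R_CompleteNormedModule)). intros t Ht.
  rewrite Rmin_left, Rmax_right in Ht by lra. apply pcont_continuous, Hg, Ht.
Qed.

Lemma Cint_unique (g : R -> C) (a b : R) (l : C) :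
  @is_RInt C_R_NormedModule g a b l -> Cint g a b = l.
Proof. apply (is_RInt_unique (V := C_R_CompleteNormedModule)). Qed.

Lemma Cint_ext (f g : R -> C) (a b : R) : a <= b ->
  (forall t, a <= t <= b -> f t = g t) -> Cint f a b = Cint g a b.
Proof.
  intros Hab E. apply (RInt_ext (V := C_R_CompleteNormedModule)).
  intros t Ht. rewrite Rmin_left, Rmax_right in Ht by lra. apply E. lra.
Qed.

Lemma Cint_ftc (G g : R -> C) (a b : R) : a <= b ->
  (forall t, a <= t <= b -> pder G t (g t)) -> pcont_on g a b ->
  Cint g a b = (G b - G a)%C.
Proof.
  intros Hab HG Hg. apply Cint_unique.
  apply (is_RInt_derive (V := C_R_CompleteNormedModule) G g);
    intros t Ht; rewrite Rmin_left, Rmax_right in Ht by lra.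
  - apply pder_is_derive, HG, Ht.
  - apply pcont_continuous, Hg, Ht.
Qed.

Lemma Cint_norm (g : R -> C) (a b M : R) : a <= b -> pcont_on g a b ->
  (forall t, a <= t <= b -> Cmod (g t) <= M) -> Cmod (Cint g a b) <= (b - a) * M.
Proof.
  intros Hab Hg HM. rewrite <- norm_Cmod.
  apply (norm_RInt_le_const (V := C_R_NormedModule) g); auto.
  - intros t Ht. rewrite norm_Cmod. auto.
  - apply Cint_correct; auto.
Qed.

(** The integral is taken in a real vector space, so linearity over [C] has to be checked on the two
    coordinates. *)
Lemma Cint_scal (c : C) (g : R -> C) (a b : R) : a <= b -> pcont_on g a b ->
  Cint (fun t => c * g t)%C a b = (c * Cint g a b)%C.
Proof.
  intros Hab Hg. apply Cint_unique. assert (H := Cint_correct g a b Hab Hg).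
  assert (H1 := is_RInt_fct_extend_fst (U := R_NormedModule) (V := R_NormedModule) _ _ _ _ H).
  assert (H2 := is_RInt_fct_extend_snd (U := R_NormedModule) (V := R_NormedModule) _ _ _ _ H).
  apply (is_RInt_fct_extend_pair (U := R_NormedModule) (V := R_NormedModule)).
  - apply (is_RInt_minus (V := R_NormedModule) (fun t => fst c * fst (g t)) (fun t => snd c * snd (g t)));
      apply (is_RInt_scal (V := R_NormedModule)); auto.
  - apply (is_RInt_plus (V := R_NormedModule) (fun t => fst c * snd (g t)) (fun t => snd c * fst (g t)));
      apply (is_RInt_scal (V := R_NormedModule)); auto.
Qed.

Lemma Cint_minus (f g : R -> C) (a b : R) : a <= b -> pcont_on f a b -> pcont_on g a b ->
  Cint (fun t => f t - g t)%C a b = (Cint f a b - Cint g a b)%C.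
Proof.
  intros. apply Cint_unique. apply (is_RInt_minus (V := C_R_NormedModule));
    apply Cint_correct; auto.
Qed.

Lemma Cint_Chasles (g : R -> C) (a b c : R) : a <= b <= c -> pcont_on g a c ->
  (Cint g a b + Cint g b c)%C = Cint g a c.
Proof.
  intros Hab Hg. symmetry. apply Cint_unique.
  apply (is_RInt_Chasles (V := C_R_NormedModule) _ _ b);
    (apply Cint_correct; [lra|intros t Ht; apply Hg; lra]).
Qed.

Lemma Cint_const (c : C) (a b : R) : a <= b -> Cint (fun _ => c) a b = ((b - a) * c)%C.
Proof.
  intros Hab. rewrite (Cint_ftc (fun t => c * t)%C (fun _ => c)); auto.
  - ring.
  - intros t _. apply gder_eq with (c * 1)%C; [ring|]. apply (gder_scal RtoC RtoC), gder_phi.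
  - intros t _. apply gcont_const.
Qed.

Lemma pcont_linear (a b : C) (t : R) : pcont (fun s => a + RtoC s * b)%C t.
Proof. apply gcont_plus; [apply gcont_const|]. apply gcont_mult; [apply gcont_phi|apply gcont_const]. Qed.

Lemma pder_linear (a b : C) (t : R) : pder (fun s => a + RtoC s * b)%C t b.
Proof.
  apply gder_eq with (0 + (1 * b + RtoC t * 0))%C; [ring|].
  apply (gder_plus RtoC (fun _ => a)); [apply gder_const|].
  apply (gder_mult RtoC RtoC (fun _ => b)); [apply gder_phi|apply gder_const].
Qed.

(** The factor [c] chooses the direction of projection: [1] and [- Ci] give the coordinates, the
    conjugate of an increment gives its modulus. *)
Lemma pder_Re (g : R -> C) (t : R) (l c : C) :
  pder g t l -> is_derive (fun s => Re (c * g s)) t (Re (c * l)).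
Proof.
  intros H. apply pder_is_derive in H.
  assert (H1 : is_derive (fun s => fst (g s)) t (fst l)).
  { destruct H as [_ H]. split; [apply is_linear_scal_l|]. intros x Hx eps.
    apply (is_filter_lim_locally_unique (K := R_AbsRing) (V := R_NormedModule)) in Hx. subst x.
    generalize (H t (fun P HP => HP) eps). apply filter_imp. intros y Hy.
    eapply Rle_trans; [|apply Hy]. rewrite norm_Cmod.
    eapply Rle_trans; [|apply Rmax_Cmod]. eapply Rle_trans; [|apply Rmax_l]. right. reflexivity. }
  assert (H2 : is_derive (fun s => snd (g s)) t (snd l)).
  { destruct H as [_ H]. split; [apply is_linear_scal_l|]. intros x Hx eps.
    apply (is_filter_lim_locally_unique (K := R_AbsRing) (V := R_NormedModule)) in Hx. subst x.
    generalize (H t (fun P HP => HP) eps). apply filter_imp. intros y Hy.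
    eapply Rle_trans; [|apply Hy]. rewrite norm_Cmod.
    eapply Rle_trans; [|apply Rmax_Cmod]. eapply Rle_trans; [|apply Rmax_r]. right. reflexivity. }
  unfold Re, Cmult; simpl.
  apply (is_derive_minus (V := R_NormedModule) (fun s => fst c * fst (g s)) (fun s => snd c * snd (g s)));
    apply is_derive_scal; auto.
Qed.

Lemma is_derive_nonincr (u du : R -> R) (a b : R) : a <= b ->
  (forall t, a <= t <= b -> is_derive u t (du t)) ->
  (forall t, a <= t <= b -> du t <= 0) -> u b <= u a.
Proof.
  intros Hab Hu Hd. destruct (MVT_gen u a b du) as [c [Hc E]].
  - intros t Ht. rewrite Rmin_left, Rmax_right in Ht by lra. apply Hu. lra.
  - intros t Ht. rewrite Rmin_left, Rmax_right in Ht by lra.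
    apply continuity_pt_filterlim. apply (ex_derive_continuous u). exists (du t). apply Hu. lra.
  - rewrite Rmin_left, Rmax_right in Hc by lra. specialize (Hd c Hc). nra.
Qed.

Lemma Re_le_Cmod (z : C) : Re z <= Cmod z.
Proof.
  eapply Rle_trans; [apply Rle_abs|]. eapply Rle_trans; [|apply Rmax_Cmod]. apply Rmax_l.
Qed.

Lemma Re_Cconj_mult (z : C) : Re (Cconj z * z) = Cmod z * Cmod z.
Proof.
  assert (E := sqrt_sqrt (fst z ^ 2 + snd z ^ 2)). unfold Cmod. rewrite E by nra.
  unfold Re, Cconj, Cmult; simpl. ring.
Qed.

(** Projection on the increment [v] reduces this to real monotonicity:
    [Re (Cconj v * k) - Cmod v * g] does not increase, and one divides by [Cmod v]. If [v = 0], it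
    remains that [g] does not decrease. *)
Lemma curve_bound (k dk : R -> C) (g dg : R -> R) (a b : R) : a <= b ->
  (forall t, a <= t <= b -> pder k t (dk t)) ->
  (forall t, a <= t <= b -> is_derive g t (dg t)) ->
  (forall t, a <= t <= b -> Cmod (dk t) <= dg t) ->
  Cmod (k b - k a) <= g b - g a.
Proof.
  intros Hab Hk Hg Hd. set (v := (k b - k a)%C).
  assert (Hv0 := Cmod_ge_0 v).
  assert (H : Re (Cconj v * k b) - Cmod v * g b <= Re (Cconj v * k a) - Cmod v * g a).
  { apply (is_derive_nonincr (fun t => Re (Cconj v * k t) - Cmod v * g t)
      (fun t => Re (Cconj v * dk t) - Cmod v * dg t)); auto.
    - intros t Ht. apply (is_derive_minus (V := R_NormedModule) (fun t => Re (Cconj v * k t))).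
      + apply pder_Re, Hk, Ht.
      + apply is_derive_scal, Hg, Ht.
    - intros t Ht. generalize (Re_le_Cmod (Cconj v * dk t)).
      rewrite Cmod_mult, Cmod_conj. specialize (Hd t Ht). nra. }
  assert (E : Re (Cconj v * k b) - Re (Cconj v * k a) = Cmod v * Cmod v).
  { rewrite <- Re_Cconj_mult. unfold v, Re, Cconj, Cmult, Cminus, Cplus, Copp; simpl. ring. }
  destruct (Rle_lt_or_eq_dec _ _ Hv0) as [Hp|Hz].
  - apply Rmult_le_reg_l with (Cmod v); [auto|]. nra.
  - rewrite <- Hz.
    assert (g a <= g b); [|lra].
    apply Ropp_le_cancel. apply (is_derive_nonincr (fun t => - g t) (fun t => - dg t)); auto.
    + intros t Ht. apply (is_derive_opp (V := R_NormedModule) g), Hg, Ht.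
    + intros t Ht. specialize (Hd t Ht). generalize (Cmod_ge_0 (dk t)). lra.
Qed.

Definition seg (a b : C) (t : R) : C := (a + RtoC t * (b - a))%C.

Definition convex (D : C -> Prop) : Prop :=
  forall a b t, D a -> D b -> 0 <= t <= 1 -> D (seg a b t).

Lemma seg_0 (a b : C) : seg a b 0 = a.
Proof. unfold seg. ring. Qed.

Lemma seg_1 (a b : C) : seg a b 1 = b.
Proof. unfold seg. ring. Qed.

Lemma mean_value (D : C -> Prop) (f f' : C -> C) (M : R) (a b : C) : convex D -> D a -> D b ->
  (forall z, D z -> cder f z (f' z)) -> (forall z, D z -> Cmod (f' z) <= M) ->
  Cmod (f b - f a) <= M * Cmod (b - a).
Proof.
  intros HD Ha Hb Hf HM.
  replace (M * Cmod (b - a)) with (M * Cmod (b - a) * 1 - M * Cmod (b - a) * 0) by ring.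
  rewrite <- (seg_0 a b) at 1. rewrite <- (seg_1 a b) at 1.
  apply (curve_bound (fun t => f (seg a b t)) (fun t => f' (seg a b t) * (b - a))%C
    (fun t => M * Cmod (b - a) * t) (fun _ => M * Cmod (b - a))).
  - lra.
  - intros t Ht. apply (gder_comp RtoC f (seg a b)); [apply Hf, HD; auto|apply pder_linear].
  - intros t Ht. auto_derive; auto. ring.
  - intros t Ht. rewrite Cmod_mult. apply Rmult_le_compat_r; [apply Cmod_ge_0|]. apply HM, HD; auto.
Qed.

(** * Goursat's theorem *)

Lemma dependent_choice {A : Type} (P : nat -> A -> Prop) (Q : nat -> A -> A -> Prop) (x0 : A) :
  P O x0 -> (forall n x, P n x -> exists y, P (S n) y /\ Q n x y) ->
  exists u : nat -> A, u O = x0 /\ forall n, P n (u n) /\ Q n (u n) (u (S n)).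
Proof.
  intros H0 HS.
  set (step := fun n x => epsilon (inhabits x0) (fun y => P (S n) y /\ Q n x y)).
  set (u := fix u n := match n with O => x0 | S k => step k (u k) end).
  exists u. split; [reflexivity|].
  assert (HP : forall n, P n (u n)).
  { induction n as [|n IH]; [exact H0|]. simpl. unfold step.
    apply (epsilon_spec (inhabits x0) _ (HS n _ IH)). }
  intros n. split; [apply HP|]. simpl. unfold step.
  apply (epsilon_spec (inhabits x0) _ (HS n _ (HP n))).
Qed.

Lemma half_pow_pos (n : nat) : 0 < (/ 2) ^ n.
Proof. apply pow_lt. lra. Qed.

Lemma half_pow_small (eps : R) : 0 < eps -> exists n, (/ 2) ^ n < eps.
Proof.
  intros He. destruct (pow_lt_1_zero (/ 2) ltac:(rewrite Rabs_pos_eq; lra) eps He) as [N HN].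
  exists N. specialize (HN N (le_n N)). rewrite Rabs_pos_eq in HN; [auto|].
  left; apply half_pow_pos.
Qed.

Lemma geometric_limit_R (u : nat -> R) (K : R) : 0 <= K ->
  (forall n m, Rabs (u (n + m)%nat - u n) <= K * (/ 2) ^ n) ->
  exists p, forall n, Rabs (u n - p) <= K * (/ 2) ^ n.
Proof.
  intros HK H.
  assert (HC : ex_finite_lim_seq u).
  { apply ex_lim_seq_cauchy_corr. intros eps.
    destruct (half_pow_small (eps / (2 * (K + 1)))) as [N HN].
    { apply Rdiv_lt_0_compat; [apply cond_pos|lra]. }
    exists N. intros n m Hn Hm.
    assert (E1 := H N (n - N)%nat). assert (E2 := H N (m - N)%nat).
    replace (N + (n - N))%nat with n in E1 by lia.
    replace (N + (m - N))%nat with m in E2 by lia.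
    replace (u n - u m) with ((u n - u N) - (u m - u N)) by ring.
    eapply Rle_lt_trans; [apply Rabs_triang|]. rewrite Rabs_Ropp.
    apply Rle_lt_trans with (2 * (K * (/ 2) ^ N)); [lra|].
    apply (Rmult_lt_compat_l (2 * (K + 1))) in HN; [|lra].
    replace (2 * (K + 1) * (eps / (2 * (K + 1)))) with (pos eps) in HN by (field; lra).
    generalize (half_pow_pos N). nra. }
  destruct HC as [p Hp]. exists p. intros n. apply is_lim_seq_spec in Hp.
  apply Rnot_lt_le. intros HL.
  destruct (Hp (mkposreal _ (proj2 (Rlt_0_minus _ _) HL))) as [N HN]. simpl in HN.
  specialize (HN (n + N)%nat ltac:(lia)). specialize (H n N).
  replace (u n - p) with (- (u (n + N)%nat - u n) + (u (n + N)%nat - p)) in HN by ring.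
  assert (T := Rabs_triang (- (u (n + N)%nat - u n)) (u (n + N)%nat - p)).
  rewrite Rabs_Ropp in T. lra.
Qed.

Lemma Rabs_Re_le (z : C) : Rabs (fst z) <= Cmod z.
Proof. eapply Rle_trans; [|apply Rmax_Cmod]. apply Rmax_l. Qed.

Lemma Rabs_Im_le (z : C) : Rabs (snd z) <= Cmod z.
Proof. eapply Rle_trans; [|apply Rmax_Cmod]. apply Rmax_r. Qed.

Lemma Cmod_le_sum (z : C) : Cmod z <= Rabs (fst z) + Rabs (snd z).
Proof.
  replace z with (RtoC (fst z) + Ci * RtoC (snd z))%C at 1.
  - eapply Rle_trans; [apply Cmod_triangle|]. rewrite Cmod_mult, !Cmod_R.
    replace (Cmod Ci) with 1; [lra|]. unfold Cmod, Ci; simpl.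
    replace (0 * (0 * 1) + 1 * (1 * 1)) with 1 by ring. symmetry; apply sqrt_1.
  - apply injective_projections; simpl; ring.
Qed.

Lemma geometric_limit (u : nat -> C) (K : R) : 0 <= K ->
  (forall n, Cmod (u (S n) - u n) <= K * (/ 2) ^ n) ->
  exists p, forall n, Cmod (u n - p) <= 4 * K * (/ 2) ^ n.
Proof.
  intros HK H.
  assert (HC : forall n m, Cmod (u (n + m)%nat - u n) <= 2 * K * (/ 2) ^ n).
  { assert (S1 : forall n m, Cmod (u (n + m)%nat - u n) <= 2 * K * (/ 2) ^ n - 2 * K * (/ 2) ^ (n + m)).
    { intros n m. induction m as [|m IH].
      - rewrite Nat.add_0_r. replace (u n - u n)%C with (RtoC 0) by ring. rewrite Cmod_0. lra.
      - rewrite Nat.add_succ_r. generalize (Cmod_tri (u (S (n + m))) (u (n + m)%nat) (u n)).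
        specialize (H (n + m)%nat). simpl (_ ^ S _). lra. }
    intros n m. specialize (S1 n m). generalize (half_pow_pos (n + m)). nra. }
  destruct (geometric_limit_R (fun n => fst (u n)) (2 * K)) as [p Hp]; [lra| |].
  { intros n m. eapply Rle_trans; [|apply (HC n m)].
    apply (Rabs_Re_le (u (n + m)%nat - u n)%C). }
  destruct (geometric_limit_R (fun n => snd (u n)) (2 * K)) as [q Hq]; [lra| |].
  { intros n m. eapply Rle_trans; [|apply (HC n m)].
    apply (Rabs_Im_le (u (n + m)%nat - u n)%C). }
  (* Each coordinate contributes [2 * K], whence the factor 4. *)
  exists (p, q). intros n. eapply Rle_trans; [apply Cmod_le_sum|]. simpl.
  specialize (Hp n). specialize (Hq n). unfold Rminus in *. lra.
Qed.

Definition Iseg (f : C -> C) (a b : C) : C := Cint (fun t => f (seg a b t) * (b - a))%C 0 1.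

Definition Tri (f : C -> C) (a b c : C) : C := (Iseg f a b + Iseg f b c + Iseg f c a)%C.

Lemma Cint_lin (g : R -> C) (u v : R) : 0 <= u -> pcont_on g v (u + v) ->
  Cint (fun t => RtoC u * g (u * t + v)%R)%C 0 1 = Cint g v (u + v).
Proof.
  intros Hu Hg. apply Cint_unique.
  assert (H := is_RInt_comp_lin (V := C_R_NormedModule) g u v 0 1 (Cint g v (u + v))).
  rewrite Rmult_0_r, Rplus_0_l, Rmult_1_r in H.
  specialize (H (Cint_correct g v (u + v) ltac:(lra) Hg)).
  revert H. apply is_RInt_ext. intros t _. unfold scal; simpl.
  unfold prod_scal, scal; simpl. unfold mult; simpl.
  apply injective_projections; simpl; ring.
Qed.

Lemma Iseg_pcont (D : C -> Prop) (f : C -> C) (a b : C) : convex D ->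
  (forall z, D z -> ccont f z) -> D a -> D b ->
  pcont_on (fun t => f (seg a b t) * (b - a))%C 0 1.
Proof.
  intros HD Hf Ha Hb t Ht. apply gcont_mult; [|apply gcont_const].
  apply gcont_comp; [apply Hf, HD; auto|apply pcont_linear].
Qed.

Section Triangles.
Variables (D : C -> Prop) (f : C -> C).
Hypothesis HD : convex D.
Hypothesis Hf : forall z, D z -> ccont f z.

Lemma Iseg_rev (a b : C) : D a -> D b -> Iseg f b a = (- Iseg f a b)%C.
Proof.
  intros Ha Hb. apply Cint_unique.
  set (g := fun t => (f (seg a b t) * (b - a))%C).
  assert (Hg := Iseg_pcont D f a b HD Hf Ha Hb). fold g in Hg.
  assert (H := is_RInt_comp_lin (V := C_R_NormedModule) g (-1) 1 0 1 (- Iseg f a b)%C).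
  replace (-1 * 0 + 1) with 1 in H by ring. replace (-1 * 1 + 1) with 0 in H by ring.
  specialize (H (is_RInt_swap (V := C_R_NormedModule) _ _ _ _ (Cint_correct g 0 1 ltac:(lra) Hg))).
  revert H. apply is_RInt_ext. intros t _. unfold scal; simpl. unfold g.
  replace (seg a b (-1 * t + 1)) with (seg b a t).
  - unfold prod_scal, scal; simpl. unfold mult; simpl.
    apply injective_projections; simpl; ring.
  - unfold seg. rewrite RtoC_plus, RtoC_mult. ring.
Qed.

Definition mid (a b : C) : C := seg a b (/ 2).

Lemma mid_in (a b : C) : D a -> D b -> D (mid a b).
Proof. intros. apply HD; auto. lra. Qed.

Lemma Iseg_mid (a b : C) : D a -> D b -> (Iseg f a (mid a b) + Iseg f (mid a b) b)%C = Iseg f a b.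
Proof.
  intros Ha Hb. set (g := fun t => (f (seg a b t) * (b - a))%C).
  assert (Hg := Iseg_pcont D f a b HD Hf Ha Hb). fold g in Hg.
  assert (E1 : Iseg f a (mid a b) = Cint g 0 (/ 2 + 0)).
  { rewrite <- Cint_lin; [|lra|intros t Ht; apply Hg; lra].
    apply Cint_ext; [lra|]. intros t _. unfold g.
    replace (seg a b (/ 2 * t + 0)) with (seg a (mid a b) t).
    - unfold mid, seg. ring.
    - unfold mid, seg. rewrite RtoC_plus, RtoC_mult. ring. }
  assert (E2 : Iseg f (mid a b) b = Cint g (/ 2) (/ 2 + / 2)).
  { rewrite <- Cint_lin; [|lra|intros t Ht; apply Hg; lra].
    apply Cint_ext; [lra|]. intros t _. unfold g.
    replace (seg a b (/ 2 * t + / 2)) with (seg (mid a b) b t).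
    - unfold mid, seg. rewrite RtoC_inv by lra. field.
    - unfold mid, seg. rewrite RtoC_plus, RtoC_mult, RtoC_inv by lra. field. }
  rewrite E1, E2. replace (/ 2 + 0) with (/ 2) by ring. replace (/ 2 + / 2) with 1 by field.
  apply Cint_Chasles; [lra|auto].
Qed.

(** The inner sides, joining midpoints, are each traversed twice in opposite directions and
    cancel. *)
Lemma Tri_subdivide (a b c : C) : D a -> D b -> D c ->
  Tri f a b c = (Tri f a (mid a b) (mid c a) + Tri f (mid a b) b (mid b c)
    + Tri f (mid c a) (mid b c) c + Tri f (mid a b) (mid b c) (mid c a))%C.
Proof.
  intros Ha Hb Hc. unfold Tri.
  rewrite <- (Iseg_mid a b), <- (Iseg_mid b c), <- (Iseg_mid c a) by auto.
  rewrite (Iseg_rev (mid a b) (mid c a)), (Iseg_rev (mid a b) (mid b c)),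
    (Iseg_rev (mid b c) (mid c a)) by (apply mid_in; auto).
  ring.
Qed.

(* [c0 z + l z^2 / 2] is the primitive of the affine approximation. *)
Lemma Iseg_near_affine (c0 l a b : C) (M : R) : D a -> D b ->
  (forall t, 0 <= t <= 1 -> Cmod (f (seg a b t) - (c0 + l * seg a b t)) <= M) ->
  Cmod (Iseg f a b - ((c0 * b + l * (b * b) / 2) - (c0 * a + l * (a * a) / 2))) <= M * Cmod (b - a).
Proof.
  intros Ha Hb HM.
  assert (Hg := Iseg_pcont D f a b HD Hf Ha Hb).
  assert (Hh : pcont_on (fun t => (c0 + l * seg a b t) * (b - a))%C 0 1).
  { intros t _. apply gcont_mult; [|apply gcont_const].
    apply gcont_plus; [apply gcont_const|]. apply gcont_scal, pcont_linear. }
  assert (E : Cint (fun t => (c0 + l * seg a b t) * (b - a))%C 0 1 =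
    ((c0 * b + l * (b * b) / 2) - (c0 * a + l * (a * a) / 2))%C).
  { rewrite (Cint_ftc (fun t => c0 * seg a b t + (l / 2) * (seg a b t * seg a b t))%C
      (fun t => (c0 + l * seg a b t) * (b - a))%C); auto; [|lra|].
    - rewrite seg_0, seg_1. field.
    - intros t _. assert (Hs := pder_linear a (b - a) t).
      eapply gder_eq; [|apply gder_plus; [apply gder_scal, Hs|apply gder_scal, (gder_mult RtoC _ _ _ _ _ Hs Hs)]].
      unfold seg. field. }
  rewrite <- E. unfold Iseg. rewrite <- Cint_minus; auto; [|lra].
  eapply Rle_trans; [apply (Cint_norm _ 0 1 (M * Cmod (b - a)))|lra]; [lra| |].
  - intros t Ht. apply gcont_minus; auto.
  - intros t Ht.
    replace (f (seg a b t) * (b - a) - (c0 + l * seg a b t) * (b - a))%C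
      with ((f (seg a b t) - (c0 + l * seg a b t)) * (b - a))%C by ring.
    rewrite Cmod_mult. apply Rmult_le_compat_r; [apply Cmod_ge_0|auto].
Qed.

End Triangles.

Definition cclosed (D : C -> Prop) : Prop :=
  forall p, (forall eps, 0 < eps -> exists z, D z /\ Cmod (z - p) < eps) -> D p.

Definition tri_size (s : R) (x : C * C * C) : Prop :=
  Cmod (snd (fst x) - fst (fst x)) <= s /\ Cmod (snd x - snd (fst x)) <= s /\
  Cmod (fst (fst x) - snd x) <= s.

Lemma Cmod_half (z : C) : Cmod (RtoC (/ 2) * z) = / 2 * Cmod z.
Proof. rewrite Cmod_mult, Cmod_R, Rabs_pos_eq by lra. reflexivity. Qed.

(** [D] stands for the solid triangle: convexity keeps the midpoints inside, closedness the limit of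
    the vertices. Bisection keeps at least a quarter of the integral at each step, while affine
    approximation at the limit point bounds it by a small multiple of the squared size. *)
Lemma goursat (D : C -> Prop) (f : C -> C) (a b c : C) : convex D -> cclosed D -> hol D f ->
  D a -> D b -> D c -> Tri f a b c = 0.
Proof.
  intros HD HC Hf Ha Hb Hc. apply NNPP. intros N. apply Cmod_pos in N.
  assert (Hcont : forall z, D z -> ccont f z) by (intros; eapply hol_ccont; eauto).
  set (eta := Cmod (Tri f a b c)) in *.
  set (s := Cmod (b - a) + Cmod (c - b) + Cmod (a - c) + 1).
  assert (Hba := Cmod_ge_0 (b - a)). assert (Hcb := Cmod_ge_0 (c - b)).
  assert (Hac := Cmod_ge_0 (a - c)).
  assert (Hs : 0 < s) by (unfold s; lra).
  set (P := fun n (x : C * C * C) => D (fst (fst x)) /\ D (snd (fst x)) /\ D (snd x) /\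
     tri_size (s * (/ 2) ^ n) x /\
     eta * (/ 4) ^ n <= Cmod (Tri f (fst (fst x)) (snd (fst x)) (snd x))).
  set (Q := fun n (x y : C * C * C) => Cmod (fst (fst y) - fst (fst x)) <= s * (/ 2) ^ n).
  destruct (dependent_choice P Q (a, b, c)) as [u [_ Hu]].
  { unfold P, tri_size; simpl. rewrite !Rmult_1_r. repeat split; auto; unfold s, eta; lra. }
  { intros n [[x y] z] (Hx & Hy & Hz & (S1 & S2 & S3) & HT). simpl in *.
    set (e := s * (/ 2) ^ n) in *. set (m := eta * (/ 4) ^ n) in *.
    assert (He : s * (/ 2 * (/ 2) ^ n) = / 2 * e) by (unfold e; ring).
    assert (Hm : eta * (/ 4 * (/ 4) ^ n) = m / 4) by (unfold m; field).
    rewrite (Tri_subdivide D f HD Hcont x y z) in HT by auto.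
    assert (Hxy := mid_in D HD x y Hx Hy). assert (Hyz := mid_in D HD y z Hy Hz).
    assert (Hzx := mid_in D HD z x Hz Hx).
    assert (B : forall p q r, Cmod (p - q) <= e -> (r = RtoC (/ 2) * (p - q))%C -> Cmod r <= / 2 * e).
    { intros p q r Hpq ->. rewrite Cmod_half. lra. }
    assert (Hh2 : RtoC (/ 2) = (/ 2)%C) by (apply RtoC_inv; lra).
    assert (S1' : Cmod (x - y) <= e) by (rewrite Cmod_sym; auto).
    assert (S2' : Cmod (y - z) <= e) by (rewrite Cmod_sym; auto).
    assert (S3' : Cmod (z - x) <= e) by (rewrite Cmod_sym; auto).
    assert (He0 : 0 <= e) by (generalize (Cmod_ge_0 (y - x)); lra).
    assert (Hc4 : m / 4 <= Cmod (Tri f x (mid x y) (mid z x)) \/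
      m / 4 <= Cmod (Tri f (mid x y) y (mid y z)) \/
      m / 4 <= Cmod (Tri f (mid z x) (mid y z) z) \/
      m / 4 <= Cmod (Tri f (mid x y) (mid y z) (mid z x))).
    { apply NNPP; intros NN.
      apply not_or_and in NN. destruct NN as [N1 NN].
      apply not_or_and in NN. destruct NN as [N2 NN].
      apply not_or_and in NN. destruct NN as [N3 N4].
      apply Rnot_le_lt in N1, N2, N3, N4.
      set (T1 := Tri f x (mid x y) (mid z x)) in *. set (T2 := Tri f (mid x y) y (mid y z)) in *.
      set (T3 := Tri f (mid z x) (mid y z) z) in *. set (T4 := Tri f (mid x y) (mid y z) (mid z x)) in *.
      generalize (Cmod_triangle (T1 + T2 + T3) T4) (Cmod_triangle (T1 + T2) T3) (Cmod_triangle T1 T2).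
      lra. }
    destruct Hc4 as [H|[H|[H|H]]].
    - exists (x, mid x y, mid z x). unfold P, Q, tri_size; simpl. rewrite He, Hm.
      repeat split; auto.
      + apply (B y x); auto. unfold mid, seg. ring.
      + apply (B z y); auto. unfold mid, seg. rewrite Hh2. field.
      + apply (B x z); auto. unfold mid, seg. rewrite Hh2. field.
      + replace (x - x)%C with (RtoC 0) by ring. rewrite Cmod_0. auto.
    - exists (mid x y, y, mid y z). unfold P, Q, tri_size; simpl. rewrite He, Hm.
      repeat split; auto.
      + apply (B y x); auto. unfold mid, seg. rewrite Hh2. field.
      + apply (B z y); auto. unfold mid, seg. ring.
      + apply (B x z); auto. unfold mid, seg. rewrite Hh2. field.
      + apply Rle_trans with (/ 2 * e); [|lra]. apply (B y x); auto. unfold mid, seg. ring.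
    - exists (mid z x, mid y z, z). unfold P, Q, tri_size; simpl. rewrite He, Hm.
      repeat split; auto.
      + apply (B y x); auto. unfold mid, seg. rewrite Hh2. field.
      + apply (B z y); auto. unfold mid, seg. rewrite Hh2. field.
      + apply (B x z); auto. unfold mid, seg. ring.
      + apply Rle_trans with (/ 2 * e); [|lra]. apply (B z x); auto. unfold mid, seg. rewrite Hh2. field.
    - exists (mid x y, mid y z, mid z x). unfold P, Q, tri_size; simpl. rewrite He, Hm.
      repeat split; auto.
      + apply (B z x); auto. unfold mid, seg. rewrite Hh2. field.
      + apply (B x y); auto. unfold mid, seg. rewrite Hh2. field.
      + apply (B y z); auto. unfold mid, seg. rewrite Hh2. field.
      + apply Rle_trans with (/ 2 * e); [|lra]. apply (B y x); auto. unfold mid, seg. ring. }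
  destruct (geometric_limit (fun n => fst (fst (u n))) s) as [p Hp]; [lra|apply Hu|].
  assert (HDp : D p).
  { apply HC. intros eps He.
    destruct (half_pow_small (eps / (4 * s))) as [n Hn]; [apply Rdiv_lt_0_compat; lra|].
    exists (fst (fst (u n))). split; [apply Hu|].
    eapply Rle_lt_trans; [apply Hp|].
    apply (Rmult_lt_compat_l (4 * s)) in Hn; [|lra].
    replace (4 * s * (eps / (4 * s))) with eps in Hn by (field; lra). exact Hn. }
  destruct (Hf p HDp) as [l Hl].
  (* Each of the three sides will contribute at most [6 * eps * e * e]; the sum [18 * eps * e * e]
     is then half of the lower bound [eta * (/ 4) ^ n]. *)
  set (eps := eta / (36 * s * s)).
  assert (Heps : 0 < eps) by (apply Rdiv_lt_0_compat; [lra|nra]).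
  destruct (Hl eps Heps) as [d [Hd H1]].
  destruct (half_pow_small (d / (8 * s))) as [n Hn]; [apply Rdiv_lt_0_compat; lra|].
  destruct (Hu n) as [(Dx & Dy & Dz & (S1 & S2 & S3) & HT) _].
  specialize (Hp n). simpl in Hp.
  destruct (u n) as [[x y] z]. simpl in *.
  set (e := s * (/ 2) ^ n) in *.
  assert (He0 : 0 < e) by (apply Rmult_lt_0_compat; [lra|apply half_pow_pos]).
  assert (Hde : 8 * e < d).
  { apply (Rmult_lt_compat_l (8 * s)) in Hn; [|lra].
    replace (8 * s * (d / (8 * s))) with d in Hn by (field; lra). unfold e. lra. }
  assert (Hpx : Cmod (x - p) <= 4 * e) by (unfold e; lra).
  set (c0 := (f p - l * p)%C).
  assert (NS : forall v w, D v -> D w -> Cmod (v - x) <= e -> Cmod (w - v) <= e ->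
    Cmod (Iseg f v w - ((c0 * w + l * (w * w) / 2) - (c0 * v + l * (v * v) / 2)))
      <= 6 * eps * e * e).
  { intros v w Dv Dw Hv Hw. eapply Rle_trans.
    - apply (Iseg_near_affine D f HD Hcont c0 l v w (6 * eps * e)); auto.
      intros t Ht.
      (* The distance is at most [e] along the side, [e] from [v] to [x] and [4 * e] from [x] to
         [p]. *)
      assert (Hsg : Cmod (seg v w t - p) <= 6 * e).
      { unfold seg. replace (v + t * (w - v) - p)%C with ((v - x) + (x - p) + t * (w - v))%C by ring.
        eapply Rle_trans; [apply Cmod_triangle|]. rewrite Cmod_mult, Cmod_R, Rabs_pos_eq by lra.
        generalize (Cmod_triangle (v - x) (x - p)). generalize (Cmod_ge_0 (w - v)). nra. }
      replace (f (seg v w t) - (c0 + l * seg v w t))%C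
        with (f (seg v w t) - f p - l * (seg v w t - p))%C by (unfold c0; ring).
      eapply Rle_trans; [apply H1; lra|]. rewrite (Rmult_comm 6 eps), Rmult_assoc.
      apply Rmult_le_compat_l; lra.
    - apply Rmult_le_compat_l; [nra|auto]. }
  assert (N1 := NS x y Dx Dy). assert (N2 := NS y z Dy Dz). assert (N3 := NS z x Dz Dx).
  replace (x - x)%C with (RtoC 0) in N1 by ring. rewrite Cmod_0 in N1.
  specialize (N1 ltac:(lra) S1). specialize (N2 S1 S2).
  specialize (N3 ltac:(rewrite Cmod_sym; auto) S3).
  assert (HTle : Cmod (Tri f x y z) <= 18 * eps * e * e).
  { unfold Tri.
    set (I1 := (Iseg f x y - _)%C) in N1. set (I2 := (Iseg f y z - _)%C) in N2.
    set (I3 := (Iseg f z x - _)%C) in N3.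
    replace (Iseg f x y + Iseg f y z + Iseg f z x)%C with (I1 + I2 + I3)%C
      by (unfold I1, I2, I3; field).
    generalize (Cmod_triangle (I1 + I2) I3) (Cmod_triangle I1 I2). lra. }
  assert (Hq : (/ 4) ^ n = (/ 2) ^ n * (/ 2) ^ n).
  { rewrite <- Rpow_mult_distr. f_equal. lra. }
  assert (E2 : 18 * eps * e * e = eta / 2 * (/ 4) ^ n).
  { rewrite Hq. unfold e, eps. field. lra. }
  assert (0 < (/ 4) ^ n) by (apply pow_lt; lra).
  rewrite E2 in HTle. nra.
Qed.

(** Primitives are wanted on open sets, whereas [goursat] needs a closed convex one; this supplies
    such a set for each triple of vertices. *)
Definition triangular (D : C -> Prop) : Prop :=
  forall a b c, D a -> D b -> D c -> exists E : C -> Prop,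
    convex E /\ cclosed E /\ (forall z, E z -> D z) /\ E a /\ E b /\ E c.

Definition good (D : C -> Prop) : Prop := copen D /\ convex D /\ triangular D.

Lemma convex_closed_ball (a : C) (r : R) : convex (fun z => Cmod (z - a) <= r).
Proof.
  intros x y t Hx Hy Ht. unfold seg.
  replace (x + t * (y - x) - a)%C with (RtoC (1 - t) * (x - a) + t * (y - a))%C
    by (rewrite RtoC_minus; ring).
  eapply Rle_trans; [apply Cmod_triangle|]. rewrite !Cmod_mult, !Cmod_R, !Rabs_pos_eq by lra. nra.
Qed.

Lemma convex_cball (a : C) (r : R) : convex (cball a r).
Proof.
  intros x y t Hx Hy Ht. unfold cball in *.
  eapply Rle_lt_trans; [apply (convex_closed_ball a (Rmax (Cmod (x - a)) (Cmod (y - a))))|];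
    auto using Rmax_l, Rmax_r. apply Rmax_lub_lt; auto.
Qed.

Lemma good_cball (a : C) (r : R) : good (cball a r).
Proof.
  split; [apply cball_open|split; [apply convex_cball|]].
  intros x y z Hx Hy Hz. unfold cball in *.
  set (m := Rmax (Cmod (x - a)) (Rmax (Cmod (y - a)) (Cmod (z - a)))).
  exists (fun w => Cmod (w - a) <= m). repeat split.
  - apply convex_closed_ball.
  - intros p Hp. apply Rnot_lt_le. intros HL.
    destruct (Hp (Cmod (p - a) - m)) as [w [Hw1 Hw2]]; [lra|].
    generalize (Cmod_tri p w a). rewrite (Cmod_sym p w). lra.
  - intros w Hw. eapply Rle_lt_trans; [apply Hw|]. repeat apply Rmax_lub_lt; auto.
  - apply Rmax_l.
  - eapply Rle_trans; [|apply Rmax_r]. apply Rmax_l.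
  - eapply Rle_trans; [|apply Rmax_r]. apply Rmax_r.
Qed.

Lemma convex_half (c : R) : convex (fun z => c <= Re z).
Proof.
  intros x y t Hx Hy Ht. unfold seg, Re in *. simpl. nra.
Qed.

Lemma good_half_plane (c : R) : good (half_plane c).
Proof.
  unfold half_plane. split; [|split].
  - intros z Hz. exists (Re z - c). split; [lra|]. intros y Hy. unfold cball in Hy.
    generalize (Rabs_Re_le (y - z)%C). unfold Re in *; simpl. unfold Rabs.
    destruct Rcase_abs; lra.
  - intros x y t Hx Hy Ht.
    apply Rlt_le_trans with (Rmin (Re x) (Re y)); [apply Rmin_glb_lt; auto|].
    apply convex_half; auto using Rmin_l, Rmin_r.
  - intros x y z Hx Hy Hz. set (m := Rmin (Re x) (Rmin (Re y) (Re z))).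
    exists (fun w => m <= Re w). repeat split.
    + apply convex_half.
    + intros p Hp. apply Rnot_lt_le. intros HL.
      destruct (Hp (m - Re p)) as [w [Hw1 Hw2]]; [lra|].
      generalize (Re_le_Cmod (w - p)%C). unfold Re in *; simpl. lra.
    + intros w Hw. eapply Rlt_le_trans; [|apply Hw]. repeat apply Rmin_glb_lt; auto.
    + apply Rmin_l.
    + eapply Rle_trans; [apply Rmin_r|]. apply Rmin_l.
    + eapply Rle_trans; [apply Rmin_r|]. apply Rmin_r.
Qed.

Theorem primitive (D : C -> Prop) (f : C -> C) : good D -> hol D f ->
  exists P : C -> C, forall z, D z -> cder P z (f z).
Proof.
  intros (HO & HV & HT) Hf.
  assert (Hcont : forall z, D z -> ccont f z) by (intros; eapply hol_ccont; eauto).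
  destruct (classic (exists a, D a)) as [[a Ha]|N].
  2:{ exists (fun _ => RtoC 0). intros z Hz. exfalso. apply N. eauto. }
  exists (Iseg f a). intros z Hz eps He.
  destruct (HO z Hz) as [r [Hr Hball]]. destruct (Hcont z Hz eps He) as [d [Hd H1]].
  exists (Rmin r d). split; [apply Rmin_pos; lra|]. intros y Hy.
  assert (Hy1 := Rlt_le_trans _ _ _ Hy (Rmin_l _ _)).
  assert (Hy2 := Rlt_le_trans _ _ _ Hy (Rmin_r _ _)).
  assert (Dy : D y) by (apply Hball; auto).
  destruct (HT a z y Ha Hz Dy) as (E & EV & EC & ED & Ea & Ez & Ey).
  assert (G := goursat E f a z y EV EC (hol_sub D E f ED Hf) Ea Ez Ey).
  unfold Tri in G. rewrite (Iseg_rev D f HV Hcont a y) in G by auto.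
  (* [Iseg_near_affine] is used with slope 0: continuity of [f] at [z] suffices once the triangle
     [a z y] has integral 0. *)
  replace (Iseg f a y - Iseg f a z - f z * (y - z))%C with
    (Iseg f z y - ((f z * y + 0 * (y * y) / 2) - (f z * z + 0 * (z * z) / 2))
      - (Iseg f a z + Iseg f z y + - Iseg f a y))%C by field.
  rewrite G. replace (Iseg f z y - (f z * y + 0 * (y * y) / 2 - (f z * z + 0 * (z * z) / 2)) - 0)%C
    with (Iseg f z y - (f z * y + 0 * (y * y) / 2 - (f z * z + 0 * (z * z) / 2)))%C by ring.
  apply (Iseg_near_affine D f HV Hcont); auto.
  intros t Ht. replace (f z + 0 * seg z y t)%C with (f z) by ring. left. apply H1.
  unfold seg. replace (z + t * (y - z) - z)%C with (t * (y - z))%C by ring.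
  rewrite Cmod_mult, Cmod_R, Rabs_pos_eq by lra. generalize (Cmod_ge_0 (y - z)). nra.
Qed.

(** * Cauchy's formulas on circles *)

Lemma compact_uniform (a b : R) (P : R -> R -> Prop) :
  (forall s d d', 0 < d' <= d -> P s d -> P s d') ->
  (forall t, a <= t <= b -> exists d, 0 < d /\ forall s, a <= s <= b -> Rabs (s - t) < d -> P s d) ->
  exists d, 0 < d /\ forall s, a <= s <= b -> P s d.
Proof.
  intros HM H.
  assert (H' : forall t, exists d, 0 < d /\ (a <= t <= b -> forall s, a <= s <= b -> Rabs (s - t) < d -> P s d)).
  { intros t. destruct (classic (a <= t <= b)) as [Ht|Ht].
    - destruct (H t Ht) as [d [Hd Hd']]. exists d. auto.
    - exists 1. split; [lra|]. intros; contradiction. }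
  set (d0 := fun t => constructive_indefinite_description _ (H' t)).
  (* The planar covering lemma is applied to the degenerate rectangle [[a, b] x [0, 0]]. *)
  set (delta := fun (t : R) (_ : R) => mkposreal (proj1_sig (d0 t)) (proj1 (proj2_sig (d0 t)))).
  destruct (compactness_value_2d a b 0 0 delta) as [d Hd].
  exists d. split; [apply cond_pos|]. intros s Hs. apply NNPP. intros N.
  apply (Hd s 0 Hs ltac:(lra)). intros (u & v & Hu & _ & Hsu & _ & Hle).
  apply N. apply HM with (delta u v).
  - split; [apply cond_pos|exact Hle].
  - apply (proj2 (proj2_sig (d0 u)) Hu s Hs Hsu).
Qed.

Lemma pcont_bounded (g : R -> C) (a b : R) : pcont_on g a b ->
  exists B, 1 <= B /\ forall t, a <= t <= b -> Cmod (g t) <= B.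
Proof.
  (* Written as [/ d], a bound becomes weaker as [d] decreases, which is the monotonicity that
     [compact_uniform] requires. *)
  intros Hg. destruct (compact_uniform a b (fun s d => Cmod (g s) <= / d)) as [d [Hd H]].
  - intros s d d' Hd Hs. eapply Rle_trans; [apply Hs|]. apply Rinv_le_contravar; lra.
  - intros t Ht. destruct (Hg t Ht 1 ltac:(lra)) as [d [Hd H]].
    assert (Hc := Cmod_ge_0 (g t)).
    exists (Rmin d (/ (Cmod (g t) + 1))). split.
    { apply Rmin_pos; auto. apply Rinv_0_lt_compat. lra. }
    intros s Hs Hst. specialize (H s). rewrite Cmod_RtoC_sub in H.
    specialize (H (Rlt_le_trans _ _ _ Hst (Rmin_l _ _))).
    apply Rle_trans with (Cmod (g t) + 1).
    + generalize (Cmod_tri_inv (g s) (g t)). lra.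
    + rewrite <- (Rinv_inv (Cmod (g t) + 1)) at 1. apply Rinv_le_contravar.
      * apply Rmin_pos; auto. apply Rinv_0_lt_compat. lra.
      * apply Rmin_r.
  - exists (Rmax 1 (/ d)). split; [apply Rmax_l|]. intros t Ht.
    eapply Rle_trans; [apply H, Ht|apply Rmax_r].
Qed.

Lemma uniform_near_curve (D : C -> Prop) (f : C -> C) (al : R -> C) (a b eps : R) :
  copen D -> (forall z, D z -> ccont f z) -> pcont_on al a b ->
  (forall t, a <= t <= b -> D (al t)) -> 0 < eps ->
  exists d, 0 < d /\ forall t, a <= t <= b -> forall y, Cmod (y - al t) < d ->
    D y /\ Cmod (f y - f (al t)) <= eps.
Proof.
  intros HO Hf Hal HD He.
  apply (compact_uniform a b (fun t d => forall y, Cmod (y - al t) < d ->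
    D y /\ Cmod (f y - f (al t)) <= eps)).
  - intros s d d' Hd Hs y Hy. apply Hs. lra.
  - intros t Ht. destruct (HO _ (HD t Ht)) as [r [Hr Hb]].
    destruct (Hf _ (HD t Ht) (eps / 2) ltac:(lra)) as [d1 [Hd1 H1]].
    set (m := Rmin r d1). assert (Hm : 0 < m) by (apply Rmin_pos; auto).
    destruct (Hal t Ht (m / 2) ltac:(lra)) as [d2 [Hd2 H2]].
    exists (Rmin d2 (m / 2)). split; [apply Rmin_pos; lra|].
    intros s Hs Hst y Hy. specialize (H2 s). rewrite Cmod_RtoC_sub in H2.
    specialize (H2 (Rlt_le_trans _ _ _ Hst (Rmin_l _ _))).
    assert (Hy2 := Rlt_le_trans _ _ _ Hy (Rmin_r _ _)).
    assert (Hyt : Cmod (y - al t) < m) by (generalize (Cmod_tri y (al s) (al t)); lra).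
    split; [apply Hb; apply Rlt_le_trans with m; [auto|apply Rmin_l]|].
    assert (A1 := H1 y (Rlt_le_trans _ _ _ Hyt (Rmin_r _ _))).
    assert (A2 : Cmod (f (al s) - f (al t)) < eps / 2).
    { apply H1. apply Rlt_le_trans with m; [lra|apply Rmin_r]. }
    generalize (Cmod_tri (f y) (f (al t)) (f (al s))). rewrite (Cmod_sym (f (al t))). lra.
Qed.

(** * Integrals over affine families of curves as functions of the parameter *)

Section ParametricIntegral.
Variables (al be ga : R -> C) (a b : R) (D : C -> Prop) (f : C -> C) (z0 : C).
Hypothesis Hab : a <= b.
Hypothesis Hal : pcont_on al a b.
Hypothesis Hbe : pcont_on be a b.
Hypothesis Hga : pcont_on ga a b.
Hypothesis HO : copen D.
Hypothesis Hf : forall z, D z -> ccont f z.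
Hypothesis HD : forall t, a <= t <= b -> D (al t + z0 * be t)%C.

Lemma param_curve_pcont (z : C) : pcont_on (fun t => al t + z * be t)%C a b.
Proof. intros t Ht. apply gcont_plus; [auto|apply gcont_scal; auto]. Qed.

Lemma param_pcont (g : C -> C) (z : C) : (forall w, D w -> ccont g w) ->
  (forall t, a <= t <= b -> D (al t + z * be t)%C) ->
  pcont_on (fun t => g (al t + z * be t) * ga t)%C a b.
Proof.
  intros Hg Hz t Ht. apply gcont_mult; [|auto].
  apply (gcont_comp RtoC g (fun t => al t + z * be t)%C); [apply Hg, Hz; auto|].
  apply param_curve_pcont; auto.
Qed.

Lemma param_near (eps : R) : 0 < eps -> exists d, 0 < d /\ forall z, Cmod (z - z0) < d ->
  forall t, a <= t <= b -> Cmod (z * be t - z0 * be t) < eps.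
Proof.
  intros He. destruct (pcont_bounded be a b Hbe) as [B [HB1 HB]].
  exists (eps / B). split; [apply Rdiv_lt_0_compat; lra|]. intros z Hz t Ht.
  replace (z * be t - z0 * be t)%C with ((z - z0) * be t)%C by ring.
  rewrite Cmod_mult. apply Rle_lt_trans with (Cmod (z - z0) * B).
  - apply Rmult_le_compat_l; [apply Cmod_ge_0|auto].
  - apply (Rmult_lt_compat_r B) in Hz; [|lra]. replace (eps / B * B) with eps in Hz by (field; lra). auto.
Qed.

Lemma Cint_param_cont :
  ccont (fun z => Cint (fun t => f (al t + z * be t) * ga t)%C a b) z0.
Proof.
  intros eps He. destruct (pcont_bounded ga a b Hga) as [B [HB1 HB]].
  set (e := eps / ((b - a + 1) * B)).
  assert (He1 : 0 < e) by (apply Rdiv_lt_0_compat; [lra|nra]).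
  destruct (uniform_near_curve D f _ a b e HO Hf (param_curve_pcont z0) HD He1) as [d [Hd H1]].
  destruct (param_near d Hd) as [d2 [Hd2 H2]].
  exists d2. split; auto. intros z Hz.
  assert (Hy : forall t, a <= t <= b -> Cmod (al t + z * be t - (al t + z0 * be t)) < d).
  { intros t Ht. replace (al t + z * be t - (al t + z0 * be t))%C with (z * be t - z0 * be t)%C by ring. auto. }
  rewrite <- Cint_minus; auto.
  2:{ apply param_pcont; auto. intros t Ht. apply (H1 t Ht _ (Hy t Ht)). }
  2:{ apply param_pcont; auto. }
  eapply Rle_lt_trans.
  - apply (Cint_norm _ a b (e * B) Hab).
    + intros t Ht. apply gcont_minus; (apply (param_pcont f); auto).
      intros s Hs. apply (H1 s Hs _ (Hy s Hs)).
    + intros t Ht.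
      replace (f (al t + z * be t) * ga t - f (al t + z0 * be t) * ga t)%C
       with ((f (al t + z * be t) - f (al t + z0 * be t)) * ga t)%C by ring.
      rewrite Cmod_mult. apply Rmult_le_compat; auto using Cmod_ge_0.
      apply (H1 t Ht _ (Hy t Ht)).
  - replace eps with ((b - a + 1) * (e * B)) by (unfold e; field; lra).
    apply Rmult_lt_compat_r; [nra|lra].
Qed.

(** The family [al t + z * be t] covers circles with centre [z], circles of complex radius [z], and
    segments ending at [z]. Only continuity of the derivative [f] is assumed: the remainder is the
    mean value inequality for [P w - f x * w] on a tube around the curve where [f] varies little. *)
Lemma Cint_param_der (P : C -> C) : (forall z, D z -> cder P z (f z)) ->
  cder (fun z => Cint (fun t => P (al t + z * be t) * ga t)%C a b) z0
    (Cint (fun t => f (al t + z0 * be t) * (be t * ga t))%C a b).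
Proof.
  intros HP eps He. destruct (pcont_bounded ga a b Hga) as [B [HB1 HB]].
  destruct (pcont_bounded be a b Hbe) as [A [HA1 HA]].
  assert (HPc : forall z, D z -> ccont P z) by (intros; eapply gder_gcont; eauto).
  set (e := eps / ((b - a + 1) * (A * B))).
  assert (HAB : 0 < A * B) by nra.
  assert (He1 : 0 < e) by (apply Rdiv_lt_0_compat; [lra|nra]).
  destruct (uniform_near_curve D f _ a b e HO Hf (param_curve_pcont z0) HD He1) as [d [Hd H1]].
  destruct (param_near d Hd) as [d2 [Hd2 H2]].
  exists d2. split; auto. intros z Hz.
  assert (Hy : forall t, a <= t <= b -> Cmod (al t + z * be t - (al t + z0 * be t)) < d).
  { intros t Ht. replace (al t + z * be t - (al t + z0 * be t))%C with (z * be t - z0 * be t)%C by ring. auto. }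
  assert (Hyz : forall t, a <= t <= b -> D (al t + z * be t)%C)
    by (intros t Ht; apply (H1 t Ht _ (Hy t Ht))).
  assert (C1 := param_pcont P z HPc Hyz). assert (C2 := param_pcont P z0 HPc HD).
  assert (C3 : pcont_on (fun t => f (al t + z0 * be t) * (be t * ga t))%C a b).
  { intros t Ht. apply gcont_mult; [|apply gcont_mult; auto].
    apply (gcont_comp RtoC f (fun t => al t + z0 * be t)%C); [apply Hf, HD; auto|].
    apply param_curve_pcont; auto. }
  assert (C4 : pcont_on (fun t => (z - z0) * (f (al t + z0 * be t) * (be t * ga t)))%C a b)
    by (intros t Ht; apply gcont_scal; auto).
  assert (C5 : pcont_on (fun t => P (al t + z * be t) * ga t - P (al t + z0 * be t) * ga t)%C a b)
    by (intros t Ht; apply gcont_minus; [apply (C1 t Ht)|apply (C2 t Ht)]).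
  rewrite (Cmult_comm (Cint _ a b) (z - z0)).
  rewrite <- (Cint_scal (z - z0)%C), <- Cint_minus, <- Cint_minus by auto.
  apply Rle_trans with ((b - a) * (e * (Cmod (z - z0) * A) * B)).
  - apply Cint_norm; auto.
    + intros t Ht. apply gcont_minus; [apply (C5 t Ht)|apply (C4 t Ht)].
    + intros t Ht. set (x := (al t + z0 * be t)%C). set (y := (al t + z * be t)%C).
      replace (P y * ga t - P x * ga t - (z - z0) * (f x * (be t * ga t)))%C
        with (((P y - f x * y) - (P x - f x * x)) * ga t)%C by (unfold x, y; ring).
      rewrite Cmod_mult. apply Rmult_le_compat; auto using Cmod_ge_0.
      apply Rle_trans with (e * Cmod (y - x)).
      * apply (mean_value (cball x d) (fun w => P w - f x * w)%C (fun w => f w - f x)%C).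
        -- apply convex_cball.
        -- unfold cball. replace (x - x)%C with (RtoC 0) by ring. rewrite Cmod_0. auto.
        -- apply Hy, Ht.
        -- intros w Hw. apply (gder_minus _ P (fun w => f x * w)%C); [|apply cder_scal].
           apply HP. apply (H1 t Ht w Hw).
        -- intros w Hw. apply (H1 t Ht w Hw).
      * apply Rmult_le_compat_l; [lra|]. unfold x, y.
        replace (al t + z * be t - (al t + z0 * be t))%C with ((z - z0) * be t)%C by ring.
        rewrite Cmod_mult. apply Rmult_le_compat_l; [apply Cmod_ge_0|auto].
  - replace ((b - a) * (e * (Cmod (z - z0) * A) * B)) with
      ((b - a) * (e * (A * B)) * Cmod (z - z0)) by ring.
    apply Rmult_le_compat_r; [apply Cmod_ge_0|].
    replace eps with ((b - a + 1) * (e * (A * B))) by (unfold e; field; lra).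
    apply Rmult_le_compat_r; [nra|lra].
Qed.

End ParametricIntegral.

Lemma is_derive_eps (u : R -> R) (t l : R) : is_derive u t l ->
  forall eps, 0 < eps -> exists d, 0 < d /\ forall s, Rabs (s - t) < d ->
    Rabs (u s - u t - l * (s - t)) <= eps * Rabs (s - t).
Proof.
  intros [_ H] eps He. destruct (H t (fun P HP => HP) (mkposreal eps He)) as [d H1].
  exists d. split; [apply cond_pos|]. intros s Hs. specialize (H1 s Hs).
  unfold norm, minus, plus, opp, scal in H1; simpl in H1. unfold mult, abs in H1; simpl in H1.
  replace (u s - u t - l * (s - t)) with (u s + - u t + - ((s + - t) * l)) by ring. exact H1.
Qed.

Lemma pder_pair (u v : R -> R) (t du dv : R) : is_derive u t du -> is_derive v t dv ->
  pder (fun s => (u s, v s)) t (du, dv).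
Proof.
  intros Hu Hv eps He.
  destruct (is_derive_eps u t du Hu (eps / 2) ltac:(lra)) as [d1 [Hd1 H1]].
  destruct (is_derive_eps v t dv Hv (eps / 2) ltac:(lra)) as [d2 [Hd2 H2]].
  exists (Rmin d1 d2). split; [apply Rmin_pos; lra|]. intros s Hs.
  rewrite Cmod_RtoC_sub in *.
  specialize (H1 s (Rlt_le_trans _ _ _ Hs (Rmin_l _ _))).
  specialize (H2 s (Rlt_le_trans _ _ _ Hs (Rmin_r _ _))).
  eapply Rle_trans; [apply Cmod_le_sum|]. simpl.
  replace (u s + - u t + - (du * (s + - t) - dv * (0 + - 0))) with (u s - u t - du * (s - t)) by ring.
  replace (v s + - v t + - (du * (0 + - 0) + dv * (s + - t))) with (v s - v t - dv * (s - t)) by ring.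
  lra.
Qed.

Definition cis (t : R) : C := (cos t, sin t).

Lemma pder_cis (t : R) : pder cis t (Ci * cis t)%C.
Proof.
  replace (Ci * cis t)%C with ((- sin t, cos t) : C).
  - apply pder_pair; auto_derive; auto; ring.
  - apply injective_projections; simpl; ring.
Qed.

Lemma pcont_cis (t : R) : pcont cis t.
Proof. eapply gder_gcont, pder_cis. Qed.

Lemma cis_0 : cis 0 = 1.
Proof. unfold cis. rewrite cos_0, sin_0. reflexivity. Qed.

Lemma cis_2PI : cis (2 * PI) = 1.
Proof. unfold cis. rewrite cos_2PI, sin_2PI. reflexivity. Qed.

Lemma Cmod_cis (t : R) : Cmod (cis t) = 1.
Proof.
  unfold Cmod, cis; simpl. replace (cos t * (cos t * 1) + sin t * (sin t * 1)) with 1.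
  - apply sqrt_1.
  - generalize (sin2_cos2 t). unfold Rsqr. lra.
Qed.

Lemma cis_plus (s t : R) : cis (s + t) = (cis s * cis t)%C.
Proof.
  unfold cis. rewrite cos_plus, sin_plus. apply injective_projections; simpl; ring.
Qed.

Lemma cis_opp (t : R) : (cis t * cis (- t))%C = 1.
Proof. rewrite <- cis_plus, Rplus_opp_r. apply cis_0. Qed.

Lemma pder_cis_opp (t : R) : pder (fun t => cis (- t)) t (- (Ci * cis (- t)))%C.
Proof.
  replace (- (Ci * cis (- t)))%C with ((- sin t, - cos t) : C).
  - apply gder_ext with (fun t => (cos t, - sin t) : C).
    + intros s. unfold cis. rewrite cos_neg, sin_neg. reflexivity.
    + apply pder_pair; auto_derive; auto; ring.
  - unfold cis. rewrite cos_neg, sin_neg. apply injective_projections; simpl; ring.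
Qed.

Lemma Ci_neq_0 : Ci <> 0.
Proof. intros E. assert (H := f_equal snd E). simpl in H. lra. Qed.

Lemma two_PI_neq : RtoC (2 * PI) <> 0.
Proof. intros E. apply RtoC_inj in E. generalize PI_RGT_0. lra. Qed.

Lemma cball_center (a : C) (r : R) : 0 < r -> cball a r a.
Proof. intros. unfold cball. replace (a - a)%C with (RtoC 0) by ring. rewrite Cmod_0. auto. Qed.

Lemma cball_circle (a : C) (r R0 t : R) : 0 <= r < R0 -> cball a R0 (a + RtoC r * cis t)%C.
Proof.
  intros Hr. unfold cball. replace (a + r * cis t - a)%C with (r * cis t)%C by ring.
  rewrite Cmod_mult, Cmod_R, Cmod_cis, Rabs_pos_eq by lra. lra.
Qed.

Lemma pcont_on_const (c : C) (a b : R) : pcont_on (fun _ => c) a b.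
Proof. intros t _. apply gcont_const. Qed.

Lemma pcont_on_cis (a b : R) : pcont_on cis a b.
Proof. intros t _. apply pcont_cis. Qed.

Lemma two_PI_pos : 0 <= 2 * PI.
Proof. generalize PI_RGT_0. lra. Qed.

Section MeanValueProperty.
Variables (P f : C -> C) (a : C) (R0 : R).
Hypothesis HP : forall z, cball a R0 z -> cder P z (f z).
Hypothesis Hf : forall z, cball a R0 z -> ccont f z.

(* The derivative in [z] of the mean over the circle of "complex radius" [z] is
   the integral of a derivative along a closed curve. *)
Lemma circle_mean (r : R) : 0 <= r < R0 ->
  Cint (fun t => P (a + r * cis t)%C) 0 (2 * PI) = (RtoC (2 * PI) * P a)%C.
Proof.
  intros Hr. set (N := fun z => Cint (fun t => P (a + z * cis t) * 1)%C 0 (2 * PI)).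
  assert (HN : forall z, cball 0 R0 z -> cder N z 0).
  { intros z Hz. unfold cball in Hz. replace (z - 0)%C with z in Hz by ring.
    assert (HD : forall t, 0 <= t <= 2 * PI -> cball a R0 (a + z * cis t)%C).
    { intros t _. unfold cball. replace (a + z * cis t - a)%C with (z * cis t)%C by ring.
      rewrite Cmod_mult, Cmod_cis. lra. }
    eapply gder_eq; [|apply (Cint_param_der (fun _ => a) cis (fun _ => RtoC 1) 0 (2 * PI) (cball a R0) f z
      two_PI_pos (pcont_on_const _ _ _) (pcont_on_cis _ _) (pcont_on_const _ _ _) (cball_open _ _) Hf HD P HP)].
    assert (Hint : pcont_on (fun t => f (a + z * cis t) * (cis t * 1))%C 0 (2 * PI)).
    { intros t Ht. apply gcont_mult.
      - apply (gcont_comp RtoC f (fun t => a + z * cis t)%C); [apply Hf, HD, Ht|].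
        apply gcont_plus; [apply gcont_const|apply gcont_scal, pcont_cis].
      - apply gcont_mult; [apply pcont_cis|apply gcont_const]. }
    (* The primitive used for [z <> 0] divides by [z]; at [z = 0] the integrand is a constant times
       [cis]. *)
    destruct (classic (z = 0)) as [Z|Z].
    - rewrite (Cint_ftc (fun t => (f a / Ci) * cis t)%C _ 0 (2 * PI)); auto using two_PI_pos.
      + rewrite cis_0, cis_2PI. ring.
      + intros t Ht. subst z. eapply gder_eq; [|apply gder_scal, pder_cis].
        replace (a + 0 * cis t)%C with a by ring. field. apply Ci_neq_0.
    - rewrite (Cint_ftc (fun t => / (Ci * z) * P (a + z * cis t))%C _ 0 (2 * PI)); auto using two_PI_pos.
      + rewrite cis_0, cis_2PI. ring.
      + intros t Ht. eapply gder_eq.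
        2:{ apply gder_scal. apply (gder_comp RtoC P (fun t => a + z * cis t)%C).
            - apply HP, HD, Ht.
            - apply gder_plus; [apply gder_const|apply gder_scal, pder_cis]. }
        field. split; [auto|apply Ci_neq_0]. }
  assert (E : N (RtoC r) = N 0).
  { apply Csub_eq, Cmod_zero. eapply Rle_trans.
    - apply (mean_value (cball 0 R0) N (fun _ => RtoC 0) 0).
      + apply convex_cball.
      + apply cball_center. lra.
      + unfold cball. replace (r - 0)%C with (RtoC r) by ring. rewrite Cmod_R, Rabs_pos_eq; lra.
      + auto.
      + intros. rewrite Cmod_0. lra.
    - lra. }
  transitivity (N r).
  - apply Cint_ext; [apply two_PI_pos|]. intros. ring.
  - rewrite E. unfold N. rewrite (Cint_ext _ (fun _ => P a)).
    + rewrite Cint_const by apply two_PI_pos. ring.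
    + apply two_PI_pos.
    + intros t _. replace (a + 0 * cis t)%C with a by ring. ring.
Qed.

End MeanValueProperty.

Section CauchyFormulas.
Variables (P f : C -> C) (a : C) (R0 : R).
Hypothesis HP : forall z, cball a R0 z -> cder P z (f z).
Hypothesis Hf : forall z, cball a R0 z -> ccont f z.

Lemma circle_param_in (r : R) : 0 <= r < R0 ->
  forall t, 0 <= t <= 2 * PI -> cball a R0 (r * cis t + a * 1)%C.
Proof.
  intros Hr t _. replace (r * cis t + a * 1)%C with (a + r * cis t)%C by ring.
  apply cball_circle, Hr.
Qed.

Lemma pcont_on_rcis (r : R) (u v : R) : pcont_on (fun t => RtoC r * cis t)%C u v.
Proof. intros t _. apply gcont_scal, pcont_cis. Qed.

(** Both sides of [circle_mean] are differentiated with respect to the centre, so that [f] need only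
    be continuous. *)
Lemma circle_mean_deriv (r : R) : 0 <= r < R0 ->
  Cint (fun t => f (a + r * cis t)%C) 0 (2 * PI) = (RtoC (2 * PI) * f a)%C.
Proof.
  intros Hr.
  assert (H := Cint_param_der (fun t => r * cis t)%C (fun _ => RtoC 1) (fun _ => RtoC 1) 0 (2 * PI)
    (cball a R0) f a two_PI_pos (pcont_on_rcis r _ _) (pcont_on_const _ _ _) (pcont_on_const _ _ _)
    (cball_open _ _) Hf (circle_param_in r Hr) P HP).
  assert (Ha : cball a R0 a) by (apply cball_center; lra).
  assert (H2 := gder_scal _ P a _ (RtoC (2 * PI)) (HP a Ha)).
  eapply gder_ext_loc with (g := fun z => (RtoC (2 * PI) * P z)%C) (d := R0 - r) in H; [|lra|].
  - rewrite <- (cder_unique _ _ _ _ H H2). apply Cint_ext; [apply two_PI_pos|].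
    intros t _. replace (r * cis t + a * 1)%C with (a + r * cis t)%C by ring. ring.
  - intros y Hy.
    assert (Hsub : forall z, cball y (R0 - Cmod (y - a)) z -> cball a R0 z).
    { unfold cball. intros z Hz. generalize (Cmod_tri z y a). lra. }
    rewrite <- (circle_mean P f y (R0 - Cmod (y - a)) (fun z Hz => HP z (Hsub z Hz))
      (fun z Hz => Hf z (Hsub z Hz)) r); [|lra].
    apply Cint_ext; [apply two_PI_pos|].
    intros t _. replace (r * cis t + y * 1)%C with (y + r * cis t)%C by ring. ring.
Qed.

(** Integration by parts: the derivative of [P (a + r * cis t) * cis (- t)] has integral 0 over the
    closed circle, which ties this moment to the mean of [f]. *)
Lemma circle_first_moment (r : R) : 0 <= r < R0 ->
  Cint (fun t => P (a + r * cis t) * cis (- t))%C 0 (2 * PI) = (RtoC (2 * PI) * r * f a)%C.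
Proof.
  intros Hr.
  assert (HPc : forall z, cball a R0 z -> ccont P z) by (intros; eapply gder_gcont; eauto).
  assert (Hc : forall t, pcont (fun t => a + r * cis t)%C t)
    by (intros t; apply gcont_plus; [apply gcont_const|apply gcont_scal, pcont_cis]).
  assert (C1 : pcont_on (fun t => f (a + r * cis t)%C) 0 (2 * PI)).
  { intros t _. apply (gcont_comp RtoC f (fun t => a + r * cis t)%C); auto.
    apply Hf, cball_circle, Hr. }
  assert (C2 : pcont_on (fun t => P (a + r * cis t) * cis (- t))%C 0 (2 * PI)).
  { intros t _. apply gcont_mult.
    - apply (gcont_comp RtoC P (fun t => a + r * cis t)%C); auto. apply HPc, cball_circle, Hr.
    - eapply gder_gcont, pder_cis_opp. }
  assert (H : Cint (fun t => Ci * r * f (a + r * cis t) - Ci * (P (a + r * cis t) * cis (- t)))%C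
    0 (2 * PI) = 0).
  { rewrite (Cint_ftc (fun t => P (a + r * cis t) * cis (- t))%C); [|apply two_PI_pos| |].
    - rewrite cis_2PI, Ropp_0, cis_0.
      assert (E := cis_opp (2 * PI)). rewrite cis_2PI in E.
      replace (cis (- (2 * PI))) with (RtoC 1); [ring|]. rewrite <- E. ring.
    - intros t _. eapply gder_eq.
      2:{ apply (gder_mult RtoC (fun t => P (a + r * cis t)%C) (fun t => cis (- t))); [|apply pder_cis_opp].
          apply (gder_comp RtoC P (fun t => a + r * cis t)%C); [apply HP, cball_circle, Hr|].
          apply gder_plus; [apply gder_const|apply gder_scal, pder_cis]. }
      replace (f (a + r * cis t) * (0 + r * (Ci * cis t)) * cis (- t))%C
        with (f (a + r * cis t) * r * Ci * (cis t * cis (- t)))%C by ring.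
      rewrite cis_opp. ring.
    - intros t Ht. apply gcont_minus; apply gcont_scal; [apply (C1 t Ht)|apply (C2 t Ht)]. }
  rewrite Cint_minus, !Cint_scal, circle_mean_deriv in H;
    try apply two_PI_pos; auto; try (intros t Ht; apply gcont_scal; [apply (C1 t Ht)||apply (C2 t Ht)]).
  apply Csub_eq. apply NNPP. intros N.
  apply (Cmult_neq_0 _ _ Ci_neq_0 N).
  replace (RtoC 0) with (- RtoC 0)%C by ring. rewrite <- H. ring.
Qed.

End CauchyFormulas.

Lemma cball_sub (a y : C) (R0 : R) (z : C) : cball y (R0 - Cmod (y - a)) z -> cball a R0 z.
Proof. unfold cball. intros Hz. generalize (Cmod_tri z y a). lra. Qed.

(** Differentiating [circle_first_moment] in the centre replaces the primitive by [f] itself: this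
    is Cauchy's formula for the derivative. *)
Lemma circle_first_moment_deriv (P f : C -> C) (a l : C) (R0 r : R) :
  (forall z, cball a R0 z -> cder P z (f z)) -> (forall z, cball a R0 z -> ccont f z) ->
  0 <= r < R0 -> cder f a l ->
  Cint (fun t => f (a + r * cis t) * cis (- t))%C 0 (2 * PI) = (RtoC (2 * PI) * r * l)%C.
Proof.
  intros HP Hf Hr Hl.
  assert (C0 : pcont_on (fun t => cis (- t)) 0 (2 * PI)) by (intros t _; eapply gder_gcont, pder_cis_opp).
  assert (H := Cint_param_der (fun t => r * cis t)%C (fun _ => RtoC 1) (fun t => cis (- t)) 0 (2 * PI)
    (cball a R0) f a two_PI_pos (pcont_on_rcis r _ _) (pcont_on_const _ _ _) C0
    (cball_open _ _) Hf (circle_param_in a R0 r Hr) P HP).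
  assert (H2 := gder_scal _ f a _ (RtoC (2 * PI) * r)%C Hl).
  eapply gder_ext_loc with (g := fun z => (RtoC (2 * PI) * r * f z)%C) (d := R0 - r) in H; [|lra|].
  - rewrite <- (cder_unique _ _ _ _ H H2). apply Cint_ext; [apply two_PI_pos|].
    intros t _. replace (r * cis t + a * 1)%C with (a + r * cis t)%C by ring. ring.
  - intros y Hy.
    rewrite <- (circle_first_moment P f y (R0 - Cmod (y - a)) (fun z Hz => HP z (cball_sub a y R0 z Hz))
      (fun z Hz => Hf z (cball_sub a y R0 z Hz)) r); [|lra].
    apply Cint_ext; [apply two_PI_pos|].
    intros t _. replace (r * cis t + y * 1)%C with (y + r * cis t)%C by ring. ring.
Qed.

Lemma hol_circle_mean (f : C -> C) (a : C) (R0 r : R) : hol (cball a R0) f -> 0 <= r < R0 ->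
  Cint (fun t => f (a + r * cis t)%C) 0 (2 * PI) = (RtoC (2 * PI) * f a)%C.
Proof.
  intros Hf Hr. destruct (primitive _ f (good_cball a R0) Hf) as [P HP].
  apply (circle_mean_deriv P f a R0); auto. intros z Hz. eapply hol_ccont; eauto.
Qed.

Lemma hol_circle_moment (f : C -> C) (a : C) (R0 r : R) : hol (cball a R0) f -> 0 <= r < R0 ->
  Cint (fun t => f (a + r * cis t) * cis (- t))%C 0 (2 * PI) = (RtoC (2 * PI) * r * cD f a)%C.
Proof.
  intros Hf Hr. destruct (primitive _ f (good_cball a R0) Hf) as [P HP].
  apply (circle_first_moment_deriv P f a _ R0); auto.
  - intros z Hz. eapply hol_ccont; eauto.
  - apply (hol_cD _ _ _ Hf), cball_center. lra.
Qed.

(** Up to a constant, [cD f] is an integral with the centre as parameter. Continuity has to come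
    before [hol_deriv], where differentiation under the integral sign presupposes it. *)
Lemma hol_cD_continuous (D : C -> Prop) (f : C -> C) (a : C) : copen D -> hol D f -> D a ->
  ccont (cD f) a.
Proof.
  intros HO Hf Ha. destruct (HO a Ha) as [R0 [HR Hb]].
  assert (Hf' := hol_sub D _ f Hb Hf).
  set (r := R0 / 2). assert (Hr : 0 <= r < R0) by (unfold r; lra).
  set (N := fun z => Cint (fun t => f (r * cis t + z * 1) * cis (- t))%C 0 (2 * PI)).
  assert (C0 : pcont_on (fun t => cis (- t)) 0 (2 * PI)) by (intros t _; eapply gder_gcont, pder_cis_opp).
  assert (HN : ccont N a).
  { apply (Cint_param_cont (fun t => r * cis t)%C (fun _ => RtoC 1) (fun t => cis (- t)) 0 (2 * PI)
      (cball a R0) f a two_PI_pos (pcont_on_rcis r _ _) (pcont_on_const _ _ _) C0 (cball_open _ _)).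
    - intros z Hz. eapply hol_ccont; eauto.
    - apply circle_param_in, Hr. }
  assert (Hk : (RtoC (2 * PI) * r)%C <> 0).
  { apply Cmult_neq_0; [apply two_PI_neq|]. intros E. apply RtoC_inj in E. unfold r in E. lra. }
  set (k := (RtoC (2 * PI) * r)%C) in *.
  apply (gcont_ext_loc _ (fun z => / k * N z)%C _ a (R0 - r)); [lra| |].
  - intros y Hy. unfold N.
    rewrite (Cint_ext _ (fun t => f (y + r * cis t) * cis (- t))%C).
    + rewrite (hol_circle_moment f y (R0 - Cmod (y - a)) r).
      * fold k. field. exact Hk.
      * apply (hol_sub _ _ _ (cball_sub a y R0) Hf').
      * lra.
    + apply two_PI_pos.
    + intros t _. replace (r * cis t + y * 1)%C with (y + r * cis t)%C by ring. ring.
  - apply gcont_scal, HN.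
Qed.

Theorem hol_deriv (D : C -> Prop) (f : C -> C) : copen D -> hol D f -> hol D (cD f).
Proof.
  intros HO Hf a Ha. destruct (HO a Ha) as [R0 [HR Hb]].
  assert (Hf' := hol_sub D _ f Hb Hf).
  set (r := R0 / 2). assert (Hr : 0 <= r < R0) by (unfold r; lra).
  assert (C0 : pcont_on (fun t => cis (- t)) 0 (2 * PI)) by (intros t _; eapply gder_gcont, pder_cis_opp).
  assert (HP : forall z, cball a R0 z -> cder f z (cD f z)) by (intros z Hz; apply (hol_cD _ _ _ Hf' Hz)).
  assert (HC : forall z, cball a R0 z -> ccont (cD f) z)
    by (intros z Hz; apply (hol_cD_continuous D); auto).
  assert (H := Cint_param_der (fun t => r * cis t)%C (fun _ => RtoC 1) (fun t => cis (- t)) 0 (2 * PI)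
    (cball a R0) (cD f) a two_PI_pos (pcont_on_rcis r _ _) (pcont_on_const _ _ _) C0
    (cball_open _ _) HC (circle_param_in a R0 r Hr) f HP).
  set (k := (RtoC (2 * PI) * r)%C).
  assert (Hk : k <> 0).
  { apply Cmult_neq_0; [apply two_PI_neq|]. intros E. apply RtoC_inj in E. unfold r in E. lra. }
  eexists. apply (gder_scal _ _ _ _ (/ k)%C) in H.
  eapply gder_ext_loc; [|intros y Hy|exact H].
  - instantiate (1 := R0 - r). lra.
  - cbv beta.
    rewrite (Cint_ext _ (fun t => f (y + r * cis t) * cis (- t))%C).
    + rewrite (hol_circle_moment f y (R0 - Cmod (y - a)) r).
      * fold k. field. exact Hk.
      * apply (hol_sub _ _ _ (cball_sub a y R0) Hf').
      * lra.
    + apply two_PI_pos.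
    + intros t _. replace (r * cis t + y * 1)%C with (y + r * cis t)%C by ring. ring.
Qed.

Lemma Cmod_Rscal (k : R) (z : C) : 0 <= k -> Cmod (RtoC k * z) = k * Cmod z.
Proof. intros Hk. rewrite Cmod_mult, Cmod_R, Rabs_pos_eq by auto. reflexivity. Qed.

Lemma circle_pcont (f : C -> C) (a : C) (R0 r : R) : hol (cball a R0) f -> 0 <= r < R0 ->
  forall t, pcont (fun t => f (a + r * cis t)%C) t.
Proof.
  intros Hf Hr t. apply (gcont_comp RtoC f (fun t => a + r * cis t)%C).
  - eapply hol_ccont; eauto. apply cball_circle, Hr.
  - apply gcont_plus; [apply gcont_const|apply gcont_scal, pcont_cis].
Qed.

Lemma center_bound (f : C -> C) (a : C) (R0 r M : R) : hol (cball a R0) f -> 0 <= r < R0 ->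
  (forall t, 0 <= t <= 2 * PI -> Cmod (f (a + r * cis t)%C) <= M) -> Cmod (f a) <= M.
Proof.
  intros Hf Hr HM. assert (E := hol_circle_mean f a R0 r Hf Hr).
  apply (f_equal Cmod) in E. rewrite Cmod_Rscal in E by apply two_PI_pos.
  assert (H : Cmod (Cint (fun t => f (a + r * cis t)%C) 0 (2 * PI)) <= (2 * PI - 0) * M).
  { apply Cint_norm; auto using two_PI_pos. intros t _. apply (circle_pcont f a R0 r Hf Hr). }
  rewrite E in H. generalize PI_RGT_0. nra.
Qed.

Lemma cauchy_estimate (f : C -> C) (a : C) (R0 r M : R) : hol (cball a R0) f -> 0 < r < R0 ->
  (forall z, cball a R0 z -> Cmod (f z) <= M) -> Cmod (cD f a) <= M / r.
Proof.
  intros Hf Hr HM. assert (E := hol_circle_moment f a R0 r Hf ltac:(lra)).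
  apply (f_equal Cmod) in E. rewrite <- Cmult_assoc, Cmod_Rscal, Cmod_Rscal in E by (try apply two_PI_pos; lra).
  assert (H : Cmod (Cint (fun t => f (a + r * cis t) * cis (- t))%C 0 (2 * PI)) <= (2 * PI - 0) * M).
  { apply Cint_norm; auto using two_PI_pos.
    - intros t _. apply gcont_mult; [apply (circle_pcont f a R0 r Hf ltac:(lra))|].
      eapply gder_gcont, pder_cis_opp.
    - intros t _. rewrite Cmod_mult, Cmod_cis, Rmult_1_r. apply HM, cball_circle. lra. }
  rewrite E in H. apply Rmult_le_reg_l with (2 * PI * r).
  - generalize PI_RGT_0. nra.
  - replace (2 * PI * r * (M / r)) with (2 * PI * M) by (field; lra). lra.
Qed.

(** * Removable singularities and univalent functions *)

Lemma hol_cD_cD (D : C -> Prop) (f : C -> C) (z : C) : copen D -> hol D f -> D z ->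
  cder (cD f) z (cD (cD f) z).
Proof. intros HO Hf Hz. apply (hol_cD D); [apply hol_deriv; auto|auto]. Qed.

(** Hadamard's formula: [Q z] is the integral over [[0, 1]] of [f'] along the segment from [a] to
    [z], which is holomorphic in [z] and defined at [a] without a case distinction. *)
Lemma quotient_ball (f : C -> C) (a : C) (R0 : R) : 0 < R0 -> hol (cball a R0) f ->
  exists Q, hol (cball a R0) Q /\ (forall z, cball a R0 z -> (f z - f a = Q z * (z - a))%C) /\
    Q a = cD f a.
Proof.
  intros HR Hf. assert (HO := cball_open a R0).
  assert (Hf' : hol (cball a R0) (cD f)) by (apply hol_deriv; auto).
  set (al := fun t : R => (a - RtoC t * a)%C).
  assert (Hal : pcont_on al 0 1).
  { intros t _. apply gcont_minus; [apply gcont_const|].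
    apply gcont_mult; [apply gcont_phi|apply gcont_const]. }
  assert (Hbe : pcont_on RtoC 0 1) by (intros t _; apply gcont_phi).
  assert (HD : forall z, cball a R0 z -> forall t, 0 <= t <= 1 -> cball a R0 (al t + z * t)%C).
  { intros z Hz t Ht. replace (al t + z * t)%C with (seg a z t) by (unfold al, seg; ring).
    apply convex_cball; auto. apply cball_center, HR. }
  exists (fun z => Cint (fun t => cD f (al t + z * t) * 1)%C 0 1). split; [|split].
  - intros z Hz. eexists.
    apply (Cint_param_der al RtoC (fun _ => RtoC 1) 0 1 (cball a R0) (cD (cD f)) z ltac:(lra) Hal Hbe
      (pcont_on_const _ _ _) HO); auto.
    + intros w Hw. apply (hol_cD_continuous (cball a R0)); auto.
    + intros w Hw. apply (hol_cD_cD (cball a R0)); auto.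
  - intros z Hz.
    assert (Hc : pcont_on (fun t => cD f (al t + z * t) * 1)%C 0 1).
    { apply (param_pcont al RtoC (fun _ => RtoC 1) 0 1 (cball a R0)); auto.
      - apply pcont_on_const.
      - intros w Hw. eapply hol_ccont; eauto. }
    rewrite Cmult_comm, <- Cint_scal by (auto; lra).
    rewrite (Cint_ftc (fun t => f (al t + z * t)%C)); [|lra| |].
    + replace (al 1 + z * 1)%C with z by (unfold al; ring).
      replace (al 0 + z * 0)%C with a by (unfold al; ring). reflexivity.
    + intros t Ht. eapply gder_eq.
      2:{ apply (gder_comp RtoC f (fun t => al t + z * t)%C).
          - apply (hol_cD (cball a R0)); auto.
          - apply gder_plus; [|apply gder_scal, gder_phi].
            apply gder_minus; [apply gder_const|]. apply gder_mult; [apply gder_phi|apply gder_const]. }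
      cbv beta. ring.
    + intros t Ht. apply gcont_scal, (Hc t Ht).
  - rewrite (Cint_ext _ (fun _ => cD f a)); [|lra|].
    + rewrite Cint_const by lra. ring.
    + intros t _. replace (al t + a * t)%C with a by (unfold al; ring). ring.
Qed.

Lemma quotient_hol (D : C -> Prop) (f : C -> C) (a : C) : copen D -> hol D f -> D a ->
  exists Q, hol D Q /\ (forall z, D z -> (f z - f a = Q z * (z - a))%C) /\ Q a = cD f a.
Proof.
  intros HO Hf Ha.
  set (Q := fun z => if Ceq_dec z a then cD f a else ((f z - f a) / (z - a))%C).
  assert (Qa : Q a = cD f a) by (unfold Q; destruct (Ceq_dec a a); congruence).
  assert (Qn : forall z, z <> a -> Q z = ((f z - f a) / (z - a))%C)
    by (intros z Hz; unfold Q; destruct (Ceq_dec z a); congruence).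
  exists Q. split; [|split; auto].
  - intros z Hz. destruct (classic (z = a)) as [->|Hza].
    + destruct (HO a Ha) as [r [Hr Hb]].
      destruct (quotient_ball f a r Hr (hol_sub _ _ _ Hb Hf)) as (Q1 & H1 & H2 & H3).
      destruct (H1 a (cball_center a r Hr)) as [l Hl]. exists l.
      apply (gder_ext_loc _ Q1 Q a l r Hr); auto.
      intros y Hy. destruct (classic (y = a)) as [->|Hya]; [congruence|].
      rewrite Qn by auto. rewrite H2 by exact Hy. field. apply Csub_neq, Hya.
    + destruct (Hf z Hz) as [l Hl]. eexists.
      apply (gder_ext_loc _ (fun y => (f y - f a) / (y - a))%C Q z _ (Cmod (z - a))).
      * apply Cmod_pos, Csub_neq, Hza.
      * intros y Hy. symmetry. apply Qn. intros ->. rewrite (Cmod_sym a z) in Hy. lra.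
      * apply gder_div; [apply Csub_neq, Hza| |].
        -- apply gder_minus; [apply Hl|apply gder_const].
        -- apply gder_minus; [apply gder_phi|apply gder_const].
  - intros z Hz. destruct (classic (z = a)) as [->|Hza]; [ring|].
    rewrite Qn by auto. field. apply Csub_neq, Hza.
Qed.

(** Continuity of [h] makes [(z - a) * h z] differentiable at [a] with derivative [h a]; dividing by
    [z - a] through [quotient_hol] gives back [h]. *)
Lemma removable (D : C -> Prop) (h : C -> C) (a : C) : copen D -> D a ->
  (forall z, D z -> z <> a -> exists l, cder h z l) -> ccont h a -> hol D h.
Proof.
  intros HO Ha Hh Hc. set (k := fun z => ((z - a) * h z)%C).
  assert (Hka : cder k a (h a)).
  { intros eps He. destruct (Hc eps He) as [d [Hd H1]]. exists d. split; auto.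
    intros y Hy. unfold k. replace ((y - a) * h y - (a - a) * h a - h a * (y - a))%C
      with ((h y - h a) * (y - a))%C by ring.
    rewrite Cmod_mult. apply Rmult_le_compat_r; [apply Cmod_ge_0|]. left. auto. }
  assert (Hk : hol D k).
  { intros z Hz. destruct (classic (z = a)) as [->|Hza]; [eauto|].
    destruct (Hh z Hz Hza) as [l Hl]. eexists. apply gder_mult; [|apply Hl].
    apply gder_minus; [apply gder_phi|apply gder_const]. }
  destruct (quotient_hol D k a HO Hk Ha) as (Q & HQ & EQ & Qa).
  assert (E : forall z, D z -> Q z = h z).
  { intros z Hz. destruct (classic (z = a)) as [->|Hza].
    - rewrite Qa. apply cD_unique, Hka.
    - specialize (EQ z Hz). unfold k in EQ.
      replace ((z - a) * h z - (a - a) * h a)%C with (h z * (z - a))%C in EQ by ring.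
      apply Csub_eq. apply NNPP; intros N.
      apply (Cmult_neq_0 _ _ N (Csub_neq _ _ Hza)).
      replace ((Q z - h z) * (z - a))%C with (Q z * (z - a) - h z * (z - a))%C by ring.
      rewrite <- EQ. ring. }
  intros z Hz. destruct (HQ z Hz) as [l Hl]. destruct (HO z Hz) as [r [Hr Hb]].
  exists l. apply (gder_ext_loc _ Q h z l r Hr); auto.
Qed.

Definition inj_on (D : C -> Prop) (F : C -> C) : Prop :=
  forall x y, D x -> D y -> F x = F y -> x = y.

Lemma circle_lower_bound (f : C -> C) (a : C) (R0 r : R) : hol (cball a R0) f -> 0 <= r < R0 ->
  (forall t, 0 <= t <= 2 * PI -> f (a + r * cis t)%C <> 0) ->
  exists d, 0 < d /\ forall t, 0 <= t <= 2 * PI -> d <= Cmod (f (a + r * cis t)%C).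
Proof.
  intros Hf Hr Hn. apply (compact_uniform 0 (2 * PI) (fun t d => d <= Cmod (f (a + r * cis t)%C))).
  - intros; lra.
  - intros t Ht. assert (Hp := Cmod_pos _ (Hn t Ht)). set (m := Cmod _) in *.
    destruct (circle_pcont f a R0 r Hf Hr t (m / 2) ltac:(lra)) as [d [Hd H1]].
    exists (Rmin d (m / 2)). split; [apply Rmin_pos; lra|].
    intros s Hs Hst. specialize (H1 s). rewrite Cmod_RtoC_sub in H1.
    specialize (H1 (Rlt_le_trans _ _ _ Hst (Rmin_l _ _))).
    rewrite Cmod_sym in H1. generalize (Cmod_tri_inv (f (a + r * cis t)%C) (f (a + r * cis s)%C)).
    fold m. generalize (Rmin_r d (m / 2)). lra.
Qed.

(* If [F' z0 = 0], the minimum principle for the nonvanishing quotients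
   [(F z - F a) / (z - a)] forces [F' a = 0] for all [a] near [z0]. *)
Lemma univalent_deriv (U : C -> Prop) (F : C -> C) (z0 : C) : copen U -> hol U F -> inj_on U F ->
  U z0 -> cD F z0 <> 0.
Proof.
  intros HO HF HI Hz0 E0. destruct (HO z0 Hz0) as [R0 [HR Hb]].
  set (r := R0 / 2). assert (Hr : 0 < r < R0) by (unfold r; lra).
  assert (HFb := hol_sub _ _ _ Hb HF).
  assert (Hcirc : forall t, U (z0 + r * cis t)%C) by (intros; apply Hb, cball_circle; lra).
  destruct (circle_lower_bound (fun z => F z - F z0)%C z0 R0 r) as [d2 [Hd2 Hlow]]; [|lra| |].
  { intros z Hz. destruct (HFb z Hz) as [l Hl]. eexists.
    apply gder_minus; [apply Hl|apply gder_const]. }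
  { intros t _ E. apply Csub_eq in E. apply HI in E; auto.
    assert (E2 : (r * cis t)%C = 0).
    { replace (r * cis t)%C with (z0 + r * cis t - z0)%C by ring. rewrite E. ring. }
    apply (f_equal Cmod) in E2. rewrite Cmod_Rscal, Cmod_cis, Cmod_0 in E2 by lra. lra. }
  (* On the circle the quotients satisfy [|Q| >= (d2 / 2) / (2 * r) = / K]. *)
  set (K := 4 * r / d2). assert (HK : 0 < K) by (apply Rdiv_lt_0_compat; lra).
  assert (HF0 : cder F z0 0) by (rewrite <- E0; apply (hol_cD U); auto).
  destruct (gder_gcont _ _ _ _ HF0 (d2 / 2) ltac:(lra)) as [e1 [He1 H1]].
  (* [F' z0 = 0] makes [|Q z0| <= / (2 * K)], half of what the minimum principle guarantees. *)
  destruct (HF0 (/ (2 * K)) ltac:(apply Rinv_0_lt_compat; lra)) as [e2 [He2 H2]].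
  set (e := Rmin r (Rmin e1 e2)).
  assert (He : 0 < e) by (repeat apply Rmin_pos; lra).
  assert (Hzero : forall a, cball z0 e a -> cD F a = 0).
  { intros a Ha. apply NNPP. intros Hn.
    assert (Ha1 : Cmod (a - z0) < r) by (eapply Rlt_le_trans; [apply Ha|apply Rmin_l]).
    assert (Ha2 : Cmod (a - z0) < e1)
      by (eapply Rlt_le_trans; [apply Ha|eapply Rle_trans; [apply Rmin_r|apply Rmin_l]]).
    assert (Ha3 : Cmod (a - z0) < e2)
      by (eapply Rlt_le_trans; [apply Ha|eapply Rle_trans; [apply Rmin_r|apply Rmin_r]]).
    assert (Ua : U a) by (apply Hb; unfold cball; lra).
    destruct (quotient_hol U F a HO HF Ua) as (Q & HQ & EQ & Qa).
    assert (Qn : forall z, U z -> Q z <> 0).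
    { intros z Uz Z. destruct (classic (z = a)) as [->|Hza]; [congruence|].
      apply Hza, HI; auto. apply Csub_eq. rewrite EQ, Z by auto. ring. }
    assert (Hb1 : Cmod (/ Q z0) <= K).
    { apply (center_bound (fun z => / Q z)%C z0 R0 r); [|lra|].
      - intros z Hz. destruct (HQ z (Hb z Hz)) as [l Hl]. eexists.
        apply gder_inv; [apply Qn, Hb, Hz|apply Hl].
      - intros t Ht. set (z := (z0 + r * cis t)%C). assert (Uz : U z) by apply Hcirc.
        rewrite Cmod_inv by (apply Qn, Uz).
        assert (Hq := Cmod_pos _ (Qn z Uz)).
        assert (M := f_equal Cmod (EQ z Uz)). rewrite Cmod_mult in M.
        assert (L1 : d2 / 2 <= Cmod (F z - F a)).
        { generalize (Hlow t Ht) (Cmod_tri (F z) (F a) (F z0)) (H1 a Ha2). fold z. lra. }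
        assert (L2 : Cmod (z - a) <= 2 * r).
        { generalize (Cmod_tri z z0 a). rewrite (Cmod_sym z0 a).
          replace (z - z0)%C with (r * cis t)%C by (unfold z; ring).
          rewrite Cmod_Rscal, Cmod_cis by lra. lra. }
        apply Rmult_le_reg_r with (Cmod (Q z)); [auto|]. rewrite Rinv_l by lra.
        apply Rmult_le_reg_r with (d2 / 2); [lra|].
        replace (K * Cmod (Q z) * (d2 / 2)) with (Cmod (Q z) * (2 * r)) by (unfold K; field; lra).
        generalize (Cmod_ge_0 (z - a)). nra. }
    rewrite Cmod_inv in Hb1 by (apply Qn, Hz0). assert (Hq := Cmod_pos _ (Qn z0 Hz0)).
    assert (M := f_equal Cmod (EQ z0 Hz0)). rewrite Cmod_mult in M.
    specialize (H2 a Ha3). replace (F a - F z0 - 0 * (a - z0))%C with (F a - F z0)%C in H2 by ring.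
    rewrite (Cmod_sym z0 a), (Cmod_sym (F z0)) in M.
    assert (Hp : 0 < Cmod (a - z0)) by (apply Cmod_pos, Csub_neq; intros ->; congruence).
    assert (KQ : 1 <= K * Cmod (Q z0)).
    { apply Rmult_le_compat_r with (r := Cmod (Q z0)) in Hb1; [|lra]. rewrite Rinv_l in Hb1; lra. }
    assert (K * Cmod (F a - F z0) <= / 2 * Cmod (a - z0)).
    { apply Rmult_le_compat_l with (r := K) in H2; [|lra].
      replace (K * (/ (2 * K) * Cmod (a - z0))) with (/ 2 * Cmod (a - z0)) in H2 by (field; lra). auto. }
    rewrite M in H. nra. }
  (* With zero derivative on a ball [F] is constant there; any second point of the ball contradicts
     injectivity. *)
  set (y := (z0 + RtoC (e / 2))%C).
  assert (Hy : Cmod (y - z0) = e / 2).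
  { unfold y. replace (z0 + RtoC (e / 2) - z0)%C with (RtoC (e / 2)) by ring.
    rewrite Cmod_R, Rabs_pos_eq; lra. }
  assert (Her : e <= r) by apply Rmin_l.
  assert (Ey : F y = F z0).
  { apply Csub_eq, Cmod_zero.
    replace 0 with (0 * Cmod (y - z0)) by ring.
    apply (mean_value (cball z0 e) F (cD F) 0).
    - apply convex_cball.
    - apply cball_center, He.
    - unfold cball. lra.
    - intros z Hz. apply (hol_cD U); auto. apply Hb. unfold cball in *. lra.
    - intros z Hz. rewrite Hzero by auto. rewrite Cmod_0. lra. }
  apply HI in Ey; auto.
  - rewrite Ey in Hy. replace (z0 - z0)%C with (RtoC 0) in Hy by ring. rewrite Cmod_0 in Hy. lra.
  - apply Hb. unfold cball. lra.
Qed.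

(* Newton iteration with the fixed slope [A]. *)
Lemma quantitative_open (F F' : C -> C) (z0 A w : C) (r : R) : A <> 0 ->
  (forall z, cball z0 r z -> cder F z (F' z)) ->
  (forall z, cball z0 r z -> Cmod (F' z - A) <= Cmod A / 2) ->
  Cmod (w - F z0) < Cmod A * r / 8 ->
  exists z, cball z0 r z /\ F z = w.
Proof.
  intros HA HF HF' Hw. assert (HAp := Cmod_pos A HA).
  set (K := Cmod (w - F z0) / Cmod A).
  assert (HK0 : 0 <= K) by (apply Rdiv_le_0_compat; [apply Cmod_ge_0|auto]).
  (* The limit of the iteration will lie within [4 * K] of [z0], hence inside the ball. *)
  assert (HK : 8 * K < r).
  { unfold K. apply Rmult_lt_reg_r with (Cmod A); [auto|].
    replace (8 * (Cmod (w - F z0) / Cmod A) * Cmod A) with (8 * Cmod (w - F z0)) by (field; lra). lra. }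
  assert (Hr : 0 < r) by lra.
  set (T := fun z => (z - (F z - w) / A)%C).
  assert (HT : forall x y, cball z0 r x -> cball z0 r y -> Cmod (T y - T x) <= / 2 * Cmod (y - x)).
  { intros x y Hx Hy. apply (mean_value (cball z0 r) T (fun z => 1 - / A * (F' z - 0))%C); auto.
    - apply convex_cball.
    - intros z Hz. apply gder_ext with (fun z => z - / A * (F z - w))%C.
      + intros v. unfold T. field. auto.
      + apply gder_minus; [apply gder_phi|]. apply gder_scal, gder_minus; [auto|apply gder_const].
    - intros z Hz. replace (1 - / A * (F' z - 0))%C with (- / A * (F' z - A))%C by (field; auto).
      rewrite Cmod_mult, Cmod_opp, Cmod_inv by auto. specialize (HF' z Hz).
      apply Rmult_le_reg_l with (Cmod A); [auto|].
      rewrite <- Rmult_assoc, Rinv_r by lra. lra. }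
  set (u := fix u n := match n with O => z0 | S k => T (u k) end).
  assert (H1 : Cmod (T z0 - z0) <= K).
  { unfold T, K. replace (z0 - (F z0 - w) / A - z0)%C with ((w - F z0) * / A)%C by (field; auto).
    rewrite Cmod_mult, Cmod_inv by auto. right. reflexivity. }
  assert (Hu : forall n, Cmod (u n - z0) <= 2 * K * (1 - (/ 2) ^ n) /\
    Cmod (u (S n) - u n) <= K * (/ 2) ^ n).
  { induction n as [|n [IH1 IH2]].
    - simpl. replace (z0 - z0)%C with (RtoC 0) by ring. rewrite Cmod_0. lra.
    - assert (B1 : Cmod (u (S n) - z0) <= 2 * K * (1 - (/ 2) ^ S n)).
      { generalize (Cmod_tri (u (S n)) (u n) z0). simpl (_ ^ S _). lra. }
      split; [exact B1|].
      change (u (S (S n))) with (T (u (S n))). change (u (S n)) with (T (u n)) at 2.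
      eapply Rle_trans; [apply HT|].
      + unfold cball. generalize (half_pow_pos n). nra.
      + unfold cball. generalize (half_pow_pos (S n)). nra.
      + simpl (_ ^ S _). lra. }
  destruct (geometric_limit u K HK0) as [p Hp]; [intros; apply Hu|].
  assert (Hpb : cball z0 r p).
  { unfold cball. specialize (Hp 0%nat). simpl in Hp. rewrite Cmod_sym. lra. }
  exists p. split; [auto|].
  assert (E : T p = p).
  { apply Csub_eq, Cmod_zero. apply Rnot_lt_le. intros HL.
    destruct (half_pow_small (Cmod (T p - p) / (8 * K + 1))) as [n Hn]; [apply Rdiv_lt_0_compat; lra|].
    apply (Rmult_lt_compat_l (8 * K + 1)) in Hn; [|lra].
    replace ((8 * K + 1) * (Cmod (T p - p) / (8 * K + 1))) with (Cmod (T p - p)) in Hn by (field; lra).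
    assert (B := HT (u n) p ltac:(unfold cball; generalize (proj1 (Hu n)) (half_pow_pos n); nra) Hpb).
    assert (P1 := Hp n). assert (P2 := Hp (S n)). change (u (S n)) with (T (u n)) in P2.
    simpl (_ ^ S _) in P2. rewrite Cmod_sym in P1.
    generalize (Cmod_tri (T p) (T (u n)) p) (half_pow_pos n). nra. }
  unfold T in E. apply Csub_eq. apply NNPP. intros N.
  apply (Cmult_neq_0 _ (/ A) N).
  { intros Z. apply (f_equal (Cmult A)) in Z. rewrite Cinv_r in Z by auto.
    replace (A * 0)%C with (RtoC 0) in Z by ring. apply RtoC_inj in Z. lra. }
  change ((F p - w) * / A)%C with ((F p - w) / A)%C.
  replace ((F p - w) / A)%C with (p - (p - (F p - w) / A))%C by ring. rewrite E. ring.
Qed.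

(** Near [F z0], [quantitative_open] finds a preimage in an arbitrarily small ball about [z0], and
    injectivity identifies it with the value of [G]; this is continuity of [G], and the derivative
    follows by inverting the linear approximation of [F]. *)
Theorem univalent_inverse (U : C -> Prop) (F : C -> C) : copen U -> hol U F -> inj_on U F ->
  exists G : C -> C,
    (forall z, U z -> G (F z) = z) /\
    copen (fun w => exists z, U z /\ F z = w) /\
    (forall z, U z -> cder G (F z) (/ cD F z)%C).
Proof.
  intros HO HF HI.
  set (G := fun w => epsilon (inhabits (RtoC 0)) (fun z => U z /\ F z = w)).
  assert (HG : forall z, U z -> U (G (F z)) /\ F (G (F z)) = F z).
  { intros z Hz. unfold G. apply (epsilon_spec (inhabits (RtoC 0)) (fun y => U y /\ F y = F z)). eauto. }
  assert (HG2 : forall z, U z -> G (F z) = z).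
  { intros z Hz. destruct (HG z Hz). apply HI; auto. }
  assert (Hloc : forall z0, U z0 -> exists r, 0 < r /\ forall r', 0 < r' <= r ->
    forall w, Cmod (w - F z0) < Cmod (cD F z0) * r' / 8 -> exists z, cball z0 r' z /\ U z /\ F z = w).
  { intros z0 Hz0. assert (HA := univalent_deriv U F z0 HO HF HI Hz0).
    assert (HAp := Cmod_pos _ HA).
    destruct (HO z0 Hz0) as [r1 [Hr1 Hb]].
    destruct (hol_cD_continuous U F z0 HO HF Hz0 (Cmod (cD F z0) / 2) ltac:(lra)) as [r2 [Hr2 H2]].
    exists (Rmin r1 r2). split; [apply Rmin_pos; auto|]. intros r' [Hr' Hle] w Hw.
    assert (L1 : r' <= r1) by (eapply Rle_trans; [apply Hle|apply Rmin_l]).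
    assert (L2 : r' <= r2) by (eapply Rle_trans; [apply Hle|apply Rmin_r]).
    destruct (quantitative_open F (cD F) z0 (cD F z0) w r' HA) as [z [Hz E]].
    - intros z Hz. apply (hol_cD U); auto. apply Hb. unfold cball in *; lra.
    - intros z Hz. left. apply H2. unfold cball in *; lra.
    - exact Hw.
    - exists z. split; [|split]; auto. apply Hb. unfold cball in *; lra. }
  exists G. split; [auto|split].
  - intros w [z0 [Hz0 <-]]. destruct (Hloc z0 Hz0) as [r [Hr H]].
    assert (HAp := Cmod_pos _ (univalent_deriv U F z0 HO HF HI Hz0)).
    exists (Cmod (cD F z0) * r / 8). split; [nra|]. intros w Hw.
    destruct (H r ltac:(lra) w Hw) as (z & _ & Hz & E). eauto.
  - intros z0 Hz0 eps He. destruct (Hloc z0 Hz0) as [r [Hr H]].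
    assert (HA := univalent_deriv U F z0 HO HF HI Hz0).
    assert (HAp := Cmod_pos _ HA). set (A := cD F z0) in *.
    assert (HF0 : cder F z0 A) by (apply (hol_cD U); auto).
    set (e := Rmin (Cmod A / 2) (eps * (Cmod A * Cmod A) / 2)).
    assert (He0 : 0 < e) by (apply Rmin_pos; [lra|apply Rdiv_lt_0_compat; [|lra]; repeat apply Rmult_lt_0_compat; auto]).
    destruct (HF0 e He0) as [d [Hd H1]].
    set (r' := Rmin r d). assert (Hr' : 0 < r' <= r) by (split; [apply Rmin_pos; auto|apply Rmin_l]).
    exists (Cmod A * r' / 8). split; [nra|]. intros w Hw.
    destruct (H r' Hr' w Hw) as (z & Hz & Uz & <-).
    rewrite !HG2 by auto.
    assert (Hzd : Cmod (z - z0) < d) by (eapply Rlt_le_trans; [apply Hz|apply Rmin_r]).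
    specialize (H1 z Hzd).
    replace (z - z0 - / A * (F z - F z0))%C with (- / A * (F z - F z0 - A * (z - z0)))%C by (field; auto).
    rewrite Cmod_mult, Cmod_opp, Cmod_inv by auto.
    assert (B : Cmod A / 2 * Cmod (z - z0) <= Cmod (F z - F z0)).
    { assert (T := Cmod_tri_inv (A * (z - z0)) (- (F z - F z0 - A * (z - z0)))).
      replace (A * (z - z0) - - (F z - F z0 - A * (z - z0)))%C with (F z - F z0)%C in T by ring.
      rewrite Cmod_opp, Cmod_mult in T.
      assert (e <= Cmod A / 2) by apply Rmin_l. generalize (Cmod_ge_0 (z - z0)). nra. }
    apply Rmult_le_reg_l with (Cmod A); [auto|]. rewrite <- Rmult_assoc, Rinv_r, Rmult_1_l by lra.
    eapply Rle_trans; [apply H1|].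
    apply Rle_trans with (eps * (Cmod A * Cmod A) / 2 * Cmod (z - z0)).
    + apply Rmult_le_compat_r; [apply Cmod_ge_0|apply Rmin_r].
    + replace (eps * (Cmod A * Cmod A) / 2 * Cmod (z - z0)) with
        (Cmod A * eps * (Cmod A / 2 * Cmod (z - z0))) by field.
      rewrite <- (Rmult_assoc (Cmod A) eps (Cmod (F z - F z0))). apply Rmult_le_compat_l; [nra|auto].
Qed.

(** * Exponential and logarithm *)

Lemma Cexp_cis (z : C) : Cexp z = (RtoC (exp (Re z)) * cis (Im z))%C.
Proof. unfold Cexp, cis. apply injective_projections; simpl; ring. Qed.

Lemma Cexp_plus (z w : C) : Cexp (z + w) = (Cexp z * Cexp w)%C.
Proof.
  rewrite !Cexp_cis. unfold Re, Im. simpl. rewrite exp_plus, cis_plus, RtoC_mult. ring.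
Qed.

Lemma Cexp_0 : Cexp 0 = 1.
Proof. rewrite Cexp_cis. unfold Re, Im; simpl. rewrite exp_0, cis_0. ring. Qed.

Lemma Cmod_Cexp (z : C) : Cmod (Cexp z) = exp (Re z).
Proof. rewrite Cexp_cis, Cmod_Rscal, Cmod_cis, Rmult_1_r; auto. left. apply exp_pos. Qed.

Lemma Cexp_neq_0 (z : C) : Cexp z <> 0.
Proof. apply Cmod_gt_0. rewrite Cmod_Cexp. apply exp_pos. Qed.

Lemma Cexp_opp (z : C) : Cexp (- z) = (/ Cexp z)%C.
Proof.
  assert (H : (Cexp z * Cexp (- z) = 1)%C).
  { rewrite <- Cexp_plus. replace (z + - z)%C with (RtoC 0) by ring. apply Cexp_0. }
  transitivity (/ Cexp z * (Cexp z * Cexp (- z)))%C; [field; apply Cexp_neq_0|].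
  rewrite H. ring.
Qed.

Lemma pder_Cexp_ray (h : C) (t : R) : pder (fun t => Cexp (RtoC t * h)) t (h * Cexp (RtoC t * h))%C.
Proof.
  destruct h as [a b].
  apply gder_ext with (fun t => (exp (t * a) * cos (t * b), exp (t * a) * sin (t * b)) : C).
  - intros s. unfold Cexp, Re, Im; simpl.
    replace (s * a - 0 * b) with (s * a) by ring. replace (s * b + 0 * a) with (s * b) by ring. reflexivity.
  - eapply gder_eq; [|apply pder_pair; auto_derive; auto].
    unfold Cexp, Re, Im; simpl.
    replace (t * a - 0 * b) with (t * a) by ring. replace (t * b + 0 * a) with (t * b) by ring.
    apply injective_projections; simpl; ring.
Qed.

(** Two integrations along the ray from 0 to [h], on which [exp 1 <= 3] bounds the exponential. *)
Lemma Cexp_near_0 (h : C) : Cmod h <= 1 -> Cmod (Cexp h - 1 - h) <= 3 * Cmod h * Cmod h.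
Proof.
  intros Hh. assert (Hh0 := Cmod_ge_0 h).
  assert (HB : forall t, 0 <= t <= 1 -> Cmod (Cexp (RtoC t * h)) <= 3).
  { intros t Ht. rewrite Cmod_Cexp. apply Rle_trans with (exp 1); [|apply exp_le_3].
    assert (Re (RtoC t * h) <= 1).
    { eapply Rle_trans; [apply Re_le_Cmod|]. rewrite Cmod_Rscal by lra. nra. }
    destruct H as [H| ->]; [left; apply exp_increasing, H|lra]. }
  assert (H1 : forall t, 0 <= t <= 1 -> Cmod (Cexp (RtoC t * h) - 1) <= 3 * Cmod h).
  { intros t Ht. apply Rle_trans with (3 * Cmod h * t - 3 * Cmod h * 0); [|nra].
    replace (RtoC 1) with (Cexp (RtoC 0 * h)).
    - apply (curve_bound (fun t => Cexp (RtoC t * h)) (fun t => h * Cexp (RtoC t * h))%C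
        (fun t => 3 * Cmod h * t) (fun _ => 3 * Cmod h)); [lra| | |].
      + intros s _. apply pder_Cexp_ray.
      + intros s _. auto_derive; auto. ring.
      + intros s Hs. rewrite Cmod_mult. specialize (HB s ltac:(lra)). nra.
    - replace (RtoC 0 * h)%C with (RtoC 0) by ring. apply Cexp_0. }
  replace (Cexp h - 1 - h)%C with ((Cexp (RtoC 1 * h) - RtoC 1 * h) - (Cexp (RtoC 0 * h) - RtoC 0 * h))%C.
  - apply Rle_trans with (3 * Cmod h * Cmod h * 1 - 3 * Cmod h * Cmod h * 0); [|lra].
    apply (curve_bound (fun t => Cexp (RtoC t * h) - RtoC t * h)%C
      (fun t => h * Cexp (RtoC t * h) - (1 * h + t * 0))%C
      (fun t => 3 * Cmod h * Cmod h * t) (fun _ => 3 * Cmod h * Cmod h)); [lra| | |].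
    + intros s _. apply gder_minus; [apply pder_Cexp_ray|].
      apply gder_mult; [apply gder_phi|apply gder_const].
    + intros s _. auto_derive; auto. ring.
    + intros s Hs. replace (h * Cexp (RtoC s * h) - (1 * h + s * 0))%C with ((Cexp (RtoC s * h) - 1) * h)%C by ring.
      rewrite Cmod_mult. apply Rmult_le_compat_r; auto.
  - replace (RtoC 1 * h)%C with h by ring. replace (RtoC 0 * h)%C with (RtoC 0) by ring.
    rewrite Cexp_0. ring.
Qed.

Lemma cder_Cexp (z : C) : cder Cexp z (Cexp z).
Proof.
  intros eps He. assert (Hz := Cmod_pos _ (Cexp_neq_0 z)). set (m := Cmod (Cexp z)) in *.
  exists (Rmin 1 (eps / (3 * m))). split; [apply Rmin_pos; [lra|apply Rdiv_lt_0_compat; lra]|].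
  intros y Hy. set (h := (y - z)%C) in *.
  assert (Hy1 := Rlt_le_trans _ _ _ Hy (Rmin_l _ _)).
  assert (Hy2 := Rlt_le_trans _ _ _ Hy (Rmin_r _ _)).
  replace y with (z + h)%C at 1 by (unfold h; ring). rewrite Cexp_plus.
  replace (Cexp z * Cexp h - Cexp z - Cexp z * h)%C with (Cexp z * (Cexp h - 1 - h))%C by ring.
  rewrite Cmod_mult. fold m. assert (H := Cexp_near_0 h ltac:(lra)). assert (Hh := Cmod_ge_0 h).
  apply (Rmult_lt_compat_l (3 * m)) in Hy2; [|lra].
  replace (3 * m * (eps / (3 * m))) with eps in Hy2 by (field; lra). nra.
Qed.

Lemma polar (z : C) : exists t, 0 <= t <= 2 * PI /\ z = (RtoC (Cmod z) * cis t)%C.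
Proof.
  destruct (classic (z = 0)) as [->|Hz].
  { exists 0. split; [generalize PI_RGT_0; lra|]. rewrite Cmod_0. ring. }
  assert (Hp := Cmod_pos z Hz). set (m := Cmod z) in *.
  set (a := fst z / m). set (b := snd z / m).
  assert (E : a * a + b * b = 1).
  { assert (E := Re_Cconj_mult z). fold m in E. unfold Re, Cconj, Cmult in E; simpl in E.
    unfold a, b. apply Rmult_eq_reg_r with (m * m); [|nra].
    replace ((fst z / m * (fst z / m) + snd z / m * (snd z / m)) * (m * m))
      with (fst z * fst z + snd z * snd z) by (field; lra). lra. }
  assert (Ha : -1 <= a <= 1) by nra.
  assert (Hc : exists t, 0 <= t <= 2 * PI /\ cos t = a /\ sin t = b).
  { assert (HB := acos_bound a). assert (Hcos := cos_acos a Ha).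
    assert (Hsin := sin_acos a Ha). replace (1 - Rsqr a) with (Rsqr b) in Hsin by (unfold Rsqr; lra).
    rewrite sqrt_Rsqr_abs in Hsin. destruct (Rle_dec 0 b) as [Hb|Hb].
    - exists (acos a). rewrite Rabs_pos_eq in Hsin by auto. repeat split; auto; lra.
    - exists (- acos a + 2 * PI). rewrite Rabs_left in Hsin by lra.
      replace (- acos a + 2 * PI) with (- acos a + 2 * INR 1 * PI) by (simpl; ring).
      rewrite cos_period, sin_period, cos_neg, sin_neg. repeat split; auto; try (simpl; lra). }
  destruct Hc as (t & Ht & Hcos & Hsin). exists t. split; auto.
  unfold cis. rewrite Hcos, Hsin. apply injective_projections; unfold a, b; simpl; field; lra.
Qed.

Lemma Cexp_surj (z : C) : z <> 0 -> exists w, Cexp w = z.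
Proof.
  intros Hz. destruct (polar z) as (t & _ & E). exists (ln (Cmod z), t).
  rewrite Cexp_cis. unfold Re, Im; simpl. rewrite exp_ln by (apply Cmod_pos, Hz). auto.
Qed.

Definition twopii : C := (0, 2 * PI).

Lemma Cexp_2pii : Cexp twopii = 1.
Proof.
  rewrite Cexp_cis. unfold Re, Im; simpl. rewrite exp_0, cis_2PI. ring.
Qed.

Lemma Cexp_2pii_mult (n : nat) : Cexp (RtoC (INR n) * twopii) = 1.
Proof.
  induction n as [|n IH].
  - simpl. replace (0 * twopii)%C with (RtoC 0) by ring. apply Cexp_0.
  - rewrite S_INR, RtoC_plus. replace ((INR n + 1) * twopii)%C with (INR n * twopii + twopii)%C by ring.
    rewrite Cexp_plus, IH, Cexp_2pii. ring.
Qed.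

Lemma Cmod_2pii : Cmod twopii = 2 * PI.
Proof.
  replace twopii with (RtoC (2 * PI) * Ci)%C.
  - rewrite Cmod_Rscal by apply two_PI_pos. replace (Cmod Ci) with 1; [ring|].
    unfold Cmod, Ci; simpl. replace (0 * (0 * 1) + 1 * (1 * 1)) with 1 by ring. symmetry; apply sqrt_1.
  - apply injective_projections; simpl; ring.
Qed.

Lemma constant_of_deriv_0 (D : C -> Prop) (f : C -> C) (x y : C) : convex D -> D x -> D y ->
  (forall z, D z -> cder f z 0) -> f x = f y.
Proof.
  intros HD Hx Hy Hf. symmetry. apply Csub_eq, Cmod_zero.
  replace 0 with (0 * Cmod (y - x)) by ring.
  apply (mean_value D f (fun _ => RtoC 0)); auto. intros. rewrite Cmod_0. lra.
Qed.

Lemma logarithm (D : C -> Prop) (f : C -> C) : good D -> hol D f -> (forall z, D z -> f z <> 0) ->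
  exists L, (forall z, D z -> cder L z (cD f z / f z)%C) /\ (forall z, D z -> Cexp (L z) = f z).
Proof.
  intros HG Hf Hn. assert (HG' := HG). destruct HG' as (HO & HV & _).
  destruct (primitive D (fun z => cD f z / f z)%C HG) as [P HP].
  { intros z Hz. eexists. apply gder_div; [auto| |apply (hol_cD D); auto].
    apply (hol_cD_cD D); auto. }
  destruct (classic (exists a, D a)) as [[a Ha]|N].
  2:{ exists P. split; intros z Hz; exfalso; apply N; eauto. }
  assert (Hc : forall z, D z -> (f z * Cexp (- P z) = f a * Cexp (- P a))%C).
  { intros z Hz. apply (constant_of_deriv_0 D (fun z => f z * Cexp (- P z))%C); auto.
    intros w Hw. eapply gder_eq.
    2:{ apply gder_mult; [apply (hol_cD D); auto|].
        apply (gder_comp _ Cexp (fun z => - P z)%C); [apply cder_Cexp|]. apply gder_opp, HP, Hw. }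
    cbv beta. field. auto. }
  destruct (Cexp_surj (f a * Cexp (- P a))%C) as [k Hk].
  { apply Cmult_neq_0; [auto|apply Cexp_neq_0]. }
  exists (fun z => P z + k)%C. split.
  - intros z Hz. eapply gder_eq; [|apply gder_plus; [apply HP, Hz|apply gder_const]]. ring.
  - intros z Hz. rewrite Cexp_plus, Hk, <- (Hc z Hz), Cexp_opp. field. apply Cexp_neq_0.
Qed.

(** * Bloch's theorem and distortion *)

(** The disc is swept by concentric circles, so compactness of an interval is used twice, in the
    angle and in the radius. *)
Lemma hol_bounded (f : C -> C) (a : C) (R0 r : R) : hol (cball a R0) f -> 0 < r < R0 ->
  exists B, forall z, Cmod (z - a) <= r -> Cmod (f z) <= B.
Proof.
  intros Hf Hr.
  destruct (compact_uniform 0 r (fun s d => forall t, 0 <= t <= 2 * PI ->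
    Cmod (f (a + RtoC s * cis t)%C) <= / d)) as [d [Hd H]].
  - intros s d d' Hd Hs t Ht. eapply Rle_trans; [apply Hs, Ht|]. apply Rinv_le_contravar; lra.
  - intros s Hs.
    assert (Hal : pcont_on (fun t => a + RtoC s * cis t)%C 0 (2 * PI))
      by (intros t _; apply gcont_plus; [apply gcont_const|apply gcont_scal, pcont_cis]).
    destruct (uniform_near_curve (cball a R0) f (fun t => a + RtoC s * cis t)%C 0 (2 * PI) 1)
      as [d [Hd Hd']]; auto; try lra.
    { apply cball_open. }
    { intros z Hz. eapply hol_ccont; eauto. }
    { intros t _. apply cball_circle. lra. }
    destruct (pcont_bounded (fun t => f (a + RtoC s * cis t)%C) 0 (2 * PI)) as [B [HB1 HB]].
    { intros t _. apply (circle_pcont f a R0); auto. lra. }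
    exists (Rmin d (/ (B + 1))). split.
    { apply Rmin_pos; auto. apply Rinv_0_lt_compat. lra. }
    intros s' Hs' Hss t Ht. apply Rle_trans with (B + 1).
    + destruct (Hd' t Ht (a + RtoC s' * cis t)%C) as [_ E].
      * replace (a + s' * cis t - (a + s * cis t))%C with ((s' - s) * cis t)%C by ring.
        rewrite Cmod_mult, Cmod_cis, Cmod_RtoC_sub, Rmult_1_r.
        eapply Rlt_le_trans; [apply Hss|apply Rmin_l].
      * specialize (HB t Ht). cbv beta in HB, E.
        generalize (Cmod_tri_inv (f (a + s' * cis t)%C) (f (a + s * cis t)%C)). lra.
    + rewrite <- (Rinv_inv (B + 1)) at 1. apply Rinv_le_contravar; [|apply Rmin_r].
      apply Rmin_pos; auto. apply Rinv_0_lt_compat. lra.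
  - exists (/ d). intros z Hz. destruct (polar (z - a)%C) as (t & Ht & E).
    replace z with (a + (z - a))%C by ring. rewrite E. apply H; auto.
    split; [apply Cmod_ge_0|auto].
Qed.

(* Bloch's argument: at an almost maximal point of [|L'(x)| (R - |x - a|)] the
   derivative is nearly constant on a disc of comparable size. *)
Lemma bloch (L : C -> C) (a : C) (R0 r : R) : hol (cball a R0) L -> 0 < r < R0 ->
  (forall x y, cball a R0 x -> cball a R0 y -> L y <> (L x + twopii)%C) ->
  Cmod (cD L a) * r <= 2048 * PI.
Proof.
  intros HL Hr Hno. apply Rnot_lt_le. intros Hbig.
  assert (HO := cball_open a R0).
  assert (HL1 : hol (cball a R0) (cD L)) by (apply hol_deriv; auto).
  destruct (hol_bounded (cD L) a R0 r HL1 Hr) as [B HB].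
  set (W := fun x => Cmod (cD L x) * (r - Cmod (x - a))).
  assert (Hself : forall x : C, Cmod (x - x) = 0).
  { intros x. replace (x - x)%C with (RtoC 0) by ring. apply Cmod_0. }
  assert (HB0 : 0 <= B) by (eapply Rle_trans; [apply Cmod_ge_0|apply (HB a); rewrite Hself; lra]).
  destruct (completeness (fun v => exists x, Cmod (x - a) <= r /\ v = W x)) as [S [HS1 HS2]].
  { exists (B * r). intros v (x & Hx & ->). unfold W.
    apply Rmult_le_compat; auto using Cmod_ge_0; generalize (Cmod_ge_0 (x - a)); lra. }
  { exists (W a), a. rewrite Hself. split; [lra|reflexivity]. }
  assert (HSa : Cmod (cD L a) * r <= S).
  { apply HS1. exists a. rewrite Hself. split; [lra|]. unfold W. rewrite Hself. ring. }
  assert (PI_pos := PI_RGT_0).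
  assert (HS : 2048 * PI < S) by lra.
  assert (Hx : exists x, Cmod (x - a) <= r /\ S / 2 < W x).
  { apply NNPP. intros N. assert (S <= S / 2); [|lra]. apply HS2. intros v (x & Hx & ->).
    apply Rnot_lt_le. intros HH. apply N. eauto. }
  destruct Hx as (x & Hx & HWx). unfold W in HWx.
  set (mu := Cmod (cD L x)) in *. set (r1 := r - Cmod (x - a)) in *.
  assert (Hmu0 : 0 <= mu) by apply Cmod_ge_0.
  assert (Hr1 : 0 < r1) by (unfold r1 in *; nra).
  assert (Hmu : 0 < mu) by nra.
  assert (HA : cD L x <> 0) by (apply Cmod_gt_0; exact Hmu).
  assert (Hin : forall y, Cmod (y - x) < r1 / 2 -> Cmod (y - a) < r - r1 / 2).
  { intros y Hy. generalize (Cmod_tri y x a). unfold r1 in *. lra. }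
  (* Here [r - Cmod (y - a)] exceeds [r1 / 2], and [S < 2 * mu * r1] by the choice of [x]. *)
  assert (H4 : forall y, Cmod (y - x) < r1 / 2 -> Cmod (cD L y) <= 4 * mu).
  { intros y Hy. assert (Hy2 := Hin y Hy).
    assert (HWy : W y <= S) by (apply HS1; exists y; split; [lra|reflexivity]).
    unfold W in HWy. generalize (Cmod_ge_0 (cD L y)). nra. }
  assert (H2 : forall y, cball x (r1 / 64) y -> Cmod (cD (cD L) y) <= 32 * mu / r1).
  { intros y Hy. unfold cball in Hy.
    replace (32 * mu / r1) with (4 * mu / (r1 / 8)) by (field; lra).
    apply (cauchy_estimate (cD L) y (r1 / 4)); [|lra|].
    - apply (hol_sub (cball a R0)); auto. unfold cball. intros z Hz.
      generalize (Hin z). generalize (Cmod_tri z y x). lra.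
    - unfold cball. intros z Hz. apply H4. generalize (Cmod_tri z y x). lra. }
  assert (Hsub : forall y, cball x (r1 / 64) y -> cball a R0 y).
  { unfold cball. intros y Hy. generalize (Hin y). lra. }
  (* On the radius [r1 / 64] the derivative varies by at most [32 * mu / r1 * (r1 / 64) = mu / 2].
     The values then fill a disc of radius [mu * r1 / 512], larger than [2 * PI] because
     [mu * r1 > S / 2 > 1024 * PI]. *)
  destruct (quantitative_open L (cD L) x (cD L x) (L x + twopii)%C (r1 / 64) HA) as (y & Hy & E).
  - intros y Hy. apply (hol_cD (cball a R0)); auto.
  - intros y Hy. apply Rle_trans with (32 * mu / r1 * Cmod (y - x)).
    + apply (mean_value (cball x (r1 / 64)) (cD L) (cD (cD L))); auto.
      * apply convex_cball.
      * apply cball_center. lra.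
      * intros z Hz. apply (hol_cD_cD (cball a R0)); auto.
    + unfold cball in Hy. fold mu.
      apply Rle_trans with (32 * mu / r1 * (r1 / 64)); [|right; field; lra].
      apply Rmult_le_compat_l; [|lra]. apply Rdiv_le_0_compat; lra.
  - replace (L x + twopii - L x)%C with twopii by ring. rewrite Cmod_2pii. fold mu. nra.
  - apply (Hno x y); auto. apply Hsub, cball_center. lra.
Qed.

(** No two values of a logarithm [L] of [G - G w0] differ by [twopii], since [Cexp (L z)] is
    injective in [z]; this is what [bloch] asks for. The radius is halved because [bloch] works
    strictly inside the disc. *)
Lemma univalent_log_deriv (D : C -> Prop) (G : C -> C) (w0 w1 : C) (r : R) :
  hol D G -> inj_on D G -> D w0 -> 0 < r -> (forall z, cball w1 r z -> D z) -> ~ cball w1 r w0 ->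
  Cmod (cD G w1 / (G w1 - G w0)) * (r / 2) <= 2048 * PI.
Proof.
  intros HG HI Hw0 Hr Hb Hn. set (f := fun z => (G z - G w0)%C).
  assert (Hd : forall z, D z -> cder f z (cD G z)).
  { intros z Hz. eapply gder_eq; [|apply gder_minus; [apply (hol_cD D); auto|apply gder_const]]. ring. }
  destruct (logarithm (cball w1 r) f (good_cball _ _)) as (L & HL & EL).
  { intros z Hz. eauto. }
  { intros z Hz E. apply Csub_eq, HI in E; auto. subst z. contradiction. }
  assert (Hw1 : cball w1 r w1) by (apply cball_center, Hr).
  replace (cD G w1 / (G w1 - G w0))%C with (cD L w1).
  - apply (bloch L w1 r); [intros z Hz; eauto|lra|].
    intros x y Hx Hy E. assert (E2 := EL y Hy). rewrite E, Cexp_plus, Cexp_2pii, EL in E2 by auto.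
    replace (f x * 1)%C with (f x) in E2 by ring. unfold f in E2.
    assert (E3 : x = y).
    { apply HI; auto. apply Csub_eq. replace (G x - G y)%C with (G x - G w0 - (G y - G w0))%C by ring.
      rewrite E2. ring. }
    subst y. assert (Z : twopii = 0) by (replace twopii with (L x + twopii - L x)%C by ring; rewrite <- E; ring).
    apply (f_equal Cmod) in Z. rewrite Cmod_2pii, Cmod_0 in Z. generalize PI_RGT_0. lra.
  - apply cD_unique. eapply gder_eq; [|apply HL, Hw1]. unfold f. f_equal. apply cD_unique, Hd, Hb, Hw1.
Qed.

(** In the next proof [|Q' / Q| <= (4096 * PI + 1) / r]: the first term is the bound of
    [univalent_log_deriv], the 1 comes from [/ (w1 - w0)]. The factor 8 is 2 from [G'' = 2 Q'] times
    4 from [r = (Re w0 - c) / 4]. *)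
Definition distortion_const : R := 8 * (4096 * PI + 1).

(* The mean value property for [Q' / Q] with [Q w = (G w - G w0) / (w - w0)],
   for which [Q' w0 / Q w0 = G'' w0 / (2 G' w0)]. *)
Theorem univalent_distortion (G : C -> C) (c : R) (w0 : C) :
  hol (half_plane c) G -> inj_on (half_plane c) G -> c < Re w0 ->
  Cmod (cD (cD G) w0) <= distortion_const / (Re w0 - c) * Cmod (cD G w0).
Proof.
  intros HG HI Hw0. destruct (good_half_plane c) as (HO & _ & _).
  set (r := (Re w0 - c) / 4). assert (Hr : 0 < r) by (unfold r; lra).
  assert (PI_pos := PI_RGT_0).
  destruct (quotient_hol _ G w0 HO HG Hw0) as (Q & HQ & EQ & Q0).
  assert (HG0 := univalent_deriv _ G w0 HO HG HI Hw0).
  assert (Qn : forall z, half_plane c z -> Q z <> 0).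
  { intros z Uz Z. destruct (classic (z = w0)) as [->|Hza]; [congruence|].
    apply Hza, HI; auto. apply Csub_eq. rewrite EQ, Z by auto. ring. }
  assert (EG : forall z, half_plane c z -> cD G z = (cD Q z * (z - w0) + Q z)%C).
  { intros z Hz. apply cD_unique. destruct (HO z Hz) as [d [Hd Hb]].
    apply gder_ext_loc with (fun z => Q z * (z - w0) + G w0)%C d; auto.
    - intros y Hy. rewrite <- EQ by auto. ring.
    - eapply gder_eq; [|apply gder_plus; [apply gder_mult;
        [apply (hol_cD _ _ _ HQ Hz)|apply gder_minus; [apply gder_phi|apply gder_const]]|apply gder_const]].
      cbv beta. ring. }
  assert (EG2 : cD (cD G) w0 = (2 * cD Q w0)%C).
  { apply cD_unique. destruct (HO w0 Hw0) as [d [Hd Hb]].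
    apply gder_ext_loc with (fun z => cD Q z * (z - w0) + Q z)%C d; auto.
    - intros y Hy. rewrite EG by auto. ring.
    - eapply gder_eq; [|apply gder_plus; [apply gder_mult;
        [apply (hol_cD_cD _ _ _ HO HQ Hw0)|apply gder_minus; [apply gder_phi|apply gder_const]]
        |apply (hol_cD _ _ _ HQ Hw0)]].
      cbv beta. ring. }
  assert (Hhp : forall z, Cmod (z - w0) < 3 * r -> half_plane c z).
  { intros z Hz. unfold half_plane. generalize (Re_le_Cmod (w0 - z)%C). rewrite Cmod_sym.
    unfold Re in *; simpl. unfold r in *. lra. }
  assert (Hc : Cmod (cD Q w0 / Q w0) <= (4096 * PI + 1) / r).
  { apply (center_bound (fun z => cD Q z / Q z)%C w0 (2 * r) r); [|lra|].
    - intros z Hz. unfold cball in Hz. assert (Hz' : half_plane c z) by (apply Hhp; lra).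
      eexists. apply gder_div; [auto|apply (hol_cD_cD _ _ _ HO HQ Hz')|apply (hol_cD _ _ _ HQ Hz')].
    - intros t _. set (w1 := (w0 + r * cis t)%C).
      assert (E1 : Cmod (w1 - w0) = r).
      { unfold w1. replace (w0 + r * cis t - w0)%C with (r * cis t)%C by ring.
        rewrite Cmod_Rscal, Cmod_cis by lra. ring. }
      assert (N1 : (w1 - w0)%C <> 0) by (apply Cmod_gt_0; lra).
      assert (H1 : half_plane c w1) by (apply Hhp; lra).
      assert (K := univalent_log_deriv (half_plane c) G w0 w1 r HG HI Hw0 Hr).
      assert (K1 : Cmod (cD G w1 / (G w1 - G w0)) * (r / 2) <= 2048 * PI).
      { apply K; unfold cball; [|rewrite Cmod_sym; lra].
        intros z Hz. apply Hhp. generalize (Cmod_tri z w1 w0). lra. }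
      (* Logarithmic derivative of the quotient [(G - G w0) / (w - w0)]. *)
      replace (cD Q w1 / Q w1)%C with (cD G w1 / (G w1 - G w0) + - (/ (w1 - w0)))%C.
      + eapply Rle_trans; [apply Cmod_triangle|]. rewrite Cmod_opp, Cmod_inv, E1 by auto.
        apply Rmult_le_reg_r with r; auto.
        replace ((4096 * PI + 1) / r * r) with (4096 * PI + 1) by (field; lra).
        rewrite Rmult_plus_distr_r, Rinv_l by lra. lra.
      + rewrite EG, EQ by auto. field. auto. }
  rewrite EG2. replace (2 * cD Q w0)%C with (2 * (cD Q w0 / Q w0) * Q w0)%C by (field; auto).
  set (p := (cD Q w0 / Q w0)%C) in *.
  rewrite !Cmod_mult, Q0, Cmod_R, Rabs_pos_eq by lra.
  apply Rmult_le_compat_r; [apply Cmod_ge_0|].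
  replace (distortion_const / (Re w0 - c)) with (2 * ((4096 * PI + 1) / r)); [lra|].
  unfold distortion_const, r. field. lra.
Qed.

(** * Leaving compact sets *)

Lemma locally_cball (z : C) (P : C -> Prop) :
  locally (T := C_UniformSpace) z P <-> exists r, 0 < r /\ forall y, cball z r y -> P y.
Proof.
  split.
  - intros H. apply locally_C in H. destruct H as [r Hr]. exists r. split; [apply cond_pos|].
    intros y Hy. apply Hr. exact Hy.
  - intros (r & Hr & H). apply locally_C. exists (mkposreal r Hr). intros y Hy. apply H. exact Hy.
Qed.

Lemma open_copen (D : C -> Prop) : open (T := C_UniformSpace) D <-> copen D.
Proof.
  split; intros H z Hz.
  - apply locally_cball, H, Hz.
  - apply locally_cball. apply H, Hz.
Qed.

Lemma C_differentiable_cder (g : C -> C) (z : C) : C_differentiable g z <-> exists l, cder g z l.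
Proof. split; intros [l Hl]; exists l; apply cder_is_derive, Hl. Qed.

(** A quantitative identity theorem. Each zero divided out costs a factor of at least [3 * r / 4] on
    the circle and at most [r / 4] at the centre, so after [N] divisions the maximum principle gives
    [|h z0| <= A * (/ 3) ^ N]. *)
Lemma many_zeros (h : C -> C) (z0 : C) (R0 r : R) (zs : nat -> C) : hol (cball z0 R0) h ->
  0 < r < R0 -> (forall m n, zs m = zs n -> m = n) -> (forall n, Cmod (zs n - z0) <= r / 4) ->
  (forall n, h (zs n) = 0) -> h z0 = 0.
Proof.
  intros Hh Hr Hinj Hball Hzero. assert (HO := cball_open z0 R0).
  destruct (hol_bounded h z0 R0 r Hh Hr) as [A HA].
  assert (HA0 : 0 <= A).
  { eapply Rle_trans; [apply Cmod_ge_0|apply (HA z0)].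
    replace (z0 - z0)%C with (RtoC 0) by ring. rewrite Cmod_0. lra. }
  assert (H : forall N, exists v, hol (cball z0 R0) v /\
    (forall z, Cmod (z - z0) = r -> Cmod (v z) * (3 * r / 4) ^ N <= A) /\
    Cmod (h z0) <= Cmod (v z0) * (r / 4) ^ N /\
    (forall k, (N <= k)%nat -> v (zs k) = 0)).
  { induction N as [|N (v & Hv & HvA & Hv0 & Hvz)].
    - exists h. simpl. repeat split; auto; intros; try lra. rewrite Rmult_1_r. apply HA. lra.
    - assert (Hin : cball z0 R0 (zs N)) by (unfold cball; specialize (Hball N); lra).
      destruct (quotient_hol _ v (zs N) HO Hv Hin) as (Q & HQ & EQ & _).
      rewrite (Hvz N) in EQ by lia.
      assert (HP : 0 <= (3 * r / 4) ^ N) by (apply pow_le; lra).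
      assert (HP2 : 0 <= (r / 4) ^ N) by (apply pow_le; lra).
      exists Q. split; [auto|split; [|split]].
      + intros z Hz. specialize (HvA z Hz).
        assert (M := EQ z ltac:(unfold cball; lra)). apply (f_equal Cmod) in M.
        replace (v z - 0)%C with (v z) in M by ring. rewrite Cmod_mult in M. rewrite M in HvA.
        assert (3 * r / 4 <= Cmod (z - zs N)).
        { generalize (Cmod_tri z (zs N) z0) (Hball N). lra. }
        assert (Cmod (Q z) * (3 * r / 4) <= Cmod (Q z) * Cmod (z - zs N))
          by (apply Rmult_le_compat_l; [apply Cmod_ge_0|auto]).
        simpl. nra.
      + assert (M := EQ z0 ltac:(apply cball_center; lra)). apply (f_equal Cmod) in M.
        replace (v z0 - 0)%C with (v z0) in M by ring. rewrite Cmod_mult in M. rewrite M in Hv0.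
        specialize (Hball N). rewrite Cmod_sym in Hball.
        assert (Cmod (Q z0) * Cmod (z0 - zs N) <= Cmod (Q z0) * (r / 4))
          by (apply Rmult_le_compat_l; [apply Cmod_ge_0|auto]).
        simpl. nra.
      + intros k Hk. assert (E := EQ (zs k) ltac:(unfold cball; specialize (Hball k); lra)).
        rewrite (Hvz k) in E by lia. apply NNPP. intros NQ.
        apply (Cmult_neq_0 _ (zs k - zs N)%C NQ).
        * apply Csub_neq. intros E2. apply Hinj in E2. lia.
        * rewrite <- E. ring. }
  apply Cmod_zero. apply Rnot_lt_le. intros HL.
  destruct (half_pow_small (Cmod (h z0) / (A + 1))) as [N HN]; [apply Rdiv_lt_0_compat; lra|].
  destruct (H N) as (v & Hv & HvA & Hv0 & _).
  assert (HP : 0 < (3 * r / 4) ^ N) by (apply pow_lt; lra).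
  assert (B : Cmod (v z0) <= A / (3 * r / 4) ^ N).
  { apply (center_bound v z0 R0 r); [auto|lra|]. intros t _.
    apply Rmult_le_reg_r with ((3 * r / 4) ^ N); [auto|].
    unfold Rdiv at 2. rewrite Rmult_assoc, Rinv_l, Rmult_1_r by lra. apply HvA.
    replace (z0 + r * cis t - z0)%C with (r * cis t)%C by ring.
    rewrite Cmod_Rscal, Cmod_cis by lra. ring. }
  assert (E : (r / 4) ^ N = (/ 3) ^ N * (3 * r / 4) ^ N)
    by (rewrite <- Rpow_mult_distr; f_equal; field).
  assert (Hle : Cmod (h z0) <= A * (/ 3) ^ N).
  { eapply Rle_trans; [apply Hv0|]. rewrite E.
    apply Rle_trans with (A / (3 * r / 4) ^ N * ((/ 3) ^ N * (3 * r / 4) ^ N)).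
    - apply Rmult_le_compat_r; [|auto]. apply Rmult_le_pos; [|lra]. apply pow_le; lra.
    - right. field. lra. }
  assert (H32 : (/ 3) ^ N <= (/ 2) ^ N) by (apply pow_incr; lra).
  apply (Rmult_lt_compat_l (A + 1)) in HN; [|lra].
  replace ((A + 1) * (Cmod (h z0) / (A + 1))) with (Cmod (h z0)) in HN by (field; lra).
  generalize (half_pow_pos N). nra.
Qed.

Lemma pcont_continuity_Cmod (k : R -> C) (t r : R) : pcont k t ->
  continuity_pt (fun s => Cmod (k s) - r) t.
Proof.
  intros H eps He. destruct (H eps He) as [d [Hd H1]]. exists d. split; auto.
  intros s [_ Hs]. simpl in *. unfold R_dist, Rdist in *. specialize (H1 s).
  rewrite Cmod_RtoC_sub in H1. specialize (H1 Hs).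
  generalize (Cmod_tri_inv (k s) (k t)) (Cmod_tri_inv (k t) (k s)). rewrite (Cmod_sym (k t)).
  intros. apply Rabs_def1; lra.
Qed.

Definition escapes (G : C -> C) (c : R) (z : C) (r X : R) : Prop :=
  forall w, c < Re w -> X < Re w -> ~ cball z r (G w).

Section Escape.
Variables (f : C -> Cbar) (G : C -> C) (c : R).
Hypothesis HG : hol (half_plane c) G.
Hypothesis HI : inj_on (half_plane c) G.
Hypothesis Hf : forall w, half_plane c w -> f (G w) = Some (Cexp w).

(** Near [z] the modulus of [f] stays below [Cmod (g z) + 1], whereas at [G w] it equals
    [exp (Re w)]. *)
Lemma escapes_regular (z : C) : regular_at f z -> exists r X, 0 < r /\ escapes G c z r X.
Proof.
  intros [g Hg]. apply locally_cball in Hg. destruct Hg as (r & Hr & Hg).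
  destruct (Hg z (cball_center z r Hr)) as [_ Hd]. apply C_differentiable_cder in Hd.
  destruct Hd as [l Hl]. destruct (gder_gcont _ _ _ _ Hl 1 ltac:(lra)) as [d [Hd H1]].
  assert (Hgz := Cmod_ge_0 (g z)).
  exists (Rmin r d), (ln (Cmod (g z) + 1)). split; [apply Rmin_pos; auto|].
  intros w Hw HX Hb. unfold cball in Hb.
  destruct (Hg (G w)) as [E _]; [unfold cball; eapply Rlt_le_trans; [apply Hb|apply Rmin_l]|].
  rewrite Hf in E by exact Hw. injection E as E.
  specialize (H1 (G w) (Rlt_le_trans _ _ _ Hb (Rmin_r _ _))).
  rewrite <- E in H1. generalize (Cmod_tri_inv (Cexp w) (g z)). rewrite Cmod_Cexp.
  apply exp_increasing in HX. rewrite exp_ln in HX by lra. lra.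
Qed.

(* The image of a far half-plane is connected and avoids a circle around the
   pole on which [f] is bounded; if it were inside that circle, [1 / f] would
   take a value infinitely often there. *)
Lemma escapes_pole (z0 : C) : pole_at f z0 -> exists r X, 0 < r /\ escapes G c z0 r X.
Proof.
  intros [Hz0 [g [Hg Hlim]]].
  apply locally_cball in Hg. destruct Hg as (R1 & HR1 & Hg).
  assert (Hlim1 := Hlim (fun x => 1 < x)). specialize (Hlim1 ltac:(exists 1; auto)).
  apply locally_cball in Hlim1. destruct Hlim1 as (R2 & HR2 & Hg1).
  set (R0 := Rmin R1 R2). assert (HR0 : 0 < R0) by (apply Rmin_pos; auto).
  assert (S1 : forall y, cball z0 R0 y -> cball z0 R1 y)
    by (unfold cball; intros y Hy; eapply Rlt_le_trans; [apply Hy|apply Rmin_l]).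
  assert (S2 : forall y, cball z0 R0 y -> cball z0 R2 y)
    by (unfold cball; intros y Hy; eapply Rlt_le_trans; [apply Hy|apply Rmin_r]).
  assert (Hgn : forall y, cball z0 R0 y -> y <> z0 -> g y <> 0).
  { intros y Hy Hn E. specialize (Hg1 y (S2 y Hy) Hn). cbv beta in Hg1. rewrite E, Cmod_0 in Hg1. lra. }
  (* The reciprocal of [f], extended by 0 at the pole; the radius [R2] has made [|g| > 1], so [g]
     has no zeros here. *)
  set (h := fun y => if Ceq_dec y z0 then RtoC 0 else (/ g y)%C).
  assert (h0 : h z0 = 0) by (unfold h; destruct (Ceq_dec z0 z0); congruence).
  assert (hn : forall y, y <> z0 -> h y = (/ g y)%C)
    by (intros y Hy; unfold h; destruct (Ceq_dec y z0); congruence).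
  assert (Hh : hol (cball z0 R0) h).
  { apply (removable _ h z0).
    - apply cball_open.
    - apply cball_center, HR0.
    - intros z Hz Hzn. destruct (Hg z (S1 z Hz) Hzn) as [_ Hd].
      apply C_differentiable_cder in Hd. destruct Hd as [l Hl]. eexists.
      apply (gder_ext_loc _ (fun y => / g y)%C h z _ (Cmod (z - z0))).
      + apply Cmod_pos, Csub_neq, Hzn.
      + intros y Hy. symmetry. apply hn. intros ->. rewrite Cmod_sym in Hy. lra.
      + apply gder_inv; [apply Hgn; auto|apply Hl].
    - intros eps He. assert (Hl := Hlim (fun x => / eps < x) ltac:(exists (/ eps); auto)).
      apply locally_cball in Hl. destruct Hl as (d & Hd & Hl).
      exists (Rmin d R0). split; [apply Rmin_pos; auto|]. intros y Hy.
      rewrite h0. replace (h y - 0)%C with (h y) by ring.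
      destruct (classic (y = z0)) as [->|Hyn]; [rewrite h0, Cmod_0; auto|].
      assert (Hb : cball z0 R0 y) by (eapply Rlt_le_trans; [apply Hy|apply Rmin_r]).
      assert (Hlt := Hl y (Rlt_le_trans _ _ _ Hy (Rmin_l _ _)) Hyn). cbv beta in Hlt.
      rewrite hn, Cmod_inv by auto. rewrite <- (Rinv_inv eps).
      apply Rinv_lt_contravar; [|auto]. apply Rmult_lt_0_compat; [apply Rinv_0_lt_compat, He|].
      apply Cmod_pos; auto. }
  assert (Hne : forall w, half_plane c w -> G w <> z0) by (intros w Hw E; specialize (Hf w Hw); congruence).
  assert (HhG : forall w, half_plane c w -> cball z0 R0 (G w) -> h (G w) = Cexp (- w)).
  { intros w Hw Hb. rewrite hn by auto. destruct (Hg (G w) (S1 _ Hb) (Hne w Hw)) as [E _].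
    rewrite Hf in E by auto. injection E as E. rewrite Cexp_opp, E. reflexivity. }
  (* [many_zeros] wants the zeros within a quarter of its outer radius [rr], so [r] is that
     quarter. *)
  set (rr := R0 / 2). set (r := rr / 4). assert (Hrr : 0 < rr < R0) by (unfold rr; lra).
  assert (Hr : 0 < r) by (unfold r; lra). assert (HrR : r < R0) by (unfold r; lra).
  destruct (circle_lower_bound h z0 R0 r Hh ltac:(lra)) as (d & Hd & Hlow).
  { intros t _. assert (Hn : (z0 + r * cis t)%C <> z0).
    { intros E. assert (E2 : (r * cis t)%C = 0).
      { replace (r * cis t)%C with (z0 + r * cis t - z0)%C by ring. rewrite E. ring. }
      apply (f_equal Cmod) in E2. rewrite Cmod_Rscal, Cmod_cis, Cmod_0 in E2 by lra. lra. }
    rewrite hn by auto. intros E.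
    assert (Hgz : g (z0 + r * cis t)%C <> 0) by (apply Hgn; auto; apply cball_circle; lra).
    apply (f_equal (Cmult (g (z0 + r * cis t)%C))) in E. rewrite Cinv_r in E by auto.
    replace (g (z0 + r * cis t)%C * 0)%C with (RtoC 0) in E by ring. apply RtoC_inj in E. lra. }
  exists r, (- ln d). split; [auto|]. intros w1 Hw1 HX1 Hb1.
  assert (Hcirc : forall w, c < Re w -> - ln d < Re w -> Cmod (G w - z0) <> r).
  { intros w Hw HX E. destruct (polar (G w - z0)%C) as (t & Ht & E2). rewrite E in E2.
    assert (E3 : (z0 + r * cis t)%C = G w) by (rewrite <- E2; ring).
    specialize (Hlow t Ht). rewrite E3, HhG, Cmod_Cexp in Hlow; auto.
    - assert (Re (- w) < ln d) by (unfold Re in *; simpl; lra).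
      apply exp_increasing in H. rewrite exp_ln in H by auto. lra.
    - unfold cball. lra. }
  assert (Hall : forall w, c < Re w -> - ln d < Re w -> cball z0 r (G w)).
  { intros w Hw HX. apply Rnot_le_lt. intros HL.
    assert (Hseg : forall t, 0 <= t <= 1 -> c < Re (seg w1 w t) /\ - ln d < Re (seg w1 w t)).
    { intros t Ht. split; [apply (proj1 (proj2 (good_half_plane c)))
        |apply (proj1 (proj2 (good_half_plane (- ln d))))]; auto. }
    destruct HL as [HL|HL]; [|apply (Hcirc w); auto].
    destruct (Ranalysis5.IVT_interv (fun t => Cmod (G (seg w1 w t) - z0) - r) 0 1) as [t [Ht Et]].
    - intros t Ht. apply pcont_continuity_Cmod. apply gcont_minus; [|apply gcont_const].
      apply gcont_comp; [|apply pcont_linear]. eapply hol_ccont; [apply HG|]. apply Hseg, Ht.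
    - lra.
    - rewrite seg_0. unfold cball in Hb1. lra.
    - rewrite seg_1. lra.
    - destruct (Hseg t Ht). apply (Hcirc (seg w1 w t)); auto. lra. }
  set (ws := fun n : nat => (w1 + RtoC (INR n) * twopii)%C).
  assert (Hre : forall n, Re (ws n) = Re w1) by (intros n; unfold ws, Re; simpl; ring).
  assert (Hws : forall n, Cexp (- ws n) = Cexp (- w1)).
  { intros n. rewrite !Cexp_opp. f_equal. unfold ws. rewrite Cexp_plus, Cexp_2pii_mult. ring. }
  assert (Hin : forall n, cball z0 r (G (ws n))) by (intros n; apply Hall; rewrite Hre; auto).
  (* The identity theorem carries the value [Cexp (- w1)] from the points [G (ws n)] to the pole,
     where [h] is 0. *)
  assert (Z : (h z0 - Cexp (- w1))%C = 0).
  { apply (many_zeros (fun z => h z - Cexp (- w1))%C z0 R0 rr (fun n => G (ws n))); auto.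
    - intros z Hz. destruct (Hh z Hz) as [l Hl]. eexists. apply gder_minus; [apply Hl|apply gder_const].
    - intros m n E. apply HI in E; try (unfold half_plane; rewrite Hre; auto).
      apply INR_eq. apply (f_equal snd) in E. unfold ws in E. simpl in E.
      generalize PI_RGT_0. nra.
    - intros n. left. apply Hin.
    - intros n. rewrite HhG, Hws; [ring|unfold half_plane; rewrite Hre; auto|].
      specialize (Hin n). unfold cball in *. lra. }
  rewrite h0 in Z. apply (Cexp_neq_0 (- w1)). apply Csub_eq.
  replace (Cexp (- w1) - 0)%C with (- (0 - Cexp (- w1)))%C by ring. rewrite Z. ring.
Qed.

Lemma escapes_compact (Omega K0 : C -> Prop) : meromorphic_on Omega f ->
  compact_set (T := C_UniformSpace) K0 -> (forall w, K0 w -> Omega w) ->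
  exists X, forall w, c < Re w -> X < Re w -> ~ K0 (G w).
Proof.
  intros Hm HK HKO.
  (* The indices are triples of centre, radius and threshold. A triple that fails to escape gives
     the empty set, so every index yields an open set and a finite subcover yields finitely many
     thresholds. *)
  destruct (HK (C * R * R)%type (fun i y => cball (fst (fst i)) (snd (fst i)) y /\
    escapes G c (fst (fst i)) (snd (fst i)) (snd i))) as [l Hl].
  - intros i. apply open_copen. intros z [Hz He]. destruct (cball_open _ _ z Hz) as (r & Hr & H).
    exists r. auto.
  - intros z Hz. assert (H : exists r X, 0 < r /\ escapes G c z r X).
    { destruct (Hm z (HKO z Hz)); [apply escapes_regular|apply escapes_pole]; auto. }
    destruct H as (r & X & Hr & H). exists (z, r, X). simpl. split; auto. apply cball_center, Hr.
  - assert (HX : exists X, forall i, In i l -> snd i <= X).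
    { clear. induction l as [|i l [X HX]].
      - exists 0. intros i [].
      - exists (Rmax (snd i) X). intros j [<-|Hj]; [apply Rmax_l|].
        eapply Rle_trans; [apply HX, Hj|apply Rmax_r]. }
    destruct HX as [X HX]. exists X. intros w Hw HXw Hk.
    destruct (Hl _ Hk) as (i & Hi & Hb & He). apply (He w); auto. specialize (HX i Hi). lra.
Qed.

End Escape.

(** * The linearizing coordinate *)

Lemma gder_neg {T : Type} (phi f : T -> C) (x : T) (l : C) :
  gder phi f x (- l)%C -> gder phi (fun y => - f y)%C x l.
Proof. intros H. eapply gder_eq; [|apply gder_opp, H]. ring. Qed.

Lemma cder_shift (f : C -> C) (w l : C) (t : R) : cder f (w + RtoC t)%C l ->
  pder (fun s => f (w + RtoC s)%C) t l.
Proof.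
  intros H. eapply gder_eq.
  2:{ apply (gder_comp RtoC f (fun s => w + RtoC s)%C); [apply H|].
      apply gder_plus; [apply gder_const|apply gder_phi]. }
  ring.
Qed.

Section Linearization.
Variables (c1 : R) (h : C -> C).
Hypothesis Hh : hol (half_plane c1) h.
Hypothesis Hn : forall w, half_plane c1 w -> h w <> 0.
Hypothesis He : forall w, half_plane c1 w -> Cmod (cD h w + h w) <= Cmod (h w) / 20.

Lemma half_plane_shift (w : C) (t : R) : half_plane c1 w -> 0 <= t -> half_plane c1 (w + RtoC t)%C.
Proof. unfold half_plane, Re. simpl. lra. Qed.

(** A logarithm [L] of [h] has derivative [h' / h] within [/ 20] of -1. Decay and growth of [h] are
    both read off from this. *)
Lemma near_exponential : exists L : C -> C, forall x y, half_plane c1 x -> half_plane c1 y ->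
  Cmod (h x) = exp (Re (L x)) /\ Cmod ((L y + y) - (L x + x)) <= / 20 * Cmod (y - x).
Proof.
  destruct (logarithm _ h (good_half_plane c1) Hh Hn) as (L & HL & EL).
  exists L. intros x y Hx Hy. split; [rewrite <- Cmod_Cexp, EL; auto|].
  apply (mean_value (half_plane c1) (fun z => L z + z)%C (fun z => cD h z / h z + 1)%C); auto.
  - apply (good_half_plane c1).
  - intros z Hz. apply gder_plus; [apply HL, Hz|apply gder_phi].
  - intros z Hz. replace (cD h z / h z + 1)%C with ((cD h z + h z) * / h z)%C by (field; auto).
    rewrite Cmod_mult, Cmod_inv by auto. assert (Hp := Cmod_pos _ (Hn z Hz)).
    apply Rmult_le_reg_r with (Cmod (h z)); [auto|]. rewrite Rmult_assoc, Rinv_l, Rmult_1_r by lra.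
    specialize (He z Hz). lra.
Qed.

Lemma decay (w : C) (t : R) : half_plane c1 w -> 0 <= t ->
  Cmod (h (w + RtoC t)%C) <= Cmod (h w) * exp (- (19 / 20) * t).
Proof.
  intros Hw Ht. destruct near_exponential as [L HL].
  assert (Hwt := half_plane_shift w t Hw Ht).
  destruct (HL w _ Hw Hwt) as [E1 E2]. destruct (HL _ _ Hwt Hw) as [E3 _].
  rewrite E1, E3, <- exp_plus.
  replace (w + t - w)%C with (RtoC t) in E2 by ring. rewrite Cmod_R, Rabs_pos_eq in E2 by auto.
  assert (E4 := Rle_trans _ _ _ (Re_le_Cmod _) E2). unfold Re in *; simpl in E4.
  destruct (Rle_lt_or_eq_dec (fst (L (w + t)%C)) (fst (L w) + - (19 / 20) * t)) as [H| ->].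
  - lra.
  - left. apply exp_increasing, H.
  - lra.
Qed.

Lemma growth (x y : C) : half_plane c1 x -> half_plane c1 y ->
  Cmod (h y) <= Cmod (h x) * exp (2 * Cmod (y - x)).
Proof.
  intros Hx Hy. destruct near_exponential as [L HL].
  destruct (HL x y Hx Hy) as [E1 E2]. destruct (HL y x Hy Hx) as [E3 _].
  rewrite E1, E3, <- exp_plus.
  assert (E4 := Rle_trans _ _ _ (Re_le_Cmod _) E2).
  assert (E5 := Re_le_Cmod (x - y)%C). rewrite Cmod_sym in E5.
  assert (E6 := Cmod_ge_0 (y - x)). unfold Re in *; simpl in E4, E5.
  destruct (Rle_lt_or_eq_dec (fst (L y)) (fst (L x) + 2 * Cmod (y - x))) as [H| ->].
  - lra.
  - left. apply exp_increasing, H.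
  - lra.
Qed.

(** Steps of length 2 give at least a halving, because [exp (19 / 10) >= 2]. *)
Lemma decay_even (w : C) (n : nat) : half_plane c1 w ->
  Cmod (h (w + RtoC (2 * INR n))%C) <= Cmod (h w) * (/ 2) ^ n.
Proof.
  intros Hw. induction n as [|n IH].
  - simpl. replace (w + RtoC (2 * 0))%C with w by (rewrite Rmult_0_r; ring). lra.
  - rewrite S_INR. assert (Hn0 := pos_INR n).
    replace (w + RtoC (2 * (INR n + 1)))%C with (w + RtoC (2 * INR n) + RtoC 2)%C
      by (rewrite Rmult_plus_distr_l, RtoC_plus; replace (2 * 1) with 2 by ring; ring).
    eapply Rle_trans; [apply decay; [apply half_plane_shift; auto; lra|lra]|].
    assert (E : exp (- (19 / 20) * 2) <= / 2).
    { replace (- (19 / 20) * 2) with (- (19 / 10)) by field. rewrite exp_Ropp.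
      apply Rinv_le_contravar; [lra|]. generalize (exp_ineq1_le (19 / 10)). lra. }
    simpl. generalize (Cmod_ge_0 (h (w + RtoC (2 * INR n))%C)) (exp_pos (- (19 / 20) * 2)). nra.
Qed.

(** The factor [20 / 19] is the integral of [exp (- (19 / 20) * s)] over the half-line. *)
Lemma dominated_curve (k dk : C -> C) (w : C) (A t : R) : half_plane c1 w -> 0 <= t ->
  (forall z, half_plane c1 z -> cder k z (dk z)) ->
  (forall z, half_plane c1 z -> Cmod (dk z) <= A * Cmod (h z)) -> 0 <= A ->
  Cmod (k (w + RtoC t)%C - k w) <= 20 / 19 * A * Cmod (h w).
Proof.
  intros Hw Ht Hk Hd HA. set (m := Cmod (h w)).
  assert (Hm : 0 <= m) by apply Cmod_ge_0.
  replace w with (w + RtoC 0)%C at 2 by ring.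
  apply Rle_trans with (- (20 / 19) * A * m * exp (- (19 / 20) * t)
    - - (20 / 19) * A * m * exp (- (19 / 20) * 0)).
  - apply (curve_bound (fun t => k (w + RtoC t)%C) (fun t => dk (w + RtoC t)%C)
      (fun t => - (20 / 19) * A * m * exp (- (19 / 20) * t))
      (fun t => A * (m * exp (- (19 / 20) * t)))); auto.
    + intros s Hs. apply cder_shift, Hk, half_plane_shift; auto; lra.
    + intros s _. auto_derive; auto. field.
    + intros s Hs. eapply Rle_trans; [apply Hd, half_plane_shift; auto; lra|].
      apply Rmult_le_compat_l; [auto|]. apply decay; auto; lra.
  - rewrite Rmult_0_r, exp_0. generalize (exp_pos (- (19 / 20) * t)).
    assert (0 <= A * m) by nra. nra.
Qed.

(* [Phi w] is the integral of [h] from [w] to infinity along a horizontal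
   line. *)
Lemma tail_integral : exists Phi : C -> C, forall w, half_plane c1 w ->
  cder Phi w (- h w)%C /\ Cmod (Phi w - h w) <= Cmod (h w) / 19.
Proof.
  destruct (primitive _ h (good_half_plane c1) Hh) as [H0 HH0].
  set (w0 := RtoC (c1 + 1)). assert (Hw0 : half_plane c1 w0) by (unfold half_plane, w0, Re; simpl; lra).
  set (S := fun (w : C) (n : nat) => (w + RtoC (2 * INR n))%C).
  assert (HS : forall w n, half_plane c1 w -> half_plane c1 (S w n)).
  { intros w n Hw. apply half_plane_shift; auto. generalize (pos_INR n). lra. }
  (* [l] is the value at infinity of the primitive [H0], first obtained along the points
     [w0 + 2 n]. *)
  destruct (geometric_limit (fun n => H0 (S w0 n)) (20 / 19 * Cmod (h w0))) as [l Hl].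
  { generalize (Cmod_ge_0 (h w0)). lra. }
  { intros n. unfold S at 1. rewrite S_INR.
    replace (w0 + RtoC (2 * (INR n + 1)))%C with (S w0 n + RtoC 2)%C
      by (unfold S; rewrite Rmult_plus_distr_l, RtoC_plus; replace (2 * 1) with 2 by ring; ring).
    eapply Rle_trans; [apply (dominated_curve H0 h (S w0 n) 1 2); auto; try lra|].
    - intros. lra.
    - generalize (decay_even w0 n Hw0). fold (S w0 n). lra. }
  (* The same [l] serves every starting point: [S w n] and [S w0 n] keep their distance [d], and by
     [growth] and [decay_even] the derivative [h] of [H0] decays like [(/ 2) ^ n] between them. *)
  assert (Hlim : forall w, half_plane c1 w -> exists K, 0 <= K /\
    forall n, Cmod (l - H0 (S w n)) <= K * (/ 2) ^ n).
  { intros w Hw. set (d := Cmod (w - w0)). set (m := Cmod (h w0)) in *.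
    assert (Hd : 0 <= d) by apply Cmod_ge_0. assert (Hm : 0 <= m) by apply Cmod_ge_0.
    assert (Hexp := exp_pos (2 * d)).
    exists (4 * (20 / 19 * m) + m * exp (2 * d) * d). split.
    { assert (0 <= m * exp (2 * d)) by nra. nra. }
    intros n.
    assert (B : Cmod (H0 (S w n) - H0 (S w0 n)) <= m * (/ 2) ^ n * exp (2 * d) * Cmod (S w n - S w0 n)).
    { apply (mean_value (fun z => half_plane c1 z /\ Cmod (z - S w0 n) <= d) H0 h).
      - intros x y t [Hx1 Hx2] [Hy1 Hy2] Ht. split; [apply (good_half_plane c1); auto|].
        apply convex_closed_ball; auto.
      - split; [apply HS, Hw0|]. replace (S w0 n - S w0 n)%C with (RtoC 0) by ring. rewrite Cmod_0. auto.
      - split; [apply HS, Hw|]. right. unfold d. f_equal. unfold S. ring.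
      - intros z [Hz _]. auto.
      - intros z [Hz1 Hz2]. eapply Rle_trans; [apply (growth (S w0 n) z); auto|].
        apply Rmult_le_compat.
        + apply Cmod_ge_0.
        + left; apply exp_pos.
        + apply decay_even, Hw0.
        + destruct Hz2 as [Hz2| ->]; [|lra]. left. apply exp_increasing. lra. }
    replace (S w n - S w0 n)%C with (w - w0)%C in B by (unfold S; ring). fold d in B.
    specialize (Hl n). cbv beta in Hl. rewrite Cmod_sym in Hl, B.
    generalize (Cmod_tri l (H0 (S w0 n)) (H0 (S w n))). lra. }
  exists (fun w => l - H0 w)%C. intros w Hw. split.
  { eapply gder_eq; [|apply gder_minus; [apply gder_const|apply HH0, Hw]]. ring. }
  apply le_epsilon. intros eps Heps. destruct (Hlim w Hw) as (K & HK & HKn).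
  assert (Hm : 0 <= Cmod (h w)) by apply Cmod_ge_0.
  destruct (half_pow_small (eps / (K + Cmod (h w) + 1))) as [n Hsm]; [apply Rdiv_lt_0_compat; lra|].
  apply (Rmult_lt_compat_l (K + Cmod (h w) + 1)) in Hsm; [|lra].
  replace ((K + Cmod (h w) + 1) * (eps / (K + Cmod (h w) + 1))) with eps in Hsm by (field; lra).
  (* [k] tends to 0 at infinity and [|k'| = |h' + h| <= |h| / 20]; integrating yields
     [20 / 19 * / 20 = / 19]. *)
  set (k := fun z => (l - H0 z - h z)%C).
  assert (Hn0 := pos_INR n).
  assert (B : Cmod (k (S w n) - k w) <= 20 / 19 * / 20 * Cmod (h w)).
  { apply (dominated_curve k (fun z => 0 - h z - cD h z)%C); auto; try lra.
    - intros z Hz. apply gder_minus; [|apply (hol_cD _ _ _ Hh Hz)].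
      apply gder_minus; [apply gder_const|apply HH0, Hz].
    - intros z Hz. replace (0 - h z - cD h z)%C with (- (cD h z + h z))%C by ring.
      rewrite Cmod_opp. specialize (He z Hz). lra. }
  assert (B2 : Cmod (k (S w n)) <= Cmod (l - H0 (S w n)) + Cmod (h (S w n))).
  { unfold k, Cminus at 1. eapply Rle_trans; [apply Cmod_triangle|]. rewrite Cmod_opp. lra. }
  specialize (HKn n). assert (Hde := decay_even w n Hw). fold (S w n) in Hde.
  generalize (Cmod_tri_inv (k w) (k (S w n))). rewrite (Cmod_sym (k w)).
  change (l - H0 w - h w)%C with (k w). generalize (half_pow_pos n). nra.
Qed.

(** With [psi = - log Phi] one has [psi' = h / Phi = h * Cexp psi]. The bound [/ 18] is the ratio of
    [|Phi - h| <= |h| / 19] to [|Phi| >= 18 / 19 * |h|]. *)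
Lemma linearization : exists psi : C -> C, forall w, half_plane c1 w ->
  cder psi w (h w * Cexp (psi w))%C /\ Cmod (h w * Cexp (psi w) - 1) <= / 18.
Proof.
  destruct tail_integral as [Phi HPhi].
  assert (Hlow : forall w, half_plane c1 w -> 18 / 19 * Cmod (h w) <= Cmod (Phi w)).
  { intros w Hw. destruct (HPhi w Hw) as [_ H]. rewrite Cmod_sym in H.
    generalize (Cmod_tri_inv (h w) (Phi w)). lra. }
  assert (HPn : forall w, half_plane c1 w -> Phi w <> 0).
  { intros w Hw. apply Cmod_gt_0. generalize (Hlow w Hw) (Cmod_pos _ (Hn w Hw)). lra. }
  destruct (logarithm _ Phi (good_half_plane c1)) as (L & HL & EL); auto.
  { intros w Hw. eexists. apply HPhi, Hw. }
  exists (fun w => - L w)%C. intros w Hw. destruct (HPhi w Hw) as [Hd Hc].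
  assert (E : (h w * Cexp (- L w))%C = (h w / Phi w)%C) by (rewrite Cexp_opp, EL by auto; reflexivity).
  rewrite E. split.
  - apply gder_neg. eapply gder_eq; [|apply HL, Hw]. rewrite (cD_unique _ _ _ Hd). field. auto.
  - replace (h w / Phi w - 1)%C with (- (Phi w - h w) * / Phi w)%C by (field; auto).
    rewrite Cmod_mult, Cmod_opp, Cmod_inv by auto.
    assert (Hp := Cmod_pos _ (HPn w Hw)). specialize (Hlow w Hw).
    apply Rmult_le_reg_r with (Cmod (Phi w)); [auto|]. rewrite Rmult_assoc, Rinv_l by lra. lra.
Qed.

End Linearization.

(** * Maps of a half-plane with derivative close to 1 *)

Section NearIdentity.
Variables (c1 : R) (psi dpsi : C -> C).
Hypothesis Hpsi : forall w, half_plane c1 w -> cder psi w (dpsi w).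
Hypothesis Hd : forall w, half_plane c1 w -> Cmod (dpsi w - 1) <= / 18.

Lemma near_identity (x y : C) : half_plane c1 x -> half_plane c1 y ->
  Cmod ((psi y - y) - (psi x - x)) <= / 18 * Cmod (y - x).
Proof.
  intros Hx Hy. apply (mean_value (half_plane c1) (fun z => psi z - z)%C (fun z => dpsi z - 1)%C); auto.
  - apply (good_half_plane c1).
  - intros z Hz. apply gder_minus; [auto|apply gder_phi].
Qed.

Lemma near_identity_inj : inj_on (half_plane c1) psi.
Proof.
  intros x y Hx Hy E. assert (H := near_identity x y Hx Hy). rewrite E in H.
  replace (psi y - y - (psi y - x))%C with (- (y - x))%C in H by ring. rewrite Cmod_opp in H.
  symmetry. apply Csub_eq, Cmod_zero. generalize (Cmod_ge_0 (y - x)). lra.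
Qed.

(** The target [z = (u, v)] is itself the centre for [quantitative_open], with slope 1 and radius
    [u - c1], the distance to the boundary. [psi] moves [z] by about [u / 18], less than the eighth
    of the radius that is allowed. The bound on [Re w] lets preimages go to infinity with [u]; the
    100 in [B] is slack. *)
Lemma near_identity_range (v : R) : exists B, forall u, B < u ->
  exists w, half_plane c1 w /\ psi w = (u, v) /\ u / 2 - B <= Re w.
Proof.
  set (w0 := RtoC (c1 + 1)). assert (Hw0 : half_plane c1 w0) by (unfold half_plane, w0, Re; simpl; lra).
  set (A := Cmod (psi w0 - w0)). assert (HA : 0 <= A) by apply Cmod_ge_0.
  assert (Hv := Rabs_pos v). assert (Hc := Rabs_pos c1). assert (Hc' := Rle_abs c1).
  assert (Hc'' := Rle_abs (- c1)). rewrite Rabs_Ropp in Hc''.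
  exists (100 * (A + Rabs v + Rabs c1 + 1)). intros u Hu.
  set (z := (u, v) : C). assert (Hz : half_plane c1 z) by (unfold half_plane, z, Re; simpl; lra).
  assert (Hzw : Cmod (z - w0) <= u - (c1 + 1) + Rabs v).
  { eapply Rle_trans; [apply Cmod_le_sum|]. unfold z, w0; simpl. rewrite Rabs_pos_eq by lra.
    replace (v + - 0) with v by ring. lra. }
  assert (Hb : forall w, half_plane c1 w -> Cmod (psi w - w) <= A + / 18 * Cmod (w - w0)).
  { intros w Hw. generalize (near_identity w0 w Hw0 Hw)
      (Cmod_tri_inv (psi w - w) (psi w0 - w0)). fold A. lra. }
  assert (H1 : Cmod 1 = 1) by (rewrite Cmod_R; apply Rabs_R1).
  destruct (quantitative_open psi dpsi z 1 z (u - c1)) as (w & Hw & E).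
  - intros E. apply RtoC_inj in E. lra.
  - intros w Hw. apply Hpsi. unfold cball in Hw. unfold half_plane.
    generalize (Re_le_Cmod (z - w)%C). rewrite Cmod_sym. unfold Re, z in *; simpl. lra.
  - intros w Hw. rewrite H1. apply Rle_trans with (/ 18); [|lra]. apply Hd. unfold cball in Hw. unfold half_plane.
    generalize (Re_le_Cmod (z - w)%C). rewrite Cmod_sym. unfold Re, z in *; simpl. lra.
  - rewrite H1, Cmod_sym. specialize (Hb z Hz). lra.
  - unfold cball in Hw.
    assert (Hwc : half_plane c1 w).
    { unfold half_plane. generalize (Re_le_Cmod (z - w)%C). rewrite Cmod_sym. unfold Re, z in *; simpl. lra. }
    exists w. split; [auto|split; [auto|]].
    specialize (Hb w Hwc). rewrite E in Hb.
    generalize (Re_le_Cmod (z - w)%C) (Cmod_tri w z w0). rewrite (Cmod_sym w z).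
    unfold Re, z in *; simpl. lra.
Qed.

End NearIdentity.

(** * Explicit flow lines *)

Definition twopik (k : nat) : R := 2 * PI * INR k.

Lemma Cexp_log_line (k : nat) (t : R) : t < 0 -> Cexp (- ln (- t), twopik k) = RtoC (/ (- t)).
Proof.
  intros Ht.
  replace ((- ln (- t), twopik k) : C) with (RtoC (- ln (- t)) + RtoC (INR k) * twopii)%C.
  - rewrite Cexp_plus, Cexp_2pii_mult, Cexp_cis. unfold Re, Im; simpl.
    rewrite cis_0, exp_Ropp, exp_ln by lra. ring.
  - unfold twopik. apply injective_projections; simpl; ring.
Qed.

(* In the coordinate [psi], with [psi' = G' exp (psi - w)], the flow
   [dw/dt = exp w / G' w] becomes [d psi/dt = exp psi], with explicit solutions
   [- log (- t) + 2 pi i k]. *)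
Theorem flow_lines (G : C -> C) (c : R) : hol (half_plane c) G -> inj_on (half_plane c) G ->
  exists (w : nat -> R -> C) (t0 : nat -> R), forall k,
    t0 k < 0 /\
    (forall t, t0 k < t < 0 -> c < Re (w k t) /\ pder (fun s => G (w k s)) t (Cexp (w k t))) /\
    (forall X, exists t1, t1 < 0 /\ forall t, t0 k < t < 0 -> t1 < t -> X < Re (w k t)) /\
    (forall m t, m <> k -> t0 m < t < 0 -> t0 k < t < 0 -> w m t <> w k t).
Proof.
  intros HG HI. destruct (good_half_plane c) as (HO & _ & _).
  assert (HK : 0 < distortion_const) by (unfold distortion_const; generalize PI_RGT_0; lra).
  (* To the right of [c1] the distortion bound makes [|G'' / G'| <= / 20], the hypothesis of
     [linearization]. *)
  set (c1 := c + 20 * distortion_const).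
  assert (Hc1 : forall w, half_plane c1 w -> half_plane c w) by (unfold half_plane, c1; intros; lra).
  assert (HG1 : forall w, half_plane c w -> cD G w <> 0).
  { intros w Hw. apply (univalent_deriv (half_plane c)); auto. }
  set (h := fun w => (Cexp (- w) * cD G w)%C).
  assert (Hh : forall w, half_plane c w -> cder h w (Cexp (- w) * cD (cD G) w - h w)%C).
  { intros w Hw. eapply gder_eq.
    2:{ apply gder_mult; [|apply (hol_cD_cD _ _ _ HO HG Hw)].
        apply (gder_comp _ Cexp (fun w => - w)%C); [apply cder_Cexp|]. apply gder_opp, gder_phi. }
    unfold h. cbv beta. ring. }
  destruct (linearization c1 h) as [psi Hpsi].
  { intros w Hw. eexists. apply Hh; auto. }
  { intros w Hw. apply Cmult_neq_0; [apply Cexp_neq_0|auto]. }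
  { intros w Hw. rewrite (cD_unique _ _ _ (Hh w (Hc1 w Hw))).
    replace (Cexp (- w) * cD (cD G) w - h w + h w)%C with (Cexp (- w) * cD (cD G) w)%C by ring.
    unfold h. rewrite !Cmod_mult.
    assert (B := univalent_distortion G c w HG HI (Hc1 w Hw)).
    assert (B2 : distortion_const / (Re w - c) <= / 20).
    { unfold half_plane, c1 in Hw. apply Rmult_le_reg_r with (Re w - c); [lra|].
      unfold Rdiv. rewrite Rmult_assoc, Rinv_l by lra. lra. }
    assert (B3 := Cmod_ge_0 (cD G w)).
    unfold Rdiv at 1. rewrite Rmult_assoc. apply Rmult_le_compat_l; [apply Cmod_ge_0|].
    eapply Rle_trans; [apply B|]. rewrite Rmult_comm. apply Rmult_le_compat_l; auto. }
  set (dpsi := fun w => (h w * Cexp (psi w))%C).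
  assert (H1 : forall w, half_plane c1 w -> cder psi w (dpsi w)) by (intros w Hw; apply Hpsi, Hw).
  assert (H2 : forall w, half_plane c1 w -> Cmod (dpsi w - 1) <= / 18) by (intros w Hw; apply Hpsi, Hw).
  assert (Hinj := near_identity_inj c1 psi dpsi H1 H2).
  destruct (univalent_inverse (half_plane c1) psi) as (W & HW1 & _ & HW2); auto.
  { apply (good_half_plane c1). }
  { intros w Hw. eauto. }
  destruct (choice (fun (k : nat) (B : R) => forall u, B < u ->
    exists w, half_plane c1 w /\ psi w = (u, twopik k) /\ u / 2 - B <= Re w)) as [B HB].
  { intros k. apply (near_identity_range c1 psi dpsi H1 H2). }
  (* After the time [- exp (- B k)] the abscissa [- ln (- t)] exceeds [B k], so the line is in the
     range of [psi]. *)
  exists (fun k t => W (- ln (- t), twopik k)), (fun k => - exp (- B k)). intros k.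
  assert (Hdom : forall k t, - exp (- B k) < t < 0 -> B k < - ln (- t)).
  { intros j t [Ht1 Ht2]. assert (Hl : ln (- t) < - B j); [|lra].
    rewrite <- (ln_exp (- B j)). apply ln_increasing; lra. }
  assert (Hw : forall k t, - exp (- B k) < t < 0 -> exists w, half_plane c1 w /\
    psi w = (- ln (- t), twopik k) /\ W (- ln (- t), twopik k) = w /\ - ln (- t) / 2 - B k <= Re w).
  { intros j t Ht. destruct (HB j _ (Hdom j t Ht)) as (w & Hw & E & Hr).
    exists w. repeat split; auto. rewrite <- E. auto. }
  split; [generalize (exp_pos (- B k)); lra|split; [|split]].
  - intros t Ht. destruct (Hw k t Ht) as (w & Hwc & E & EW & _). rewrite EW.
    split; [apply Hc1, Hwc|].
    assert (D1 : pder (fun s => (- ln (- s), twopik k) : C) t (/ (- t), 0)).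
    { apply pder_pair; [|apply (is_derive_const (V := R_NormedModule))].
      auto_derive; [lra|]. field. lra. }
    assert (D2 : cder W (- ln (- t), twopik k) (/ dpsi w)%C).
    { rewrite <- E, <- (cD_unique _ _ _ (H1 w Hwc)). apply HW2, Hwc. }
    assert (D3 : cder G w (cD G w)) by (apply (hol_cD _ _ _ HG), Hc1, Hwc).
    assert (D12 := gder_comp RtoC W (fun s => (- ln (- s), twopik k) : C) t _ _ D2 D1).
    rewrite <- EW in D3.
    assert (D := gder_comp RtoC G (fun s => W (- ln (- s), twopik k)) t _ _ D3 D12).
    (* The factors [cD G w] and [/ (- t) = Cexp (psi w)] cancel against [dpsi w] and leave
       [Cexp w]. *)
    eapply gder_eq; [|apply D]. rewrite EW. unfold dpsi, h. rewrite E, Cexp_log_line, Cexp_opp by lra.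
    change ((/ - t, 0) : C) with (RtoC (/ - t)). rewrite RtoC_inv by lra.
    field. repeat split; auto using Cexp_neq_0.
    intros Z. apply (f_equal fst) in Z. simpl in Z. lra.
  - intros X. exists (- exp (- (2 * (X + B k) + 1))). split; [generalize (exp_pos (- (2 * (X + B k) + 1))); lra|].
    intros t Ht Ht1. destruct (Hw k t Ht) as (w & Hwc & E & EW & Hr). rewrite EW.
    assert (Hl : ln (- t) < - (2 * (X + B k) + 1)).
    { rewrite <- (ln_exp (- (2 * (X + B k) + 1))). apply ln_increasing; lra. }
    lra.
  (* Only equal times are compared here; meetings at different times are left to [meeting_time]. *)
  - intros m t Hm Htm Htk E. destruct (Hw m t Htm) as (w & Hwc & Ew & EW & _).
    destruct (Hw k t Htk) as (w' & Hwc' & Ew' & EW' & _). rewrite EW, EW' in E. subst w'.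
    rewrite Ew in Ew'. apply (f_equal snd) in Ew'. simpl in Ew'. unfold twopik in Ew'.
    apply Hm, INR_eq. generalize PI_RGT_0. nra.
Qed.

(** * Uniqueness and maximal trajectories *)

(** Real induction: the supremum of the initial segments on which [P] holds satisfies [P] by the
    limit clause and cannot precede [b] by the step clause. *)
Lemma interval_induction (P : R -> Prop) (a b : R) : a <= b -> P a ->
  (forall t, a < t <= b -> (forall s, a <= s < t -> P s) -> P t) ->
  (forall t, a <= t < b -> P t -> exists d, 0 < d /\ forall s, t < s < t + d -> s <= b -> P s) ->
  P b.
Proof.
  intros Hab Ha Hlim Hstep.
  set (E := fun s => a <= s <= b /\ forall r, a <= r <= s -> P r).
  destruct (completeness E) as [m [Hm1 Hm2]].
  { exists b. intros s [Hs _]. lra. }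
  { exists a. split; [lra|]. intros r Hr. replace r with a by lra. auto. }
  assert (Ham : a <= m).
  { apply Hm1. split; [lra|]. intros r Hr. replace r with a by lra. auto. }
  assert (Hmb : m <= b) by (apply Hm2; intros s [Hs _]; lra).
  assert (Hlt : forall r, a <= r < m -> P r).
  { intros r Hr. apply NNPP. intros N. assert (m <= r); [|lra].
    apply Hm2. intros s [Hs HP]. apply Rnot_lt_le. intros Hrs. apply N, HP. lra. }
  assert (HPm : P m).
  { destruct (Req_dec a m) as [<-|Hn]; auto. apply Hlim; auto. lra. }
  destruct (Req_dec m b) as [<-|Hn]; auto. exfalso.
  destruct (Hstep m ltac:(lra) HPm) as [d [Hd Hs]].
  set (q := Rmin b (m + d / 2)).
  assert (Hq : m < q) by (apply Rmin_glb_lt; lra).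
  assert (q <= m); [|lra]. apply Hm1. split; [split; [lra|apply Rmin_l]|].
  intros r Hr. destruct (Rlt_le_dec r m) as [H|H]; [apply Hlt; lra|].
  destruct (Req_dec r m) as [->|Hrm]; auto. apply Hs.
  - assert (q <= m + d / 2) by apply Rmin_r. lra.
  - assert (q <= b) by apply Rmin_l. lra.
Qed.

Lemma curve_compact (k : R -> C) (a b : R) : a <= b -> pcont_on k a b ->
  compact_set (T := C_UniformSpace) (fun z => exists t, a <= t <= b /\ k t = z).
Proof.
  intros Hab Hk I A HA Hcov.
  assert (Hloc : forall t, a <= t <= b -> exists i d, 0 < d /\
    forall s, Rabs (s - t) < d -> A i (k s)).
  { intros t Ht. destruct (Hcov (k t)) as [i Hi]; [eauto|].
    destruct (proj1 (open_copen _) (HA i) _ Hi) as [r [Hr Hb]].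
    destruct (Hk t Ht r Hr) as [d [Hd H1]]. exists i, d. split; auto. intros s Hs. apply Hb, H1.
    rewrite Cmod_RtoC_sub. auto. }
  set (P := fun t => exists l : list I, forall s, a <= s <= t -> exists i, In i l /\ A i (k s)).
  assert (HP : P b).
  { apply (interval_induction P a b Hab).
    - destruct (Hloc a ltac:(lra)) as (i & d & Hd & H). exists (i :: nil). intros s Hs.
      exists i. split; [left; auto|]. apply H. replace (s - a) with 0 by lra. rewrite Rabs_R0. auto.
    - intros t Ht HPs. destruct (Hloc t ltac:(lra)) as (i & d & Hd & H).
      destruct (HPs (Rmax a (t - d / 2))) as [l Hl].
      { split; [apply Rmax_l|]. apply Rmax_lub_lt; lra. }
      exists (i :: l). intros s Hs. destruct (Rle_lt_dec s (Rmax a (t - d / 2))) as [H1|H1].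
      + destruct (Hl s ltac:(lra)) as (j & Hj & HAj). exists j. split; [right; auto|auto].
      + exists i. split; [left; auto|]. apply H. generalize (Rmax_r a (t - d / 2)).
        intros. apply Rabs_def1; lra.
    - intros t Ht [l Hl]. destruct (Hloc t ltac:(lra)) as (i & d & Hd & H).
      exists d. split; auto. intros s Hs _. exists (i :: l). intros r Hr.
      destruct (Rle_lt_dec r t) as [H1|H1].
      + destruct (Hl r ltac:(lra)) as (j & Hj & HAj). exists j. split; [right; auto|auto].
      + exists i. split; [left; auto|]. apply H. apply Rabs_def1; lra. }
  destruct HP as [l Hl]. exists l. intros z (t & Ht & <-). apply Hl, Ht.
Qed.

Lemma is_derive_Cmod_sqr (v : R -> C) (t : R) (dv : C) : pder v t dv ->
  is_derive (fun s => Cmod (v s) * Cmod (v s)) t (2 * Re (Cconj (v t) * dv)).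
Proof.
  intros H. assert (H1 := pder_Re v t dv 1 H). assert (H2 := pder_Re v t dv (- Ci)%C H).
  apply (is_derive_ext (fun s => Re (1 * v s) * Re (1 * v s) + Re (- Ci * v s) * Re (- Ci * v s))).
  - intros s. rewrite <- Re_Cconj_mult. unfold Re, Cconj, Cmult; simpl. ring.
  - replace (2 * Re (Cconj (v t) * dv)) with
      ((Re (1 * dv) * Re (1 * v t) + Re (1 * v t) * Re (1 * dv)) +
       (Re (- Ci * dv) * Re (- Ci * v t) + Re (- Ci * v t) * Re (- Ci * dv)))
      by (unfold Re, Cconj, Cmult; simpl; ring).
    apply (is_derive_plus (V := R_NormedModule));
      (apply (is_derive_mult (K := R_AbsRing)); auto; intros; apply Rmult_comm).
Qed.

(** [|v|^2 * exp (- 2 L t)] does not increase; the square is differentiable also where [v]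
    vanishes. *)
Lemma gronwall_zero (v dv : R -> C) (L a b : R) : a <= b ->
  (forall t, a <= t <= b -> pder v t (dv t) /\ Cmod (dv t) <= L * Cmod (v t)) ->
  v a = 0 -> v b = 0.
Proof.
  intros Hab H Ha.
  assert (Hu : Cmod (v b) * Cmod (v b) * exp (- (2 * L) * b) <= Cmod (v a) * Cmod (v a) * exp (- (2 * L) * a)).
  { apply (is_derive_nonincr (fun t => Cmod (v t) * Cmod (v t) * exp (- (2 * L) * t))
      (fun t => 2 * Re (Cconj (v t) * dv t) * exp (- (2 * L) * t) +
        Cmod (v t) * Cmod (v t) * (- (2 * L) * exp (- (2 * L) * t)))); auto.
    - intros t Ht. apply (is_derive_mult (K := R_AbsRing) (fun t => Cmod (v t) * Cmod (v t))
        (fun t => exp (- (2 * L) * t))).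
      + apply is_derive_Cmod_sqr, H, Ht.
      + auto_derive; auto. ring.
      + intros; apply Rmult_comm.
    - intros t Ht. destruct (H t Ht) as [_ Hd].
      assert (HR := Re_le_Cmod (Cconj (v t) * dv t)). rewrite Cmod_mult, Cmod_conj in HR.
      assert (H0 := Cmod_ge_0 (v t)). assert (He := exp_pos (- (2 * L) * t)).
      assert (Re (Cconj (v t) * dv t) <= L * Cmod (v t) * Cmod (v t)) by nra. nra. }
  rewrite Ha, Cmod_0 in Hu. apply Cmod_zero, Rnot_lt_le. intros HL.
  assert (0 < Cmod (v b) * Cmod (v b) * exp (- (2 * L) * b))
    by (repeat apply Rmult_lt_0_compat; auto using exp_pos).
  lra.
Qed.

(** With [sg] equal to -1 this is the time-reversed flow, so backward uniqueness is forward
    uniqueness for reflected curves. *)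
Definition flows (Omega : C -> Prop) (f : C -> Cbar) (sg : C) (x : R -> C) (t : R) : Prop :=
  Omega (x t) /\ exists v, f (x t) = Some v /\ pder x t (sg * v)%C.

Section Uniqueness.
Variables (Omega : C -> Prop) (f : C -> Cbar).
Hypothesis Hm : meromorphic_on Omega f.

Lemma locally_lipschitz (z v : C) : Omega z -> f z = Some v -> exists (g : C -> C) r L, 0 < r /\ 0 <= L /\
  (forall y, cball z r y -> f y = Some (g y)) /\
  (forall x y, cball z r x -> cball z r y -> Cmod (g y - g x) <= L * Cmod (y - x)).
Proof.
  intros Hz Hv. destruct (Hm z Hz) as [[g Hg]|[E _]]; [|congruence].
  apply locally_cball in Hg. destruct Hg as (r & Hr & Hg).
  assert (Hh : hol (cball z r) g).
  { intros y Hy. apply C_differentiable_cder, Hg, Hy. }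
  destruct (hol_cD_continuous _ g z (cball_open z r) Hh (cball_center z r Hr) 1 ltac:(lra)) as (d & Hd & H1).
  exists g, (Rmin r d), (Cmod (cD g z) + 1).
  assert (S1 : forall y, cball z (Rmin r d) y -> cball z r y)
    by (unfold cball; intros y Hy; eapply Rlt_le_trans; [apply Hy|apply Rmin_l]).
  split; [apply Rmin_pos; auto|split; [generalize (Cmod_ge_0 (cD g z)); lra|split]].
  - intros y Hy. apply Hg; auto.
  - intros x y Hx Hy. apply (mean_value (cball z (Rmin r d)) g (cD g)); auto.
    + apply convex_cball.
    + intros w Hw. apply (hol_cD _ _ _ Hh); auto.
    + intros w Hw. specialize (H1 w (Rlt_le_trans _ _ _ Hw (Rmin_r _ _))).
      generalize (Cmod_tri_inv (cD g w) (cD g z)). lra.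
Qed.

(** Real induction on the time of agreement: continuity handles limits, the local Lipschitz bound
    with Gronwall's inequality the steps forward. *)
Lemma flow_unique (sg : C) (x y : R -> C) (a b : R) : a <= b ->
  (forall t, a <= t <= b -> flows Omega f sg x t) ->
  (forall t, a <= t <= b -> flows Omega f sg y t) -> x a = y a -> x b = y b.
Proof.
  intros Hab Hx Hy Ha.
  assert (Cx : pcont_on x a b) by (intros t Ht; destruct (Hx t Ht) as (_ & v & _ & D); eapply gder_gcont, D).
  assert (Cy : pcont_on y a b) by (intros t Ht; destruct (Hy t Ht) as (_ & v & _ & D); eapply gder_gcont, D).
  apply (interval_induction (fun t => x t = y t) a b Hab Ha).
  - intros t Ht Hs. apply Csub_eq, Cmod_zero, Rnot_lt_le. intros HL.
    assert (Cxy : pcont (fun t => x t - y t)%C t) by (apply gcont_minus; [apply Cx|apply Cy]; lra).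
    destruct (Cxy _ HL) as (d & Hd & H1).
    set (s := Rmax a (t - d / 2)). assert (s < t) by (apply Rmax_lub_lt; lra).
    assert (a <= s) by apply Rmax_l. assert (t - d / 2 <= s) by apply Rmax_r.
    specialize (H1 s). rewrite Cmod_RtoC_sub in H1.
    specialize (H1 ltac:(apply Rabs_def1; lra)). rewrite (Hs s ltac:(lra)), Cmod_sym in H1.
    replace (y s - y s)%C with (RtoC 0) in H1 by ring.
    replace (x t - y t - 0)%C with (x t - y t)%C in H1 by ring. lra.
  - intros t Ht E. destruct (Hx t ltac:(lra)) as (Ht1 & v & Hv & _).
    destruct (locally_lipschitz (x t) v Ht1 Hv) as (g & r & L & Hr & HL & Hg & Hlip).
    destruct (Cx t ltac:(lra) r Hr) as (d1 & Hd1 & H1).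
    destruct (Cy t ltac:(lra) r Hr) as (d2 & Hd2 & H2).
    exists (Rmin d1 d2). split; [apply Rmin_pos; auto|]. intros s Hs Hsb.
    assert (L1 := Rmin_l d1 d2). assert (L2 := Rmin_r d1 d2).
    assert (Bx : forall q, t <= q <= s -> cball (x t) r (x q)).
    { intros q Hq. apply H1. rewrite Cmod_RtoC_sub. apply Rabs_def1; lra. }
    assert (By : forall q, t <= q <= s -> cball (x t) r (y q)).
    { intros q Hq. unfold cball. rewrite E. apply H2. rewrite Cmod_RtoC_sub. apply Rabs_def1; lra. }
    apply Csub_eq.
    apply (gronwall_zero (fun q => x q - y q)%C (fun q => sg * (g (x q) - g (y q)))%C (Cmod sg * L) t s).
    + lra.
    + intros q Hq. split.
      * destruct (Hx q ltac:(lra)) as (_ & v1 & E1 & D1). destruct (Hy q ltac:(lra)) as (_ & v2 & E2 & D2).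
        rewrite (Hg _ (Bx q Hq)) in E1. rewrite (Hg _ (By q Hq)) in E2.
        injection E1 as <-. injection E2 as <-.
        eapply gder_eq; [|apply gder_minus; [apply D1|apply D2]]. ring.
      * rewrite Cmod_mult, Rmult_assoc. apply Rmult_le_compat_l; [apply Cmod_ge_0|]. auto.
    + rewrite E. ring.
Qed.

Lemma pder_reflect (x : R -> C) (t : R) (l : C) : pder x (- t) l -> pder (fun s => x (- s)) t (- l)%C.
Proof.
  intros H eps He. destruct (H eps He) as (d & Hd & H1). exists d. split; auto. intros s Hs.
  rewrite Cmod_RtoC_sub in *. specialize (H1 (- s)). rewrite Cmod_RtoC_sub in H1.
  replace (- s - - t) with (- (s - t)) in H1 by ring. rewrite Rabs_Ropp in H1. specialize (H1 Hs).
  replace (- l * (s - t))%C with (l * (RtoC (- s) - RtoC (- t)))%C by (rewrite !RtoC_opp; ring). exact H1.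
Qed.

Lemma flows_reflect (x : R -> C) (t : R) : flows Omega f 1 x (- t) -> flows Omega f (- (1)) (fun s => x (- s)) t.
Proof.
  intros (H & v & Hv & D). split; auto. exists v. split; auto.
  eapply gder_eq; [|apply pder_reflect, D]. ring.
Qed.

Lemma flow_unique_back (x y : R -> C) (a b : R) : a <= b ->
  (forall t, a <= t <= b -> flows Omega f 1 x t) ->
  (forall t, a <= t <= b -> flows Omega f 1 y t) -> x b = y b -> x a = y a.
Proof.
  intros Hab Hx Hy E. rewrite <- (Ropp_involutive a).
  apply (flow_unique (- (1))%C (fun s => x (- s)) (fun s => y (- s)) (- b) (- a)).
  - lra.
  - intros t Ht. apply flows_reflect, Hx. lra.
  - intros t Ht. apply flows_reflect, Hy. lra.
  - rewrite Ropp_involutive. auto.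
Qed.

Lemma in_dom_between (z : path) (s t r : R) : in_dom z s -> in_dom z t -> s <= r <= t -> in_dom z r.
Proof.
  intros [H1 _] [_ H2] Hr. split.
  - eapply Rbar_lt_le_trans; [apply H1|]. simpl. lra.
  - eapply Rbar_le_lt_trans; [|apply H2]. simpl. lra.
Qed.

Lemma in_dom_open (z : path) (t : R) : in_dom z t -> exists d, 0 < d /\ forall s, Rabs (s - t) < d -> in_dom z s.
Proof.
  intros [H1 H2].
  assert (E1 : exists d, 0 < d /\ forall s, t - s < d -> Rbar_lt (lo z) s).
  { destruct (lo z) as [u| |]; simpl in *.
    - exists (t - u). split; [lra|]. intros; lra.
    - contradiction.
    - exists 1. split; [lra|auto]. }
  assert (E2 : exists d, 0 < d /\ forall s, s - t < d -> Rbar_lt s (hi z)).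
  { destruct (hi z) as [u| |]; simpl in *.
    - exists (u - t). split; [lra|]. intros; lra.
    - exists 1. split; [lra|auto].
    - contradiction. }
  destruct E1 as (d1 & Hd1 & E1). destruct E2 as (d2 & Hd2 & E2).
  exists (Rmin d1 d2). split; [apply Rmin_pos; auto|]. intros s Hs. apply Rabs_def2 in Hs.
  generalize (Rmin_l d1 d2) (Rmin_r d1 d2). intros. split; [apply E1|apply E2]; lra.
Qed.

Lemma in_dom_exists (z : path) : Rbar_lt (lo z) (hi z) -> exists t, in_dom z t.
Proof.
  unfold in_dom. destruct (lo z) as [u| |], (hi z) as [w| |]; simpl; try tauto; intros H.
  - exists ((u + w) / 2). simpl. lra.
  - exists (u + 1). simpl. split; [lra|auto].
  - exists (w - 1). simpl. split; [auto|lra].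
  - exists 0. auto.
Qed.

Lemma solution_flows (z : path) (t : R) : solution Omega f z -> in_dom z t -> flows Omega f 1 z t.
Proof.
  intros [_ H] Ht. destruct (H t Ht) as (HO & v & Hv & D). split; auto. exists v. split; auto.
  apply pder_is_derive in D. eapply gder_eq; [|apply D]. ring.
Qed.

Lemma solution_unique (x y : path) (s t : R) : solution Omega f x -> solution Omega f y ->
  in_dom x s -> in_dom y s -> x s = y s -> in_dom x t -> in_dom y t -> x t = y t.
Proof.
  intros Hx Hy Hxs Hys E Hxt Hyt. destruct (Rle_dec s t) as [H|H].
  - apply (flow_unique 1%C x y s t H); auto; intros r Hr; apply solution_flows; auto.
    + apply (in_dom_between x s t); auto.
    + apply (in_dom_between y s t); auto.
  - apply (flow_unique_back x y t s); auto; [lra| |]; intros r Hr; apply solution_flows; auto.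
    + apply (in_dom_between x t s); auto.
    + apply (in_dom_between y t s); auto.
Qed.

Lemma extends_in_dom (y z : path) (t : R) : extends y z -> in_dom z t -> in_dom y t.
Proof.
  intros (H1 & H2 & _) [H3 H4]. split.
  - eapply Rbar_le_lt_trans; eauto.
  - eapply Rbar_lt_le_trans; eauto.
Qed.

Lemma extends_trans (x y z : path) : extends x y -> extends y z -> extends x z.
Proof.
  intros Hxy Hyz. assert (HD := extends_in_dom y z).
  destruct Hxy as (A1 & A2 & A3). assert (Hyz' := Hyz). destruct Hyz' as (B1 & B2 & B3).
  split; [eapply Rbar_le_trans; eauto|split; [eapply Rbar_le_trans; eauto|]].
  intros t Ht. rewrite A3, B3; auto.
Qed.

(** Any two extensions agree at a time [s0] of [z], hence wherever both are defined. Their union is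
    therefore a solution, living between the infimum of the left ends and the supremum of the right
    ends. *)
Lemma maximal_extension (z : path) : solution Omega f z ->
  exists Z, trajectory Omega f Z /\ extends Z z.
Proof.
  intros Hz. set (S := fun y => solution Omega f y /\ extends y z).
  assert (HSz : S z) by (split; [auto|split; [apply Rbar_le_refl|split; [apply Rbar_le_refl|auto]]]).
  destruct (Rbar_ex_glb (fun e => exists y, S y /\ e = lo y)) as [l [Hl1 Hl2]].
  destruct (Rbar_ex_lub (fun e => exists y, S y /\ e = hi y)) as [u [Hu1 Hu2]].
  destruct (in_dom_exists z (proj1 Hz)) as [s0 Hs0].
  set (Z := Path l u (fun t => epsilon (inhabits (RtoC 0)) (fun v => exists y : path, S y /\ in_dom y t /\ y t = v))).
  assert (Hcover : forall t, in_dom Z t -> exists y, S y /\ in_dom y t).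
  { intros t [Ht1 Ht2]. change (Rbar_lt l t) in Ht1. change (Rbar_lt t u) in Ht2. destruct (Rle_dec t s0) as [H|H].
    - assert (Hy : exists y, S y /\ Rbar_lt (lo y) t).
      { apply NNPP. intros N. apply (Rbar_lt_not_le _ _ Ht1). apply Hl2.
        intros e (y & HSy & ->). apply Rbar_not_lt_le. intros HH. apply N. eauto. }
      destruct Hy as (y & HSy & Hy). exists y. split; auto. split; auto.
      eapply Rbar_le_lt_trans; [|apply (extends_in_dom y z s0 (proj2 HSy) Hs0)]. simpl. lra.
    - assert (Hy : exists y, S y /\ Rbar_lt t (hi y)).
      { apply NNPP. intros N. apply (Rbar_lt_not_le _ _ Ht2). apply Hu2.
        intros e (y & HSy & ->). apply Rbar_not_lt_le. intros HH. apply N. eauto. }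
      destruct Hy as (y & HSy & Hy). exists y. split; auto. split; auto.
      eapply Rbar_lt_le_trans; [apply (extends_in_dom y z s0 (proj2 HSy) Hs0)|]. simpl. lra. }
  assert (Hval : forall y t, S y -> in_dom y t -> Z t = y t).
  { intros y t HSy Ht. simpl.
    destruct (epsilon_spec (inhabits (RtoC 0)) (fun v => exists y : path, S y /\ in_dom y t /\ y t = v))
      as (y' & HSy' & Ht' & <-); [eauto|].
    destruct HSy as [Sy Ey]. destruct HSy' as [Sy' Ey'].
    apply (solution_unique y' y s0 t); auto.
    - apply (extends_in_dom y' z); auto.
    - apply (extends_in_dom y z); auto.
    - transitivity (z s0); [apply Ey'|symmetry; apply Ey]; auto. }
  assert (HSdom : forall y, S y -> Rbar_le l (lo y) /\ Rbar_le (hi y) u).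
  { intros y HSy. split; [apply Hl1|apply Hu1]; eauto. }
  assert (HZz : extends Z z).
  { split; [apply HSdom, HSz|split; [apply HSdom, HSz|]]. intros t Ht. apply Hval; auto. }
  exists Z. split; [|auto]. split.
  - split.
    + simpl. eapply Rbar_le_lt_trans; [apply HSdom, HSz|].
      eapply Rbar_lt_le_trans; [apply Hz|apply HSdom, HSz].
    + intros t Ht. destruct (Hcover t Ht) as (y & HSy & Hy).
      destruct (proj2 (proj1 HSy) t Hy) as (HO & v & Hv & D).
      rewrite (Hval y t HSy Hy). split; auto. exists v. split; auto.
      apply pder_is_derive. apply pder_is_derive in D.
      destruct (in_dom_open y t Hy) as (d & Hd & Hdom).
      apply (gder_ext_loc RtoC y Z t v d Hd); auto.
      intros s Hs. rewrite Cmod_RtoC_sub in Hs. symmetry. apply Hval; auto.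
  - intros y Hy Hext. assert (HSy : S y) by (split; [auto|apply (extends_trans y Z z); auto]).
    destruct (HSdom y HSy) as [D1 D2]. destruct Hext as (E1 & E2 & _).
    split; apply Rbar_le_antisym; auto.
Qed.

Lemma path_pcont (z : path) (t : R) : solution Omega f z -> in_dom z t -> pcont z t.
Proof.
  intros Hz Ht. destruct (solution_flows z t Hz Ht) as (_ & v & _ & D). eapply gder_gcont, D.
Qed.

(** * Trajectories that leave all compact sets at time 0 *)

Definition ends_at_0 (z : path) : Prop := exists t0, t0 < 0 /\ (forall t, t0 < t < 0 -> in_dom z t) /\
  forall K0 : C -> Prop, compact_set (T := C_UniformSpace) K0 -> (forall w, K0 w -> Omega w) ->
    exists t1, t1 < 0 /\ forall t, t1 < t < 0 -> ~ K0 (z t).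

Lemma arc_compact (z : path) (a b : R) : solution Omega f z -> in_dom z a -> in_dom z b -> a <= b ->
  compact_set (T := C_UniformSpace) (fun w => exists t, a <= t <= b /\ z t = w) /\
  forall w, (exists t, a <= t <= b /\ z t = w) -> Omega w.
Proof.
  intros Hz Ha Hb Hab. split.
  - apply curve_compact; auto. intros t Ht. apply path_pcont; auto. apply (in_dom_between z a b); auto.
  - intros w (t & Ht & <-). apply (solution_flows z t Hz). apply (in_dom_between z a b); auto.
Qed.

(** A path living up to some [t >= 0] would run, just before 0, in a compact arc of [Omega] that it
    has to leave. *)
Lemma ends_at_0_neg (z : path) (t : R) : solution Omega f z -> ends_at_0 z -> in_dom z t -> t < 0.
Proof.
  intros Hz (t0 & Ht0 & Hdom & HK) Ht. apply Rnot_le_lt. intros Hle.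
  assert (Ha : in_dom z (t0 / 2)) by (apply Hdom; lra).
  destruct (arc_compact z (t0 / 2) t Hz Ha Ht ltac:(lra)) as [HC HO].
  destruct (HK _ HC HO) as (t1 & Ht1 & N).
  set (s := Rmax (t0 / 4) (t1 / 2)).
  assert (t0 / 4 <= s) by apply Rmax_l. assert (t1 / 2 <= s) by apply Rmax_r.
  assert (s < 0) by (apply Rmax_lub_lt; lra).
  apply (N s); [lra|]. exists s. split; auto. lra.
Qed.

(** The flow being autonomous, [x] delayed by [d = t - s] coincides with [y] from time [t] on. If
    [d > 0], then [y] near time 0 repeats [x] up to time [- d], which is a compact arc, although [y]
    leaves every compact set. *)
Lemma meeting_time (x y : path) (s t : R) : solution Omega f x -> solution Omega f y ->
  ends_at_0 x -> ends_at_0 y -> in_dom x s -> in_dom y t -> x s = y t -> s <= t ->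
  s = t /\ forall r, t <= r < 0 -> x r = y r.
Proof.
  intros Hx Hy Ex Ey Hs Ht E Hst.
  assert (Hs0 := ends_at_0_neg x s Hx Ex Hs). assert (Ht0 := ends_at_0_neg y t Hy Ey Ht).
  assert (Hdom : forall z q r, solution Omega f z -> ends_at_0 z -> in_dom z q -> q <= r < 0 -> in_dom z r).
  { intros z q r Hz (t0 & Ht0' & Hd & _) Hq Hr. set (m := Rmax (t0 / 2) r).
    assert (t0 / 2 <= m) by apply Rmax_l. assert (r <= m) by apply Rmax_r.
    assert (m < 0) by (apply Rmax_lub_lt; lra).
    apply (in_dom_between z q m); auto. apply Hd. lra. lra. }
  set (d := t - s).
  assert (Hag : forall r, t <= r < 0 -> x (r - d) = y r).
  { intros r Hr.
    apply (flow_unique 1%C (fun q => x (q - d)) y t r); [lra| | |].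
    - intros q Hq. assert (Hq' : in_dom x (q - d)) by (apply (Hdom x s); auto; unfold d; lra).
      destruct (solution_flows x _ Hx Hq') as (HO & v & Hv & D). split; auto. exists v. split; auto.
      intros eps He. destruct (D eps He) as (e & Hee & H1). exists e. split; auto. intros q2 Hq2.
      specialize (H1 (q2 - d)). rewrite Cmod_RtoC_sub in *.
      replace (q2 - d - (q - d)) with (q2 - q) in H1 by ring. specialize (H1 Hq2).
      replace (RtoC (q2 - d) - RtoC (q - d))%C with (RtoC q2 - RtoC q)%C in H1
        by (rewrite !RtoC_minus; ring). exact H1.
    - intros q Hq. apply solution_flows; auto. apply (Hdom y t); auto. lra.
    - replace (t - d) with s by (unfold d; ring). auto. }
  assert (Hd : s = t).
  { destruct (Req_dec s t) as [|Hne]; auto. exfalso. assert (Hd : 0 < d) by (unfold d; lra).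
    assert (H1 : in_dom x (- d)) by (apply (Hdom x s); auto; unfold d; lra).
    destruct (arc_compact x s (- d) Hx Hs H1 ltac:(unfold d; lra)) as [HC HO].
    destruct Ey as (t0 & _ & _ & HK). destruct (HK _ HC HO) as (t1 & Ht1 & N).
    set (r := Rmax t (t1 / 2)).
    assert (t <= r) by apply Rmax_l. assert (t1 / 2 <= r) by apply Rmax_r.
    assert (r < 0) by (apply Rmax_lub_lt; lra).
    apply (N r); [lra|]. exists (r - d). split; [unfold d in *; lra|]. apply Hag. lra. }
  split; auto. intros r Hr. rewrite <- Hag by auto. f_equal. unfold d. lra.
Qed.

End Uniqueness.

(** * Assembly of the trajectories *)

Theorem theorem1p3 (Omega : C -> Prop) (f : C -> Cbar)
    (M : R) (U : C -> Prop) (F : C -> C) :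
  is_domain Omega ->
  meromorphic_on Omega f ->
  0 < M ->
  is_domain U ->
  (forall z, U z -> Omega z) ->
  analytic_on U F ->
  (forall z, U z -> f z = Some (Cexp (F z))) ->
  maps_univalently_onto F U (half_plane (ln M)) ->
  exists z : nat -> path,
    (forall n, trajectory Omega f (z n) /\
               tends_to_boundary_in_finite_time Omega U (z n)) /\
    (forall m n, m <> n -> disjoint_paths (z m) (z n)).
Proof.
  intros _ Hm _ (_ & HUo & _) HUO HF HfF (_ & HI & Honto).
  apply open_copen in HUo. set (c := ln M) in *.
  assert (HFh : hol U F) by (intros z Hz; apply C_differentiable_cder, HF, Hz).
  destruct (univalent_inverse U F HUo HFh HI) as (G & HGF & _ & HGd).
  assert (HG : forall w, half_plane c w -> U (G w) /\ F (G w) = w).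
  { intros w Hw. apply Honto in Hw. destruct Hw as (z & Hz & <-). rewrite HGF; auto. }
  assert (HGh : hol (half_plane c) G).
  { intros w Hw. destruct (HG w Hw) as [Hu E]. rewrite <- E. eauto. }
  assert (HGi : inj_on (half_plane c) G).
  { intros x y Hx Hy E. rewrite <- (proj2 (HG x Hx)), <- (proj2 (HG y Hy)), E. reflexivity. }
  assert (HfG : forall w, half_plane c w -> f (G w) = Some (Cexp w)).
  { intros w Hw. destruct (HG w Hw) as [Hu E]. rewrite HfF, E by auto. reflexivity. }
  destruct (flow_lines G c HGh HGi) as (w & t0 & Hw).
  set (arc := fun k => Path (t0 k) 0 (fun t => G (w k t))).
  assert (Hdom : forall k t, in_dom (arc k) t <-> t0 k < t < 0) by (intros; unfold in_dom; simpl; tauto).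
  assert (Harc : forall k, solution Omega f (arc k)).
  { intros k. destruct (Hw k) as (Ht0 & H1 & _). split; [exact Ht0|].
    intros t Ht. apply Hdom in Ht. destruct (H1 t Ht) as [Hc D]. simpl. split; [apply HUO, HG, Hc|].
    exists (Cexp (w k t)). split; [apply HfG, Hc|]. apply pder_is_derive, D. }
  destruct (choice (fun k Z => trajectory Omega f Z /\ extends Z (arc k))) as [Z HZ].
  { intros k. apply (maximal_extension Omega f Hm), Harc. }
  assert (Hval : forall k t, t0 k < t < 0 -> in_dom (Z k) t /\ Z k t = G (w k t)).
  { intros k t Ht. destruct (HZ k) as [_ He]. assert (Hd : in_dom (arc k) t) by (apply Hdom; auto).
    split; [apply (extends_in_dom _ _ _ He Hd)|]. apply He, Hd. }
  (* The clause [t0 k <= t1] keeps later times on the explicit arc, and so inside [U]. *)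
  assert (Htend : forall k K0, compact_set (T := C_UniformSpace) K0 -> (forall w, K0 w -> Omega w) ->
    exists t1, t0 k <= t1 < 0 /\ forall t, t1 < t < 0 -> ~ K0 (Z k t)).
  { intros k K0 HK HKO. destruct (escapes_compact f G c HGh HGi HfG Omega K0 Hm HK HKO) as [X HX].
    destruct (Hw k) as (Ht0 & H1 & H2 & _). destruct (H2 X) as (t1 & Ht1 & H3).
    exists (Rmax (t0 k) t1). split; [split; [apply Rmax_l|apply Rmax_lub_lt; auto]|].
    intros t Ht. assert (L1 := Rmax_l (t0 k) t1). assert (L2 := Rmax_r (t0 k) t1).
    rewrite (proj2 (Hval k t ltac:(lra))). apply HX; [apply H1; lra|apply H3; lra]. }
  assert (Hends : forall k, ends_at_0 Omega (Z k)).
  { intros k. exists (t0 k). split; [apply Hw|split].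
    - intros t Ht. apply Hval, Ht.
    - intros K0 HK HKO. destruct (Htend k K0 HK HKO) as (t1 & Ht1 & H). exists t1. split; [lra|auto]. }
  exists Z. split.
  - intros k. split; [apply HZ|]. exists 0. intros K0 HK HKO.
    destruct (Htend k K0 HK HKO) as (t1 & Ht1 & H). exists t1. split; [lra|].
    intros t Ht. destruct (Hval k t ltac:(lra)) as [Hd E]. split; [auto|split; [|auto]].
    rewrite E. apply HG. apply (Hw k). lra.
  - assert (Hsol : forall k, solution Omega f (Z k)) by (intros k; apply HZ).
    assert (Hno : forall m n s t, m <> n -> in_dom (Z m) s -> in_dom (Z n) t -> Z m s = Z n t -> s <= t -> False).
    { intros m n s t Hmn Hs Ht E Hst.
      destruct (meeting_time Omega f Hm (Z m) (Z n) s t) as [_ Hag]; auto.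
      assert (Ht' := ends_at_0_neg Omega f (Z n) t (Hsol n) (Hends n) Ht).
      destruct (Hw m) as (Hm0 & Hm1 & _). destruct (Hw n) as (Hn0 & Hn1 & _ & Hn2).
      (* Halving a negative number moves it towards 0: [r] is later than the meeting time and lies
         on both explicit arcs. *)
      set (r := Rmax t (Rmax (t0 m) (t0 n)) / 2).
      assert (L1 := Rmax_l t (Rmax (t0 m) (t0 n))). assert (L2 := Rmax_r t (Rmax (t0 m) (t0 n))).
      assert (L3 := Rmax_l (t0 m) (t0 n)). assert (L4 := Rmax_r (t0 m) (t0 n)).
      assert (L5 : Rmax t (Rmax (t0 m) (t0 n)) < 0) by (repeat apply Rmax_lub_lt; auto).
      assert (Rm : t0 m < r < 0) by (unfold r; lra). assert (Rn : t0 n < r < 0) by (unfold r; lra).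
      apply (Hn2 m r Hmn Rm Rn). apply HGi; [apply Hm1, Rm|apply Hn1, Rn|].
      rewrite <- (proj2 (Hval m r Rm)), <- (proj2 (Hval n r Rn)). apply Hag. unfold r; lra. }
    intros m n Hmn z [(s & Hs & Es) (t & Ht & Et)]. destruct (Rle_dec s t) as [H|H].
    + apply (Hno m n s t); auto. congruence.
    + apply (Hno n m t s); auto; [congruence|lra].
Qed.
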